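(* For every integer $\ell\geq 2$ and every integer $r\geq 4$ the following holds asymptotically almost surely: for all $p=p(n)\geq n^{-(r-2)+\frac{1}{2\ell-1}+o(1)}$, $$ \mathrm{ex}\left(G_{n,p}^{(r)}, C_{2\ell}^{(r)}\right) \leq p\,n^{r-1+o(1)}.$$
   Context: An $r$-graph is an $r$-uniform hypergraph. $G_{n,p}^{(r)}$ is the random $r$-graph on $n$ labelled vertices in which each of the $\binom{n}{r}$ possible edges is present independently with probability $p=p(n)$. For $r$-graphs $G,H$, $\mathrm{ex}(G,H)$ is the maximum number of edges of a subgraph of $G$ containing no (not necessarily induced) copy of $H$. The linear cycle $C_k^{(r)}$ is the $r$-graph obtained from the graph cycle $C_k$ by adding, to each of its $k$ edges, $r-2$ new vertices of degree one (so that consecutive edges share exactly one vertex and non-consecutive edges are disjoint). ''Asymptotically almost surely'' means with probability tending to $1$ as $n\to\infty$. Every $o(1)$ term appearing in an exponent is a function of order $O(\log\log n/\log n)$ (depending only on $\ell,r$), i.e. it stands for a factor $(\log n)^{O(1)}$. *)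

(* Defs.v *)
From HB Require Import structures.
From mathcomp Require Import all_boot all_order all_algebra.
From mathcomp Require Import all_classical all_reals all_analysis.
Set Implicit Arguments.
Unset Strict Implicit.
Unset Printing Implicit Defensive.
Import Order.TTheory GRing.Theory Num.Theory.
Import numFieldNormedType.Exports.
Local Open Scope ring_scope.

(* A hypergraph on the finite vertex type [V] is its edge set
   [G : {set {set V}}]; it is an r-graph when [G \subset complete_rgraph V r]. *)
Definition complete_rgraph (V : finType) (r : nat) : {set {set V}} :=
  [set e : {set V} | #|e| == r].

(* Copies are not necessarily induced. *)
Definition contains_copy (W V : finType) (H : {set {set W}})
    (G : {set {set V}}) : bool :=
  [exists f : {ffun W -> V},
     injectiveb f && [forall e in H, (f @: e)%SET \in G]].

Definition turan_ex (W V : finType) (G : {set {set V}}) (H : {set {set W}}) : nat :=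
  \max_(F : {set {set V}} | (F \subset G) && ~~ contains_copy H F) #|F|.

(* [inl i] is the i-th vertex of the graph cycle C_k and [inr (i, j)] is the
   j-th of the r - 2 vertices added to its edge {i, i + 1 mod k}. *)
Definition linear_cycle_vertex (k r : nat) : finType :=
  ('I_k + 'I_k * 'I_(r - 2))%type.

Definition linear_cycle_edge (k r : nat) (i : 'I_k) :
    {set linear_cycle_vertex k r} :=
  [set inl i; inl (ordS i)] :|: [set inr (i, j) | j : 'I_(r - 2)].

Definition linear_cycle (k r : nat) : {set {set linear_cycle_vertex k r}} :=
  [set linear_cycle_edge r i | i : 'I_k].

(* The probability that the random r-graph G_{n,p}^{(r)} on the vertex set 'I_n
   satisfies [A]: an r-graph [G] has weight the product, over all r-subsets
   [e], of [p] or [1 - p] according to whether [e] is an edge of [G]. *)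
Definition Gnp_prob (R : realType) (r n : nat) (p : R)
    (A : pred {set {set 'I_n}}) : R :=
  \sum_(G : {set {set 'I_n}} | (G \subset complete_rgraph 'I_n r) && A G)
    \prod_(e in complete_rgraph 'I_n r) (if e \in G then p else 1 - p).

(* Main.v *)
(** The container method reduces the theorem to a balanced supersaturation statement: if an
    [r]-partite [r]-graph [G] has [n ^ (r - 1)] times a large power of [ln n] edges, then it carries
    a family [H] of linear cycles of length [k = 2 * l] with [#|H|] of order [#|G| * Q ^ (k - 1)]
    and in which every [j] edges lie in at most [Q ^ (k - j)] members, where [Q] is
    [#|G| / n ^ (1 + 1 / (2 * l - 1))] up to a power of [ln n].  Iterating, all cycle-free
    [r]-graphs are covered by [exp (n ^ (1 + 1 / (2 * l - 1) + o(1)))] containers with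
    [n ^ (r - 1 + o(1))] edges each, and a union bound concludes.

    For the supersaturation, take [H] maximal with the degree conditions.  If [H] is too small,
    few edges are saturated; delete them and regularize by dyadic pigeonholing.  As [r >= 4], some
    two coordinates [a], [b] have codegrees at most [n ^ (-2/3)] times the degrees.  Consider the
    closed walks of length [k] alternating between [a] and [b].  Those that repeat a vertex are
    negligible, and those containing a saturated set of edges in two or more arcs are negligible
    by the codegree bound.  When the saturated edges form one arc, they are counted by the trace of
    the product of a matrix with small row and column sums and of an even power of the adjacency
    matrix, so there are few of them by Schur's test and the log-convexity of the moments.  Hence
    some closed walk is a linear cycle without saturated subset, and [H] was not maximal. *)

Require Import Defs.
From HB Require Import structures.
From mathcomp Require Import all_boot all_order all_algebra.
From mathcomp Require Import all_classical all_reals all_analysis.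
From mathcomp Require Import zify ring lra.
From mathcomp Require Import fintype finset.
Set Implicit Arguments.
Unset Strict Implicit.
Unset Printing Implicit Defensive.
Import Order.TTheory GRing.Theory Num.Theory.
Import numFieldNormedType.Exports.
Local Open Scope nat_scope.

(** * Walks in a symmetric multigraph *)

(** Let [p <= q] be the degrees in the two parts; up to logarithms there are at least [(p * q) ^ l]
    closed walks of length [k = 2 * l]. The value of [Q] comes from the walks all of whose edges are
    saturated: there are about [n * p * Q ^ (k - 1)] of them, negligible once [p / Q] exceeds
    [n ^ (1 / (k - 1))]. If some edges are free, each arc of free edges is closed up by a codegree
    [de] instead of a degree and gains [nu = p / de]. Two arcs beat the factor [n] if [nu ^ 2]
    exceeds [n]. Counting edges gives [(2 * nu) ^ (r - 1) >= n ^ (r - 2)], so that [r = 3] would be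
    borderline, while [r >= 4] leaves room. A single free arc gains [nu] only once, which is too
    little when few edges are saturated. Hence the spectral argument: it compares with the actual
    number of closed walks, interpolating from length 2, and needs [n <= 2 * nu * n ^ ((l - 1) / (2
    * l - 1))]; for [l = 2] the gain [n ^ (2 / 3) / 2] in [nu] is just enough. *)

Section TupleSums.
Variable D : finType.
Implicit Types (F : seq D -> nat) (s : seq D).

(** The summand takes a plain sequence, so that walks can be concatenated, rotated and masked
    without casts between tuple types. *)
Definition tsum m F : nat := \sum_(u : m.-tuple D) F u.

Lemma tsum0 F : tsum 0 F = F [::].
Proof.
rewrite /tsum (big_pred1 [tuple]) // => u /=.
by apply/esym/eqP/tuple0.
Qed.

Lemma tsumS m F : tsum m.+1 F = \sum_d tsum m (fun s => F (d :: s)).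
Proof.
rewrite /tsum pair_big /=.
rewrite (reindex (fun x : D * m.-tuple D => cons_tuple x.1 x.2)) //=.
exists (fun u : m.+1.-tuple D => (thead u, behead_tuple u)).
  by case=> d u _ /=; rewrite theadE; congr pair; apply: val_inj.
by move=> u _; rewrite [u]tuple_eta; apply: val_inj.
Qed.

Lemma eq_tsum m F1 F2 : (forall s, size s = m -> F1 s = F2 s) -> tsum m F1 = tsum m F2.
Proof. by move=> eqF; apply: eq_bigr => u _; rewrite eqF // size_tuple. Qed.

Lemma leq_tsum m F1 F2 : (forall s, size s = m -> F1 s <= F2 s) -> tsum m F1 <= tsum m F2.
Proof. by move=> leF; apply: leq_sum => u _; rewrite leF // size_tuple. Qed.

Lemma tsum_sum (I : finType) (P : pred I) m (F : I -> seq D -> nat) :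
  tsum m (fun s => \sum_(i | P i) F i s) = \sum_(i | P i) tsum m (F i).
Proof. by rewrite /tsum exchange_big. Qed.

Lemma tsumZ m c F : tsum m (fun s => c * F s) = c * tsum m F.
Proof. by rewrite /tsum big_distrr. Qed.

Lemma tsumZr m c F : tsum m (fun s => F s * c) = tsum m F * c.
Proof. by rewrite /tsum big_distrl. Qed.

Lemma tsum_cat m1 m2 F :
  tsum (m1 + m2) F = tsum m1 (fun s1 => tsum m2 (fun s2 => F (s1 ++ s2))).
Proof.
elim: m1 F => [|m1 IH] F; first by rewrite tsum0.
by rewrite addSn !tsumS; apply: eq_bigr => d _; rewrite IH.
Qed.

Lemma tsum_rcons m F : tsum m.+1 F = \sum_d tsum m (fun s => F (rcons s d)).
Proof.
rewrite -addn1 tsum_cat -tsum_sum; apply: eq_tsum => s _.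
by rewrite tsumS; apply: eq_bigr => d _; rewrite tsum0 cats1.
Qed.

Lemma tsum_rot i m F : tsum m F = tsum m (fun s => F (rot i s)).
Proof.
rewrite /tsum (reindex (fun u : m.-tuple D => rot_tuple i u)) //=.
exists (fun u : m.-tuple D => rotr_tuple i u) => u _; apply: val_inj => /=.
  exact: rotK.
exact: rotrK.
Qed.

End TupleSums.

Section SquareSums.

Lemma leq_double_mul (x y : nat) : 2 * (x * y) <= x ^ 2 + y ^ 2.
Proof. exact: (nat_Cauchy x y). Qed.

Lemma sum_sqr_le (I : finType) (P : pred I) (f : I -> nat) :
  (\sum_(i | P i) f i) ^ 2 <= #|P| * \sum_(i | P i) f i ^ 2.
Proof.
rewrite -(leq_pmul2l (isT : 0 < 2)) -mulnn big_distrlr /=.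
have -> : 2 * (#|P| * \sum_(i | P i) f i ^ 2) =
    \sum_(i | P i) \sum_(j | P j) (f i ^ 2 + f j ^ 2).
  under [RHS]eq_bigr => i _ do rewrite big_split /= sum_nat_const.
  rewrite big_split /= sum_nat_const -big_distrr /=.
  by rewrite mul2n addnn.
rewrite big_distrr /=; apply: leq_sum => i _; rewrite big_distrr /=.
by apply: leq_sum => j _; apply: leq_double_mul.
Qed.

End SquareSums.

Section Walks.
Variables (D W : finType) (src tgt : D -> W) (E : {pred D}) (rv : D -> D).
Hypotheses (rvK : involutive rv) (srcrv : forall d, src (rv d) = tgt d)
  (Erv : forall d, (rv d \in E) = (d \in E)).

Fixpoint walk (w : W) (s : seq D) (w' : W) : bool :=
  if s is d :: s' then [&& d \in E, src d == w & walk (tgt d) s' w'] else w == w'.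

(** An entry of the [m]-th power of the adjacency matrix; [nclosed m] is then its trace. *)
Definition nwalks m w w' := tsum m (fun s => walk w s w').

Definition closed_walk s := [exists w, walk w s w].

Definition nclosed m := \sum_w nwalks m w w.

Lemma walk_cat w s1 s2 w' :
  walk w (s1 ++ s2) w' = \sum_z walk w s1 z * walk z s2 w' :> nat.
Proof.
elim: s1 w => [|d s1 IH] w /=.
  rewrite (bigD1 w) //= eqxx mul1n big1 ?addn0 // => z /negPf.
  by rewrite eq_sym => ->.
case: (d \in E) => /=; last by rewrite big1.
case: (src d == w) => /=; last by rewrite big1.
exact: IH.
Qed.

Lemma walk_rcons w s d w' :
  walk w (rcons s d) w' = [&& d \in E, walk w s (src d) & tgt d == w'].
Proof.
elim: s w => [|d' s IH] w /=.
  by rewrite [w == _]eq_sym.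
by rewrite IH; case: (d' \in E); case: (d \in E) => //=; rewrite ?andbF //= andbA.
Qed.

Lemma closed_walkE s : 0 < size s -> closed_walk s = \sum_w walk w s w :> nat.
Proof.
case: s => // d s _; rewrite (bigD1 (src d)) //= eqxx /=.
rewrite big1 => [|w /negPf]; last by rewrite eq_sym => -> ; rewrite andbF.
rewrite addn0; congr nat_of_bool; apply/existsP/idP => [[w] | h].
  by case/and3P=> -> /eqP <-.
by exists (src d); rewrite /= eqxx.
Qed.

Lemma nclosedE m : 0 < m -> nclosed m = tsum m (fun s => closed_walk s).
Proof.
move=> m0; rewrite /nclosed /nwalks -tsum_sum; apply: eq_tsum => s sz.
by rewrite closed_walkE ?sz.
Qed.

Lemma closed_walk_rot i s : closed_walk (rot i s) = closed_walk s.
Proof.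
case: s => [//|d0 s0]; have sz : 0 < size (d0 :: s0) by [].
move: (d0 :: s0) sz => s sz.
have inj : injective nat_of_bool by case; case.
apply: inj.
rewrite -{2}(cat_take_drop i s) /rot.
have h : size (take i s ++ drop i s) = size (drop i s ++ take i s).
  by rewrite !size_cat addnC.
rewrite !closed_walkE -?h ?cat_take_drop //.
under eq_bigr => w _ do rewrite walk_cat.
rewrite exchange_big /= -{3}(cat_take_drop i s); apply: eq_bigr => w _.
by rewrite walk_cat; apply: eq_bigr => z _; rewrite mulnC.
Qed.

Lemma nwalks_add m1 m2 w w' :
  nwalks (m1 + m2) w w' = \sum_z nwalks m1 w z * nwalks m2 z w'.
Proof.
rewrite /nwalks tsum_cat.
under eq_tsum => s _.
  under eq_tsum => s2 _ do rewrite walk_cat.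
  rewrite tsum_sum; under eq_bigr => z _ do rewrite tsumZ.
  over.
by rewrite tsum_sum; apply: eq_bigr => z _; rewrite tsumZr.
Qed.

Lemma nwalks0 w w' : nwalks 0 w w' = (w == w').
Proof. by rewrite /nwalks tsum0. Qed.

Lemma nwalks1 w w' : nwalks 1 w w' = #|[pred d in E | (src d == w) && (tgt d == w')]|.
Proof.
rewrite /nwalks tsumS -sum1_card [RHS]big_mkcond /=; apply: eq_bigr => d _.
rewrite tsum0 /= inE; by case: ifP => // ->.
Qed.

Lemma tgtrv d : tgt (rv d) = src d.
Proof. by rewrite -srcrv rvK. Qed.

Lemma nwalks1_sym w w' : nwalks 1 w w' = nwalks 1 w' w.
Proof.
rewrite !nwalks1 -!sum1_card (reindex rv) /=; last by exists rv => d _; apply: rvK.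
apply: eq_bigl => d; rewrite !inE Erv srcrv tgtrv.
by rewrite [(tgt d == w) && _]andbC.
Qed.

Lemma nwalks_sym m w w' : nwalks m w w' = nwalks m w' w.
Proof.
elim: m w w' => [|m IH] w w'; first by rewrite !nwalks0 eq_sym.
rewrite -[in LHS]add1n -[in RHS]addn1 !nwalks_add; apply: eq_bigr => z _.
by rewrite IH nwalks1_sym mulnC.
Qed.

Lemma nclosed_double m : nclosed (m + m) = \sum_w \sum_z nwalks m w z ^ 2.
Proof.
apply: eq_bigr => w _; rewrite nwalks_add; apply: eq_bigr => z _.
by rewrite (nwalks_sym m z) mulnn.
Qed.

Lemma schur_test (K : W -> W -> nat) s (f : W -> nat) :
    (forall w, \sum_z K w z <= s) -> (forall z, \sum_w K w z <= s) ->
  \sum_w \sum_z K w z * (f w * f z) <= s * \sum_w f w ^ 2.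
Proof.
move=> rK cK; rewrite -(leq_pmul2l (isT : 0 < 2)).
apply: (@leq_trans (\sum_w \sum_z (K w z * f w ^ 2 + K w z * f z ^ 2))).
  rewrite big_distrr /=; apply: leq_sum => w _; rewrite big_distrr /=.
  by apply: leq_sum => z _; rewrite mulnCA -mulnDr leq_mul2l leq_double_mul orbT.
under eq_bigr do rewrite big_split /=.
rewrite big_split /= mul2n -addnn leq_add //.
  rewrite big_distrr /=; apply: leq_sum => w _.
  by rewrite -big_distrl /= leq_mul2r rK orbT.
rewrite exchange_big big_distrr /=; apply: leq_sum => w _.
by rewrite -big_distrl /= leq_mul2r cK orbT.
Qed.

(** Evenness makes the power a Gram matrix: it is the sum over [y] of the rank-one matrices with
    entries [nwalks m y w * nwalks m y z], and Schur's test applies to each of them. *)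
Lemma schur_nclosed (K : W -> W -> nat) s m :
    (forall w, \sum_z K w z <= s) -> (forall z, \sum_w K w z <= s) ->
  \sum_w \sum_z K w z * nwalks (m + m) z w <= s * nclosed (m + m).
Proof.
move=> rK cK; rewrite nclosed_double big_distrr /=.
have -> : \sum_w \sum_z K w z * nwalks (m + m) z w =
    \sum_y \sum_w \sum_z K w z * (nwalks m y w * nwalks m y z).
  rewrite [RHS]exchange_big; apply: eq_bigr => w _.
  rewrite [RHS]exchange_big; apply: eq_bigr => z _ /=.
  rewrite nwalks_add -big_distrr /=; congr (_ * _); apply: eq_bigr => y _.
  by rewrite (nwalks_sym m z) mulnC.
by apply: leq_sum => y _; apply: schur_test.
Qed.

(** For the adjacency matrix [M] and a matrix [f] with columns indexed by [K], these are the entries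
    of [M ^ m * f], and [energy] is the squared Frobenius norm. The identity matrix yields the
    closed walks of length [2 * m]; a single column, the indicator of a set, yields their lower
    bound. *)
Definition evolve (K : finType) (f : W -> K -> nat) m w c := \sum_z nwalks m w z * f z c.
Definition energy (K : finType) (f : W -> K -> nat) m := \sum_w \sum_c evolve f m w c ^ 2.

Lemma evolveS (K : finType) (f : W -> K -> nat) m w c :
  evolve f m.+1 w c = \sum_z nwalks 1 w z * evolve f m z c.
Proof.
rewrite /evolve -add1n; under eq_bigr do rewrite nwalks_add big_distrl /=.
rewrite exchange_big; apply: eq_bigr => z _; rewrite big_distrr /=.
by apply: eq_bigr => y _; rewrite mulnA.
Qed.

Lemma energy_polar (K : finType) (f : W -> K -> nat) m :
  energy f m.+1 = \sum_w \sum_c evolve f m.+2 w c * evolve f m w c.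
Proof.
rewrite /energy exchange_big [RHS]exchange_big; apply: eq_bigr => c _ /=.
transitivity (\sum_w \sum_z nwalks 1 w z * (evolve f m z c * evolve f m.+1 w c)).
  apply: eq_bigr => w _; rewrite -mulnn {1}evolveS big_distrl /=.
  by apply: eq_bigr => z _; rewrite mulnA.
rewrite exchange_big; apply: eq_bigr => w _.
rewrite evolveS big_distrl /=; apply: eq_bigr => z _.
by rewrite nwalks1_sym -mulnA; congr (_ * _); rewrite mulnC.
Qed.

(** The arithmetic-geometric mean inequality, applied entrywise with the weights [x] and [y], stands
    in for the log-convexity of the energies: a ratio of at least [x / y] propagates without roots
    or divisions. *)
Lemma energy_ratio_step (K : finType) (f : W -> K -> nat) x y m : 0 < y ->
  x * energy f m <= y * energy f m.+1 -> x * energy f m.+1 <= y * energy f m.+2.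
Proof.
move=> y0 h.
have key : 2 * (x * y * energy f m.+1) <= y ^ 2 * energy f m.+2 + x ^ 2 * energy f m.
  rewrite energy_polar /energy !big_distrr -big_split /=; apply: leq_sum => w _.
  rewrite !big_distrr -big_split /=; apply: leq_sum => c _.
  have := leq_double_mul (y * evolve f m.+2 w c) (x * evolve f m w c).
  by rewrite !expnMn; congr (_ <= _); lia.
have h2 : x ^ 2 * energy f m <= x * y * energy f m.+1.
  by rewrite -mulnn -!mulnA leq_mul2l h orbT.
have h3 : y * (x * energy f m.+1) <= y * (y * energy f m.+2) by lia.
by rewrite leq_pmul2l in h3.
Qed.

Lemma energy_ratio (K : finType) (f : W -> K -> nat) x y m m' : 0 < y -> m <= m' ->
  x * energy f m <= y * energy f m.+1 -> x * energy f m' <= y * energy f m'.+1.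
Proof.
move=> y0 /subnK <-; elim: (m' - m) => [//|i IH] /IH; exact: energy_ratio_step.
Qed.

Lemma energy_growth (K : finType) (f : W -> K -> nat) x y m i : 0 < y ->
  x * energy f m <= y * energy f m.+1 -> x ^ i * energy f m <= y ^ i * energy f (m + i).
Proof.
move=> y0 h; elim: i => [|i IH]; first by rewrite addn0.
rewrite addnS !expnS -!mulnA.
apply: leq_trans (_ : x * (y ^ i * energy f (m + i)) <= _).
  by rewrite leq_mul2l IH orbT.
rewrite mulnCA [y * _]mulnCA leq_mul2l (energy_ratio _ _ h) ?orbT //; exact: leq_addr.
Qed.

(* By log-convexity the ratios of consecutive terms increase: either the one at [m - i] is at
   least [x / y], and so are all later ones, or it is not, and then no earlier one is. *)
Lemma energy_interpolation (K : finType) (f : W -> K -> nat) x y a m i :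
    0 < y -> a + i <= m ->
    x ^ (m - a) * energy f a <= y ^ (m - a) * energy f m ->
  x ^ i * energy f (m - i) <= y ^ i * energy f m.
Proof.
move=> y0 aim h.
have [ge|lt] := leqP (x * energy f (m - i)) (y * energy f (m - i).+1).
  by rewrite -[in X in _ <= X](@subnK i m) ?energy_growth //; lia.
have low j : a <= j <= m - i -> y * energy f j.+1 <= x * energy f j.
  move=> /andP[_ jm]; rewrite leqNgt; apply/negP => /ltnW c.
  by have := energy_ratio y0 jm c; lia.
have dec j : a + j <= m - i -> y ^ j * energy f (a + j) <= x ^ j * energy f a.
  elim: j => [|j IH] le; first by rewrite addn0.
  rewrite addnS !expnS -!mulnA mulnCA.
  apply: leq_trans (_ : y ^ j * (x * energy f (a + j)) <= _).
    by rewrite leq_mul2l low ?orbT //; lia.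
  by rewrite mulnCA leq_mul2l IH ?orbT //; lia.
have := dec (m - i - a); rewrite subnKC; last by lia.
move=> /(_ (leqnn _)) h2.
have : x ^ i * (y ^ (m - i - a) * energy f (m - i)) <= y ^ (m - a) * energy f m.
  apply: leq_trans h; rewrite (_ : m - a = i + (m - i - a)); last by lia.
  by rewrite expnD -mulnA leq_mul2l h2 orbT.
rewrite (_ : m - a = (m - i - a) + i); last by lia.
by rewrite expnD mulnCA -mulnA leq_pmul2l // expn_gt0 y0.
Qed.

Lemma energy_delta m : energy (fun w c : W => (w == c) : nat) m = nclosed (m + m).
Proof.
rewrite nclosed_double; apply: eq_bigr => w _; apply: eq_bigr => c _.
rewrite /evolve (bigD1 c) //= eqxx muln1 big1 ?addn0 // => z /negPf ->.
by rewrite muln0.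
Qed.

(** The comparison starts from length 2, not 0: the trace of the identity is [#|W|], whereas the
    closed walks of length 2 benefit from small codegrees. *)
Lemma nclosed_interpolation x y m i : 0 < y -> i < m ->
    x ^ m.-1 * nclosed 2 <= y ^ m.-1 * nclosed (m + m) ->
  x ^ i * nclosed ((m - i) + (m - i)) <= y ^ i * nclosed (m + m).
Proof.
move=> y0 im h; rewrite -!energy_delta; apply: (@energy_interpolation _ _ _ _ 1) => //.
by rewrite subn1 !energy_delta.
Qed.

(* [e ^ 2 / (#|A| * #|C|)] is at most the Rayleigh quotient of the indicator of [A] for the
   two-step operator. *)
Lemma nclosed_lower (A C : {set W}) e m :
    e <= \sum_(w in A) \sum_(z in C) nwalks 1 w z -> 0 < #|A| -> 0 < #|C| ->
  (e ^ 2) ^ m <= (#|A| * #|C|) ^ m * nclosed (m + m).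
Proof.
move=> he A0 C0.
have big_unitE (F : unit -> nat) : \sum_c F c = F tt by rewrite (big_pred1 tt) // => -[].
pose f (w : W) (c : unit) : nat := w \in A.
have e0 : energy f 0 = #|A|.
  rewrite /energy -sum1_card [RHS]big_mkcond /=; apply: eq_bigr => w _.
  rewrite big_unitE //= /evolve; under eq_bigr do rewrite nwalks0.
  rewrite (bigD1 w) //= eqxx mul1n big1 ?addn0 => [|z /negPf]; last by rewrite eq_sym => ->.
  by rewrite /f; case: (w \in A).
have e1 : e ^ 2 <= #|C| * energy f 1.
  have -> : energy f 1 = \sum_w (\sum_(z in A) nwalks 1 w z) ^ 2.
    apply: eq_bigr => w _; rewrite big_unitE /= /evolve [in RHS]big_mkcond /=.
    congr (_ ^ _); apply: eq_bigr => z _; rewrite /f.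
    by case: (z \in A); rewrite ?muln1 ?muln0.
  apply: leq_trans (_ : (\sum_(w in C) \sum_(z in A) nwalks 1 w z) ^ 2 <= _).
    rewrite leq_sqr; apply: leq_trans he _; rewrite exchange_big /=.
    by apply: leq_sum => z _; apply: leq_sum => w _; rewrite nwalks1_sym.
  apply: leq_trans (sum_sqr_le _ _) _; rewrite leq_mul2l; apply/orP; right.
  by rewrite [X in _ <= X](bigID (mem C)) /= leq_addr.
have h : e ^ 2 * energy f 0 <= (#|A| * #|C|) * energy f 1.
  by rewrite e0 mulnC -mulnA leq_mul2l e1 orbT.
have := @energy_growth _ f _ _ 0 m _ h; rewrite muln_gt0 A0 C0 => /(_ isT).
rewrite add0n e0 => h2.
have h3 : energy f m <= #|A| * nclosed (m + m).
  rewrite nclosed_double big_distrr /=; apply: leq_sum => w _.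
  rewrite big_unitE /= /evolve.
  have -> : \sum_z nwalks m w z * f z tt = \sum_(z in A) nwalks m w z.
    rewrite [RHS]big_mkcond /=; apply: eq_bigr => z _.
    by rewrite /f; case: (z \in A); rewrite ?muln1 ?muln0.
  apply: leq_trans (sum_sqr_le _ _) _; rewrite leq_mul2l; apply/orP; right.
  by rewrite [X in _ <= X](bigID (mem A)) /= leq_addr.
rewrite -(leq_pmul2l A0) mulnC; apply: leq_trans h2 _.
by rewrite mulnCA leq_mul2l h3 orbT.
Qed.

End Walks.

(** * Hypergraph containers *)

Section HypergraphDegrees.
Variable T : finType.
Implicit Types (H : {set {set T}}) (s e : {set T}).

Definition hdeg H s := #|[set e in H | s \subset e]|.

Lemma hdegU H1 H2 s : hdeg (H1 :|: H2) s <= hdeg H1 s + hdeg H2 s.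
Proof.
rewrite /hdeg -(leq_add2r #|[set e in H1 | s \subset e] :&: [set e in H2 | s \subset e]|).
rewrite -[X in _ <= X + _]cardsUI -addnA leq_add //; first last.
  by rewrite leq_addr.
by apply: subset_leq_card; apply/subsetP => e; rewrite !inE; case/andP=> /orP[] -> ->; rewrite ?orbT.
Qed.

Lemma hdegS H1 H2 s : H1 \subset H2 -> hdeg H1 s <= hdeg H2 s.
Proof.
move=> h; apply: subset_leq_card; apply/subsetP => e; rewrite !inE.
by case/andP=> /(subsetP h) -> ->.
Qed.

Lemma sum_hdeg H (P : pred {set T}) :
  \sum_(s | P s) hdeg H s = \sum_(e in H) #|[set s | P s && (s \subset e)]|.
Proof.
under eq_bigr => s _ do rewrite /hdeg -sum1_card.
rewrite (exchange_big_dep (mem H)) /=; last by move=> s e _; rewrite inE; case/andP.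
apply: eq_bigr => e eH; rewrite -sum1_card; apply: eq_bigl => s.
by rewrite !inE eH.
Qed.

Lemma sum_hdeg_le H (P : pred {set T}) k : (forall e, e \in H -> #|e| <= k) ->
  \sum_(s | P s) hdeg H s <= #|H| * 2 ^ k.
Proof.
move=> Hk; rewrite sum_hdeg -sum_nat_const; apply: leq_sum => e eH.
apply: leq_trans (_ : #|powerset e| <= _).
  by apply: subset_leq_card; apply/subsetP => s; rewrite !inE; case/andP.
by rewrite card_powerset leq_exp2l // Hk.
Qed.

Lemma card_le_sum_hdeg H (X : {set T}) :
  (forall e, e \in H -> ~~ [disjoint e & X]) -> #|H| <= \sum_(u in X) hdeg H [set u].
Proof.
move=> meet; under eq_bigr => u _ do rewrite /hdeg -sum1_card.
rewrite (exchange_big_dep (mem H)) /=; last by move=> s e _; rewrite inE; case/andP.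
rewrite -sum1_card; apply: leq_sum => e eH.
have /pred0Pn[u /andP[/= ue uX]] := meet e eH.
by rewrite (bigD1 u) //= uX inE eH sub1set.
Qed.

End HypergraphDegrees.

Section ContainerStep.
Variables (k A B C : nat).
Hypotheses (k0 : 0 < k) (A0 : 0 < A) (B0 : 0 < B).
(** [A'] allows for one batch of links on top of a degree still below its threshold. [B'] is such
    that, as long as the links are too few for the induction hypothesis, the edges of [H] that meet
    [S] or contain a saturated set make up at most a quarter of the lower bound [#|G| * Q ^ k / B]
    on [#|H|]. *)
Let A' := A.+1.
Let B' := 16 * A * B ^ 2 * 2 ^ k.+1.

(** For positive [C] the inequality on [c] is [#|c| <= (1 - 1 / C) * #|G|], written without
    division. *)
Definition containers_for (T : finType) (G : {set T}) (H : {set {set T}}) k Q C (F : {set {set T}}) :=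
  [/\ #|F| <= #|G|.+1 ^ (k * (#|G| %/ Q).+1),
      forall c, c \in F -> c \subset G /\ C * #|c| + #|G| <= C * #|G|
    & forall I : {set T}, I \subset G -> (forall e, e \in H -> ~~ (e \subset I)) ->
      exists2 c, c \in F & I \subset c].

Hypothesis IH : forall (T : finType) (G : {set T}) (H : {set {set T}}) Q, 0 < Q ->
  (forall e, e \in H -> e \subset G /\ #|e| = k) ->
  (forall s : {set T}, 0 < #|s| <= k -> hdeg H s <= A' * Q ^ (k - #|s|)) ->
  #|G| * Q ^ k.-1 <= B' * #|H| -> exists F, containers_for G H k Q C F.

Variables (T : finType) (G : {set T}) (H : {set {set T}}) (Q : nat).
Hypotheses (Q0 : 0 < Q) (Huni : forall e, e \in H -> e \subset G /\ #|e| = k.+1)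
  (Hdeg : forall s : {set T}, 0 < #|s| <= k.+1 -> hdeg H s <= A * Q ^ (k.+1 - #|s|))
  (Hbig : #|G| * Q ^ k <= B * #|H|).

(* In the decision tree, [X] is the set of vertices already examined, [S] the set of those put in
   the independent set and [L] the collection of links gathered so far. *)
Definition link_saturated (L : {set {set T}}) (s : {set T}) :=
  (0 < #|s| <= k) && (Q ^ (k - #|s|) <= hdeg L s).

(** Edges containing a saturated set are set aside, so that a set of vertices can pass its threshold
    only once, by the links of a single vertex. *)
Definition available (X : {set T}) (L : {set {set T}}) :=
  [set e in H | [disjoint e & X] & [forall s : {set T}, (s \subset e) ==> ~~ link_saturated L s]].

(** At a leaf every unexamined vertex has low degree, so the available edges make up at most a
    quarter of the lower bound on [#|H|], and those lost to [S] or to saturation another quarter.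
    The others meet the rejected vertices [X :\: S], each of degree at most [A * Q ^ k], so there
    must be many of these. *)
Lemma leaf_deleted_large (X S : {set T}) (L : {set {set T}}) :
    X \subset G -> S \subset X -> (forall e, e \in L -> #|e| = k) ->
    #|S| * Q ^ k <= 4 * B * #|L| -> B' * #|L| < #|G| * Q ^ k.-1 ->
    (forall u, u \in G :\: X -> 4 * B * hdeg (available X L) [set u] < Q ^ k) ->
  #|G| <= 4 * A * B * #|X :\: S|.
Proof.
move=> XG SX Lk hS small lowdeg.
pose H1 := [set e in H | ~~ [disjoint e & X :\: S]].
pose H2 := [set e in H | ~~ [disjoint e & S]].
pose H3 := \bigcup_(s | link_saturated L s) [set e in H | s \subset e].
have dH u : hdeg H [set u] <= A * Q ^ k.
  by have := @Hdeg [set u]; rewrite cards1 subn1 /=; apply.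
have c1 : #|H1| <= #|X :\: S| * (A * Q ^ k).
  apply: leq_trans (@card_le_sum_hdeg _ H1 (X :\: S) _) _ => [e|].
    by rewrite inE; case/andP.
  rewrite -sum_nat_const; apply: leq_sum => u _; apply: leq_trans (dH u).
  by apply: hdegS; apply/subsetP => e; rewrite inE; case/andP.
have c2 : #|H2| <= #|S| * (A * Q ^ k).
  apply: leq_trans (@card_le_sum_hdeg _ H2 S _) _ => [e|].
    by rewrite inE; case/andP.
  rewrite -sum_nat_const; apply: leq_sum => u _; apply: leq_trans (dH u).
  by apply: hdegS; apply/subsetP => e; rewrite inE; case/andP.
have c3 : #|H3| <= A * Q * (#|L| * 2 ^ k).
  apply: leq_trans (_ : \sum_(s | link_saturated L s) hdeg H s <= _).
    rewrite /H3; elim/big_rec2: _ => [|s m U _ le]; first by rewrite cards0.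
    by apply: leq_trans (leq_card_setU _ _) _; rewrite leq_add2l.
  apply: leq_trans (_ : \sum_(s | link_saturated L s) A * Q * hdeg L s <= _).
    apply: leq_sum => s /andP[/andP[s0 sk] sat].
    apply: leq_trans (Hdeg _) _; first by rewrite s0 (leq_trans sk).
    by rewrite subSn // expnS mulnA leq_mul2l sat orbT.
  rewrite -big_distrr leq_mul2l sum_hdeg_le ?orbT // => e /Lk ->; exact: leqnn.
have c4 : 4 * B * #|available X L| <= #|G| * Q ^ k.
  apply: leq_trans (_ : 4 * B * \sum_(u in G :\: X) hdeg (available X L) [set u] <= _).
    rewrite leq_mul2l card_le_sum_hdeg ?orbT // => e; rewrite inE => /and3P[eH disj _].
    have [eG ek] := Huni eH.
    have /card_gt0P[u ue] : 0 < #|e| by rewrite ek.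
    apply/pred0Pn; exists u; rewrite /= ue inE (subsetP eG) // andbT /=.
    by apply/negP => uX; move: disj => /pred0P /(_ u) /=; rewrite ue uX.
  rewrite big_distrr /=; apply: leq_trans (_ : \sum_(u in G :\: X) Q ^ k <= _).
    by apply: leq_sum => u /lowdeg /ltnW.
  by rewrite sum_nat_const leq_mul2r subset_leq_card ?orbT // subsetDl.
have cov : #|H| <= #|H1| + #|H2| + #|H3| + #|available X L|.
  apply: leq_trans (_ : #|H1 :|: H2 :|: H3 :|: available X L| <= _).
    apply: subset_leq_card; apply/subsetP => e eH; rewrite !inE eH /=.
    case: (boolP [disjoint e & X :\: S]) => //= d1.
    case: (boolP [disjoint e & S]) => //= d2.
    have -> : [disjoint e & X].
      rewrite disjoint_subset; apply/subsetP => u ue; rewrite inE; apply/negP => uX.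
      case uS : (u \in S); first by move/pred0P: d2 => /(_ u) /=; rewrite ue uS.
      by move/pred0P: d1 => /(_ u) /=; rewrite ue inE uS uX.
    case: (boolP [forall s : {set T}, (s \subset e) ==> ~~ link_saturated L s]); rewrite ?orbT //.
    rewrite negb_forall => /existsP[s]; rewrite negb_imply negbK => /andP[se sat].
    by rewrite orbF; apply/bigcupP; exists s => //; rewrite inE eH.
  by rewrite (leq_trans (leq_card_setU _ _)) // leq_add2r (leq_trans (leq_card_setU _ _)) // leq_add2r leq_card_setU.
have Qk : Q ^ k = Q * Q ^ k.-1 by rewrite -expnS prednK.
have Qk0 : 0 < Q ^ k by rewrite expn_gt0 Q0.
have small2 : B' * (#|L| * Q) <= #|G| * Q ^ k.
  by rewrite Qk [Q * _]mulnC !mulnA leq_mul2r ltnW ?orbT.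
have c2' : 4 * B * #|H2| <= 16 * A * B ^ 2 * (#|L| * Q).
  apply: leq_trans (_ : 4 * B * (A * (#|S| * Q ^ k)) <= _).
    by rewrite leq_mul2l (leq_trans c2) ?orbT // mulnCA.
  apply: leq_trans (_ : 4 * B * (A * (4 * B * #|L|)) <= _).
    by rewrite !leq_mul2l hS !orbT.
  rewrite (_ : 4 * B * (A * (4 * B * #|L|)) = 16 * A * B ^ 2 * #|L|); last by rewrite -mulnn; lia.
  by rewrite leq_mul2l leq_pmulr ?orbT.
have c3' : 4 * B * #|H3| <= 16 * A * B ^ 2 * 2 ^ k * (#|L| * Q).
  apply: leq_trans (_ : 4 * B * (A * Q * (#|L| * 2 ^ k)) <= _).
    by rewrite leq_mul2l c3 orbT.
  rewrite (_ : 4 * B * (A * Q * (#|L| * 2 ^ k)) = (4 * A * B) * (2 ^ k * (#|L| * Q))); last by lia.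
  rewrite -[16 * A * B ^ 2 * 2 ^ k * _]mulnA leq_mul2r; apply/orP; right.
  by rewrite -mulnn; nia.
have e23 : 16 * A * B ^ 2 * (#|L| * Q) + 16 * A * B ^ 2 * 2 ^ k * (#|L| * Q) <= B' * (#|L| * Q).
  rewrite -mulnDl leq_mul2r; apply/orP; right.
  rewrite /B' -[X in X + _]muln1 -mulnDr leq_mul2l; apply/orP; right.
  by rewrite expnS mul2n -addnn leq_add2r expn_gt0.
have fin : 4 * (#|G| * Q ^ k) <= 4 * A * B * #|X :\: S| * Q ^ k + 2 * (#|G| * Q ^ k).
  apply: leq_trans (_ : 4 * B * #|H| <= _); first by rewrite -mulnA leq_mul2l Hbig orbT.
  apply: leq_trans (_ : 4 * B * (#|H1| + #|H2| + #|H3| + #|available X L|) <= _).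
    by rewrite leq_mul2l cov orbT.
  have c1' : 4 * B * #|H1| <= 4 * A * B * #|X :\: S| * Q ^ k.
    rewrite (_ : 4 * A * B * #|X :\: S| * Q ^ k = 4 * B * (#|X :\: S| * (A * Q ^ k))); last by lia.
    by rewrite leq_mul2l c1 orbT.
  rewrite !mulnDr; lia.
have : #|G| * Q ^ k <= 4 * A * B * #|X :\: S| * Q ^ k by lia.
by rewrite leq_pmul2r.
Qed.

Lemma links_independent (X : {set T}) (L : {set {set T}}) u :
  u \in G :\: X -> (forall e, e \in L -> e \subset G /\ #|e| = k) ->
  (forall s : {set T}, 0 < #|s| <= k -> hdeg L s <= A' * Q ^ (k - #|s|)) ->
  let L' := L :|: [set e :\ u | e in [set e in available X L | u \in e]] in
  [/\ forall e, e \in L' -> e \subset G /\ #|e| = k,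
      forall s : {set T}, 0 < #|s| <= k -> hdeg L' s <= A' * Q ^ (k - #|s|),
      #|L'| = #|L| + hdeg (available X L) [set u]
    & forall I : {set T}, u \in I -> (forall e, e \in H -> ~~ (e \subset I)) ->
       (forall e, e \in L -> ~~ (e \subset I)) -> forall e, e \in L' -> ~~ (e \subset I)].
Proof.
move=> uGX Luni Ldeg; set K := [set _ | e in _] => L'.
have KP e : e \in K -> exists f, [/\ f \in available X L, u \in f, f \in H & e = f :\ u].
  case/imsetP=> f; rewrite inE => /andP[fA uf] ->; exists f; split=> //.
  by move: fA; rewrite inE; case/and3P.
have Kuni e : e \in K -> e \subset G /\ #|e| = k.
  case/KP=> f [_ uf fH ->]; have [fG fk] := Huni fH; split.
    exact: subset_trans (subsetDl _ _) fG.
  by move: fk; rewrite (cardsD1 u) uf => -[].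
have Kunsat e (s : {set T}) : e \in K -> s \subset e -> ~~ link_saturated L s.
  case/KP=> f [fA _ _ ->] sf; move: fA; rewrite inE => /and3P[_ _ /forallP/(_ s)].
  by rewrite (subset_trans sf (subsetDl _ _)).
(* A member of [L] is itself link-saturated, its threshold being [Q ^ 0]; so the new links are not
   yet in [L]. *)
have KL : [disjoint L & K].
  rewrite disjoint_sym disjoint_subset; apply/subsetP => e eK; rewrite inE; apply/negP => eL.
  have := Kunsat e e eK (subxx _); rewrite /link_saturated.
  have [_ ->] := Kuni _ eK; rewrite k0 leqnn subnn expn0 /= -ltnNge ltnS leqn0 cards_eq0.
  by move/eqP/setP/(_ e); rewrite !inE eL subxx.
have cK : #|K| = hdeg (available X L) [set u].
  rewrite /K card_in_imset => [|e f].
    by apply: eq_card => e; rewrite !inE sub1set.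
  by rewrite !inE => /andP[_ ue] /andP[_ uf] /(congr1 (fun x => u |: x)); rewrite !setD1K.
split.
- by move=> e; rewrite inE => /orP[/Luni|/Kuni].
- move=> s sk; have [h0|hpos] := posnP (hdeg K s).
    by apply: leq_trans (hdegU _ _ _) _; rewrite h0 addn0 Ldeg.
  have [e /[!inE] /andP[eK se]] : exists e, e \in [set e in K | s \subset e] by apply/card_gt0P.
  have := Kunsat e s eK se; rewrite /link_saturated sk /= -ltnNge => lt.
  apply: leq_trans (hdegU _ _ _) _; rewrite mulSn leq_add ?(ltnW lt) //.
  have us : u \notin s.
    by apply/negP => us; have [f [_ _ _ fe]] := KP e eK; move/subsetP: se => /(_ u us); rewrite fe !inE eqxx.
  have hb : hdeg H (u |: s) <= A * Q ^ (k - #|s|).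
    by have := @Hdeg (u |: s); rewrite cardsU1 us add1n subSS; apply; case/andP: sk.
  apply: leq_trans hb.
  rewrite /hdeg; apply: leq_trans (_ : #|[set e :\ u | e in [set e in H | u |: s \subset e]]| <= _).
    apply: subset_leq_card; apply/subsetP => e'; rewrite inE => /andP[/KP[f [_ uf fH ->]] sf].
    apply/imsetP; exists f => //; rewrite inE fH subUset sub1set uf.
    exact: subset_trans sf (subsetDl _ _).
  exact: leq_imset_card.
- by rewrite cardsU -cK; move: KL; rewrite -setI_eq0 => /eqP ->; rewrite cards0 subn0.
- move=> I uI IH0 IL e; rewrite inE => /orP[/IL //|/KP[f [_ uf fH ->]]].
  apply/negP => fI; have /negP := IH0 f fH; apply; apply/subsetP => x xf.
  by have [-> //|xu] := eqVneq x u; apply: (subsetP fI); rewrite !inE xu.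
Qed.

(** A vertex of high available degree is examined, and the tree branches on whether it lies in the
    independent set. Each positive answer creates many links, so at most [#|G| %/ Q] of them occur
    before [L] is dense enough for the induction hypothesis; the first factor of the bound counts
    the possible positions of these answers. *)
Lemma decision_tree m (X S : {set T}) (L : {set {set T}}) :
    #|G :\: X| = m -> X \subset G -> S \subset X ->
    (forall e, e \in L -> e \subset G /\ #|e| = k) ->
    (forall s : {set T}, 0 < #|s| <= k -> hdeg L s <= A' * Q ^ (k - #|s|)) ->
    #|S| * Q ^ k <= 4 * B * #|L| ->
  exists F : {set {set T}},
  [/\ #|F| <= m.+1 ^ ((#|G| %/ Q).+1 - #|S|) * #|G|.+1 ^ (k * (#|G| %/ Q).+1),
      forall c, c \in F -> c \subset G /\ maxn C (4 * A * B) * #|c| + #|G| <= maxn C (4 * A * B) * #|G|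
    & forall I : {set T}, I \subset G -> [disjoint I & X :\: S] ->
       (forall e, e \in H -> ~~ (e \subset I)) -> (forall e, e \in L -> ~~ (e \subset I)) ->
      exists2 c, c \in F & I \subset c].
Proof.
elim/ltn_ind: m X S L => m IHm X S L cX XG SX Luni Ldeg LS.
have scale D (c : {set T}) : c \subset G -> D <= maxn C (4 * A * B) -> D * #|c| + #|G| <= D * #|G| ->
    maxn C (4 * A * B) * #|c| + #|G| <= maxn C (4 * A * B) * #|G|.
  move=> /subset_leq_card cG le h; rewrite -(subnK le) !mulnDl -addnA leq_add //.
  by rewrite leq_mul2l cG orbT.
have pos i j : 0 < i.+1 ^ j by rewrite expn_gt0.
have [big|small] := leqP (#|G| * Q ^ k.-1) (B' * #|L|).
  have [F [F1 F2 F3]] := IH Q0 Luni Ldeg big; exists F; split.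
  - by apply: leq_trans F1 _; rewrite leq_pmull.
  - by move=> c /F2[cG h]; split=> //; apply: (scale C) => //; rewrite leq_maxl.
  - by move=> I IG _ _ IL; apply: F3.
have Qk : Q ^ k = Q * Q ^ k.-1 by rewrite -expnS prednK.
have bud : #|S| <= #|G| %/ Q.
  rewrite leq_divRL // -(@leq_pmul2r (Q ^ k.-1)) ?expn_gt0 ?Q0 // -mulnA -Qk.
  apply: leq_trans LS _; apply: leq_trans (ltnW small); rewrite leq_mul2r; apply/orP; right.
  rewrite (_ : B' = 4 * B * (4 * A * B * 2 ^ k.+1)); last by rewrite /B' -mulnn; lia.
  by rewrite leq_pmulr // !muln_gt0 A0 B0 expn_gt0.
have [/existsP[u /andP[uGX uhigh]]|] :=
    boolP [exists u, (u \in G :\: X) && (Q ^ k <= 4 * B * hdeg (available X L) [set u])]; last first.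
  rewrite negb_exists => /forallP low.
  have Lk e : e \in L -> #|e| = k by case/Luni.
  have dl : #|G| <= 4 * A * B * #|X :\: S|.
    apply: leaf_deleted_large LS small _ => // u uGX.
    by have := low u; rewrite uGX /= -ltnNge.
  have XS : X :\: S \subset G by exact: subset_trans (subsetDl _ _) XG.
  exists [set G :\: (X :\: S)]; split.
  - by rewrite cards1 muln_gt0 !pos.
  - move=> c; rewrite inE => /eqP ->; split; first exact: subsetDl.
    apply: (scale (4 * A * B)); rewrite ?subsetDl ?leq_maxr // cardsD (setIidPr XS).
    rewrite -[X in _ <= _ * X](subnK (subset_leq_card XS)) mulnDr leq_add2l //.
  - by move=> I IG disj _ _; exists (G :\: (X :\: S)); rewrite ?inE // subsetD IG.
have [L'uni L'deg L'card L'ind] := links_independent uGX Luni Ldeg.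
move: L'uni L'deg L'card L'ind; set L' := _ :|: _ => L'uni L'deg L'card L'ind.
have [uG uX] : u \in G /\ u \notin X by move: uGX; rewrite inE => /andP[].
have uXG : u |: X \subset G by rewrite subUset sub1set uG.
case: m IHm cX => [|m] IHm cX.
  by move/eqP: cX; rewrite cards_eq0 => /eqP GX0; rewrite GX0 inE in uGX.
have cX' : #|G :\: (u |: X)| = m.
  have -> : G :\: (u |: X) = (G :\: X) :\ u by apply/setP => x; rewrite !inE negb_or andbA.
  by move: cX; rewrite (cardsD1 u) uGX => -[].
have uS : u \notin S by apply: contra uX; apply: (subsetP SX).
have [F1 [F1c F1s F1i]] := IHm m (ltnSn m) (u |: X) S L cX' uXG (subset_trans SX (subsetUr _ _)) Luni Ldeg LS.
have LS' : #|u |: S| * Q ^ k <= 4 * B * #|L'|.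
  by rewrite cardsU1 uS mulnDl mul1n L'card mulnDr addnC leq_add.
have [F2 [F2c F2s F2i]] := IHm m (ltnSn m) (u |: X) (u |: S) L' cX' uXG (setUS _ SX) L'uni L'deg LS'.
exists (F1 :|: F2); split.
- apply: leq_trans (leq_card_setU _ _) _; apply: leq_trans (leq_add F1c F2c) _.
  (* With [b = #|G| %/ Q - #|S|], the branches contribute [(m + 1) ^ (b + 1) + (m + 1) ^ b = (m + 2)
     * (m + 1) ^ b], which is at most [(m + 2) ^ (b + 1)]. *)
  rewrite -mulnDl leq_mul2r; apply/orP; right.
  rewrite cardsU1 uS add1n subSS subSn // !expnS.
  rewrite -{2}[m.+1 ^ (_ - _)]mul1n -mulnDl addn1 leq_mul2l.
  by have [->//|b0] := posnP (#|G| %/ Q - #|S|); rewrite leq_exp2r ?leqnSn ?orbT.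
- by move=> c; rewrite inE => /orP[/F1s|/F2s].
- move=> I IG disj IH0 IL.
  have [uI|uI] := boolP (u \in I).
    have [||c cF Ic] := F2i I IG _ IH0; last by exists c; rewrite // inE cF orbT.
      apply/pred0P => x /=; apply/negP => /andP[xI]; rewrite !inE negb_or => /andP[/andP[xu xS]].
      rewrite (negPf xu) /= => xX; move/pred0P: disj => /(_ x) /=.
      by rewrite xI inE xS xX.
    exact: L'ind.
  have [|c cF Ic] := F1i I IG _ IH0 IL; last by exists c; rewrite // inE cF.
  apply/pred0P => x /=; apply/negP => /andP[xI]; rewrite !inE => /andP[xS /orP[/eqP xu|xX]].
    by rewrite xu in xI; rewrite xI in uI.
  by move/pred0P: disj => /(_ x) /=; rewrite xI inE xS xX.
Qed.

End ContainerStep.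

Theorem hypergraph_containers k A B : 0 < k -> 0 < A -> 0 < B ->
  exists C, forall (T : finType) (G : {set T}) (H : {set {set T}}) Q, 0 < Q ->
  (forall e, e \in H -> e \subset G /\ #|e| = k) ->
  (forall s : {set T}, 0 < #|s| <= k -> hdeg H s <= A * Q ^ (k - #|s|)) ->
  #|G| * Q ^ k.-1 <= B * #|H| -> exists F, containers_for G H k Q C F.
Proof.
elim: k A B => [//|[|k] IHk] A B _ A0 B0.
  (* In uniformity 1 the edges are single vertices, which independent sets avoid: [G] without them
     is the only container. *)
  exists B => T G H Q Q0 Huni _; rewrite expn0 muln1 => Hbig.
  pose Z := G :&: [set x | [set x] \in H].
  have ZH : #|Z| = #|H|.
    rewrite -(card_imset _ (@set1_inj T)); apply: eq_card => e; apply/imsetP/idP => [[x]|eH].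
      by rewrite !inE => /andP[_ h] ->.
    have [eG /eqP/cards1P[x ex]] := Huni e eH.
    by exists x; rewrite // !inE -ex eH andbT -sub1set -ex.
  exists [set G :\: Z]; split.
  - by rewrite cards1 expn_gt0.
  - move=> c; rewrite inE => /eqP ->; split; first exact: subsetDl.
    rewrite cardsD (setIidPr (subsetIl _ _)).
    move: Hbig; rewrite -ZH => Hbig; have := subset_leq_card (subsetIl G [set x | [set x] \in H]).
    rewrite -/Z => ZG; rewrite mulnBr; have := leq_mul (leqnn B) ZG; lia.
  - move=> I IG ind; exists (G :\: Z); first by rewrite inE.
    apply/subsetP => x xI; rewrite !inE (subsetP IG) // andbT /=.
    by apply/negP => /ind; rewrite sub1set xI.
have B'0 : 0 < 16 * A * B ^ 2 * 2 ^ k.+2 by rewrite !(muln_gt0, expn_gt0) A0 B0.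
have [C HC] := IHk A.+1 _ isT isT B'0.
exists (maxn C (4 * A * B)) => T G H Q Q0 Huni Hdeg Hbig.
have [||||||F [F1 F2 F3]] := @decision_tree k.+1 A B C isT A0 B0 HC T G H Q Q0 Huni Hdeg Hbig #|G| set0 set0 set0.
- by rewrite setD0.
- exact: sub0set.
- exact: sub0set.
- by move=> e; rewrite inE.
- by move=> s _; rewrite /hdeg (_ : [set e in set0 | _] = set0) ?cards0 //; apply/setP => e; rewrite !inE.
- by rewrite cards0.
exists F; split=> //.
- by apply: leq_trans F1 _; rewrite cards0 subn0 -expnD [X in _ <= _ ^ X]mulSn.
- move=> I IG ind; apply: F3 => //; first by rewrite setD0; apply/pred0P => x; rewrite /= !inE andbF.
  by move=> e; rewrite inE.
Qed.

(** * Closed walks avoiding repetitions and saturated sets *)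

(** The number of maximal runs of [false], each counted at its last position. *)
Fixpoint gaps (m : bitseq) : nat :=
  match m with
  | [::] => 0
  | true :: m' => gaps m'
  | false :: m' => (if m' is false :: _ then 0 else 1) + gaps m'
  end.

Lemma gaps0 m : gaps m = 0 -> m = nseq (size m) true.
Proof.
elim: m => [//|[] m IH] /=; first by move=> /IH {1}->.
by case: m IH => [|[] m] //= IH h; have := IH h.
Qed.

Lemma gaps1 m : gaps (true :: m) <= 1 -> last true m = false ->
  exists a b, true :: m = nseq a true ++ nseq b false.
Proof.
elim: m => [//|[] m IH] /=.
  by move=> h1 h2; have [//|a [b ->]] := IH h1 _; exists a.+1, b.
case: m IH => [|[] m] IH /=.
- by move=> _ _; exists 1, 1.
- move=> h1 h2; have g0 : gaps m = 0 by lia.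
  have lt n : last true (nseq n true) = true by elim: n.
  by move: h2; rewrite (gaps0 g0) lt.
- move=> h1 h2; have [||a [b E]] := IH; [by move: h1 => /= | by [] |].
  case: a E => [|[|a]] /=; first by case: b.
    by move=> [E]; exists 1, b.+1; rewrite /= E.
  by [].
Qed.

Lemma split_first_true m : true \in m -> exists a b, m = nseq a false ++ true :: b.
Proof.
elim: m => [//|[] m IH] tm; first by exists 0, m.
by have [|a [b ->]] := IH; [move: tm; rewrite inE | exists a.+1, b].
Qed.

(** After this rotation no run is cut by the ends of the list: its runs are the arcs of the cyclic
    word, and one gap means one arc. *)
Lemma rot_true_false m : true \in m -> false \in m ->
  exists i j m', rot j (rot i m) = true :: m' /\ last true m' = false.
Proof.
move=> tm fm; have [i m1 e1] := rot_to fm.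
have tm1 : true \in m1 by move: tm; rewrite -(mem_rot i) e1 inE.
have [a [b e2]] := split_first_true tm1.
exists i, (size (nseq a.+1 false)), (b ++ nseq a.+1 false); split.
  by rewrite e1 e2 -cat_cons (rot_size_cat (nseq a.+1 false)).
by rewrite last_cat /=; elim: a {e2}.
Qed.

(** Being a closed walk is invariant under rotation, so at the cost of a factor equal to the length
    only repetitions of the first entry have to be counted. *)
Definition hit (D V : eqType) (f : D -> V) (s : seq D) :=
  if s is d :: s' then f d \in map f s' else false.

Lemma not_uniq_rot (D V : eqType) (f : D -> V) s :
  ~~ uniq (map f s) -> exists2 i, i < size s & hit f (rot i s).
Proof.
elim: s => [//|d s IH] /=; rewrite negb_and negbK.
case: (boolP (f d \in map f s)) => /= [h _|_ /IH[i si]]; first by exists 0; rewrite // rot0.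
rewrite /rot (drop_nth d) //= map_cat mem_cat => h.
exists i.+1 => //; rewrite /rot /= (drop_nth d) //= map_cat mem_cat /= inE.
by case/orP: h => ->; rewrite ?orbT.
Qed.

Section GoodWalks.
Variables (D W : finType) (src tgt : D -> W) (E : {set D}) (rv : D -> D) (side : W -> bool).
Variables (p q de : nat).
Hypotheses (rvK : involutive rv) (srcrv : forall d, src (rv d) = tgt d)
  (Erv : forall d, (rv d \in E) = (d \in E))
  (side_tgt : forall d, side (tgt d) = ~~ side (src d)).
Let dg (b : bool) := if b then q else p.
Hypothesis deg_le : forall w, #|[set d in E | src d == w]| <= dg (side w).
Hypothesis codeg_le : forall w w', nwalks src tgt E 1 w w' <= de.

Local Notation walk := (walk src tgt E).
Local Notation nwalks := (nwalks src tgt E).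
Local Notation closed_walk := (closed_walk src tgt E).
Local Notation nclosed := (nclosed src tgt E).

(* Bounds the number of ways to complete prescribed darts at the [true] positions to a walk: a
   dart that precedes a prescribed dart or the end of the walk has both ends fixed, and costs a
   codegree instead of a degree. *)
Fixpoint fill (b : bool) (m : bitseq) : nat :=
  match m with
  | [::] => 1
  | true :: m' => fill (~~ b) m'
  | false :: m' => (if m' is false :: _ then dg b else de) * fill (~~ b) m'
  end.

Fixpoint dprod (b : bool) n := if n is n'.+1 then dg b * dprod (~~ b) n' else 1.

Lemma fill_bound w w' u m :
  tsum (size m) (fun s => walk w s w' && (mask m s == u)) <= fill (side w) m.
Proof.
elim: m w u => [|b m IH] w u /=; first by rewrite tsum0; case: (_ && _).
rewrite tsumS; case: b => /=.
  case: u => [|d0 u].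
    rewrite big1 // => d _; apply: big1 => s _ /=.
    by rewrite andbC.
  rewrite (bigD1 d0) //= big1 => [|d dd0]; last first.
    by apply: big1 => s _; rewrite eqseq_cons (negPf dd0) andbF.
  rewrite addn0; have [<-|sw] := eqVneq (src d0) w; last first.
    by apply: leq_trans (_ : 0 <= _) => //; rewrite leqn0; apply/eqP/big1 => s _; rewrite andbF.
  rewrite -side_tgt; apply: leq_trans (IH _ u); apply: leq_tsum => s _.
  by rewrite eqseq_cons eqxx; case: (d0 \in E).
(* [P] records what the rest of the walk imposes on the target of the first dart: nothing if the
   next dart is free, a fixed vertex otherwise. *)
have step (P : pred D) : (forall d, d \in E -> src d = w -> ~~ P d ->
     tsum (size m) (fun s => walk (tgt d) s w' && (mask m s == u)) = 0) ->
  \sum_d tsum (size m) (fun s => [&& d \in E, src d == w & walk (tgt d) s w'] && (mask m s == u)) <=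
    #|[set d in E | (src d == w) && P d]| * fill (~~ side w) m.
  move=> h; rewrite -sum_nat_const [X in _ <= X]big_mkcond /=; apply: leq_sum => d _.
  rewrite inE; case: (boolP (d \in E)) => dE /=; last by rewrite leqn0; apply/eqP/big1.
  case: eqP => sd /=; last by rewrite leqn0; apply/eqP/big1.
  case: (boolP (P d)) => Pd; last by rewrite h.
  by rewrite -sd -side_tgt; apply: IH.
have codeg w1 : #|[set d in E | (src d == w) && (tgt d == w1)]| <= de.
  by apply: leq_trans (codeg_le w w1); rewrite nwalks1 cardsE.
case: m IH step => [|[] m] IH step.
- apply: leq_trans (step (fun d => tgt d == w') _) _; last by rewrite leq_mul2r codeg orbT.
  by move=> d _ _ /negPf dw; rewrite tsum0 /= dw.
- case: u IH step => [|d0 u] IH step.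
    rewrite big1 // => d _; apply: big1 => -[[|d1 s] //= sz] _.
    by rewrite andbF.
  apply: leq_trans (step (fun d => tgt d == src d0) _) _; last by rewrite leq_mul2r codeg orbT.
  move=> d _ _ dw; apply: big1 => -[[|d1 s] //= sz] _; rewrite eqseq_cons.
  by case: (d1 =P d0) => [->|]; rewrite ?andbF // eq_sym (negPf dw) andbF.
- apply: leq_trans (step predT _) _ => //; rewrite leq_mul2r; apply/orP; right.
  apply: leq_trans (deg_le w); rewrite subset_leq_card //.
  by apply/subsetP => d; rewrite !inE andbT.
Qed.

Variable nu : nat.
Hypotheses (pq : p <= q) (nude : nu * de <= p).

(** Compared with the product of all degrees, each prescribed dart saves a factor of at least [p]
    and each gap a factor [nu], since [nu * de <= p] and both degree bounds are at least [p]. *)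
Lemma fill_le b m : p ^ count id m * nu ^ gaps m * fill b m <= dprod b (size m).
Proof.
have p_dg c : p <= dg c by rewrite /dg; case: c.
elim: m b => [//|[] m IH] b /=.
  rewrite add1n expnS -!mulnA; apply: leq_mul => //.
  by rewrite mulnA; apply: IH.
rewrite add0n; have c : (nu ^ (if m is false :: _ then 0 else 1)) * (if m is false :: _ then dg b else de) <= dg b.
  by case: m IH => [|[] m] _; rewrite ?expn1 ?mul1n // (leq_trans nude).
rewrite expnD; apply: leq_trans (leq_mul c (IH (~~ b))).
by rewrite leq_eqVlt; apply/orP; left; apply/eqP; lia.
Qed.

Lemma dprod_double b l : dprod b (l + l) = (p * q) ^ l.
Proof.
elim: l b => [//|l IH] b; rewrite addnS addSn /= negbK IH expnS.
by case: b; rewrite /dg /= mulnA // [q * p]mulnC.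
Qed.

Lemma dprodD b i j : dprod b (i + j) = dprod b i * dprod (odd i (+) b) j.
Proof.
elim: i b => [|i IH] b /=; first by rewrite mul1n.
by rewrite IH mulnA addbN addNb.
Qed.

Lemma walk_side w s w' : walk w s w' -> side w' = odd (size s) (+) side w.
Proof.
elim: s w => [|d s IH] w /=; first by move/eqP->.
by case/and3P=> _ /eqP <- /IH ->; rewrite side_tgt addbN addNb.
Qed.

Lemma nwalks_le m w w' : 0 < m -> nu * nwalks m w w' <= dprod (side w) m.
Proof.
move=> m0; have := fill_le (side w) (nseq m false); rewrite size_nseq.
have -> : count id (nseq m false) = 0 by elim: m {m0}.
have -> : gaps (nseq m false) = 1 by case: m m0 => //; elim.
rewrite mul1n expn1; apply: leq_trans; rewrite leq_mul2l; apply/orP; right.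
apply: leq_trans (fill_bound w w' [::] (nseq m false)); rewrite size_nseq.
apply: leq_tsum => s sz; rewrite -sz (_ : mask _ s = [::]) ?andbT //.
by elim: s {sz} => //.
Qed.

Definition revisits i s := \sum_w walk w (take i s) w * walk w (drop i s) w.

(** A walk that returns to [w] splits into two closed walks. The last dart of each is determined up
    to a codegree, so [nu] is gained twice. For odd [i] there are none, because the sides
    alternate. *)
Lemma revisits_bound i l : 0 < i < l + l ->
  nu ^ 2 * tsum (l + l) (revisits i) <= #|W| * (p * q) ^ l.
Proof.
case/andP=> i0 il; rewrite /revisits tsum_sum big_distrr /= -sum_nat_const.
apply: leq_sum => w _; rewrite -(subnKC (ltnW il)) tsum_cat.
under eq_tsum => s si.
  under eq_tsum => s2 _ do rewrite take_cat drop_cat si ltnn subnn take0 drop0 cats0.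
  rewrite tsumZ; over.
rewrite tsumZr -/(nwalks i w w) -/(nwalks (l + l - i) w w).
have [oi|ei] := boolP (odd i).
  rewrite (_ : nwalks i w w = 0) ?mul0n ?muln0 //; apply: big1 => s _.
  apply/eqP; rewrite eqb0; apply/negP => /walk_side; rewrite size_tuple oi.
  by case: (side w).
rewrite -(dprod_double (side w)) -{2}(subnKC (ltnW il)) dprodD (negPf ei) addFb.
rewrite -mulnn mulnACA; apply: leq_mul; apply: nwalks_le => //.
by rewrite subn_gt0.
Qed.

Section Saturation.
Variables (sat : pred (seq D)) (Y : nat -> nat).
Hypotheses (sat_perm : forall s1 s2, perm_eq s1 s2 -> sat s1 = sat s2)
  (sat_le : forall j d, d \in E -> 0 < j -> tsum j (fun s => sat (d :: s)) <= Y j.+1).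

Definition nsat k m := tsum k (fun s => closed_walk s && sat (mask m s)).

Lemma nsat_rot i k m : size m = k -> nsat k m = nsat k (rot i m).
Proof.
move=> sm; rewrite /nsat [RHS](tsum_rot i); apply: eq_tsum => s ss.
rewrite closed_walk_rot mask_rot ?sm ?ss //; congr (_ && _ : nat).
by apply/esym/sat_perm; rewrite perm_rot.
Qed.

Lemma closed_walk_cons d s : closed_walk (d :: s) = (d \in E) && walk (tgt d) s (src d).
Proof.
apply/existsP/idP => [[w]|h]; first by case/and3P=> -> /eqP <-.
by exists (src d); rewrite /= eqxx.
Qed.

(** The first saturated dart is chosen in [#|E|] ways, the others through [Y], and the free
    positions by [fill]. Against [(p * q) ^ l] this loses the number of starting vertices, to be
    regained from the gaps and from the sparsity of saturated sets. *)
Lemma nsat_sup l m : size m = l + l -> head false m -> 1 < count id m ->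
  p ^ count id m * nu ^ gaps m * nsat (l + l) m <= #|E| * Y (count id m) * (p * q) ^ l.
Proof.
case: m => [//|[] m] //= sm _; rewrite add1n ltnS => cm.
rewrite /nsat -sm tsumS -mulnA big_distrr /= -sum_nat_const big_distrl /=.
rewrite [X in _ <= X]big_mkcond /= [X in _ * X]/= big_distrr /=.
apply: leq_sum => d _; case: (boolP (d \in E)) => dE; last first.
  rewrite (_ : tsum _ _ = 0) ?muln0 //; apply: big1 => s _.
  by rewrite closed_walk_cons (negPf dE).
apply: leq_trans (_ : p ^ (count id m).+1 * (nu ^ gaps m *
   tsum (count id m) (fun u => sat (d :: u) * fill (side (tgt d)) m)) <= _).
  rewrite !leq_mul2l; apply/orP; right; apply/orP; right.
  apply: leq_trans (_ : tsum (count id m) (fun u => sat (d :: u) *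
      tsum (size m) (fun s => walk (tgt d) s (src d) && (mask m s == u))) <= _); last first.
    by apply: leq_tsum => u _; rewrite leq_mul2l fill_bound orbT.
  rewrite /tsum; under [X in _ <= X]eq_bigr => u _ do rewrite big_distrr /=.
  rewrite exchange_big /=; apply: leq_sum => s _.
  rewrite closed_walk_cons dE /=.
  have sz : size (mask m s) == count id m by rewrite size_mask // size_tuple.
  rewrite (bigD1 (Tuple sz)) //= eqxx andbT.
  by apply: leq_trans (leq_addr _ _); case: (walk _ _ _); case: (sat _).
rewrite tsumZr; have h := fill_le (side (tgt d)) m.
rewrite expnS; apply: leq_trans (_ : tsum (count id m) (fun u => sat (d :: u)) *
   (p * (p ^ count id m * nu ^ gaps m * fill (side (tgt d)) m)) <= _).
  by rewrite leq_eqVlt; apply/orP; left; apply/eqP; lia.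
apply: leq_mul; first exact: sat_le.
apply: leq_trans (leq_mul (leqnn p) h) _.
apply: leq_trans (_ : dprod (side (src d)) (size m).+1 <= _).
  by rewrite /= side_tgt leq_mul2r /dg; case: (side _); rewrite ?pq ?leqnn orbT.
by rewrite sm dprod_double.
Qed.

(** The matrix for Schur's test. Its row sums are controlled by the first dart of the saturated arc
    and its column sums by the last one, which the invariance of [sat] under permutations brings to
    the front. *)
Let S j w z := tsum j (fun s => walk w s z && sat s).

Lemma sum_walk_end w s : \sum_z walk w s z <= 1.
Proof.
elim: s w => [|d s IH] w /=.
  by rewrite (bigD1 w) //= eqxx big1 ?addn0 // => z /negPf; rewrite eq_sym => ->.
case: (d \in E) => /=; last by rewrite big1.
by case: (src d == w) => /=; [exact: IH | rewrite big1].
Qed.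

Lemma sum_walk_origin s z : \sum_w walk w s z <= 1.
Proof.
case: s => [|d s] /=.
  by rewrite (bigD1 z) //= eqxx big1 ?addn0 // => w /negPf ->.
rewrite (bigD1 (src d)) //= big1 ?addn0 => [|w /negPf]; last first.
  by rewrite eq_sym => ->; rewrite andbF.
by case: (_ && _).
Qed.

Lemma dg_le_q b : dg b <= q.
Proof. by rewrite /dg; case: b. Qed.

Lemma out_le w : #|[pred d in E | src d == w]| <= q.
Proof.
apply: leq_trans (dg_le_q (side w)); apply: leq_trans (deg_le w).
by rewrite subset_leq_card //; apply/subsetP => d; rewrite !inE.
Qed.

Lemma in_le w : #|[pred d in E | tgt d == w]| <= q.
Proof.
apply: leq_trans (out_le w); rewrite -!sum1_card (reindex rv) /=; last by exists rv => d _; apply: rvK.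
by rewrite leq_eqVlt; apply/orP; left; apply/eqP; apply: eq_bigl => d; rewrite !inE Erv (tgtrv rvK srcrv).
Qed.

Lemma S_row j w : 1 < j -> \sum_z S j w z <= q * Y j.
Proof.
case: j => [//|j] j0; rewrite /S -tsum_sum tsumS.
apply: leq_trans (_ : \sum_(d | (d \in E) && (src d == w)) Y j.+1 <= _); last first.
  by rewrite sum_nat_const leq_mul2r; apply/orP; right; apply: out_le.
rewrite [X in _ <= X]big_mkcond /=; apply: leq_sum => d _.
case: (boolP (d \in E)) => dE /=; last by rewrite leqn0; apply/eqP/big1 => s _; apply: big1.
case: eqP => /= _; last by rewrite leqn0; apply/eqP/big1 => s _; apply: big1.
apply: leq_trans (sat_le dE j0); apply: leq_tsum => s _.
case: (sat _); last by rewrite big1 // => z _; rewrite andbF.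
by apply: leq_trans (sum_walk_end (tgt d) s); apply: leq_sum => z _; rewrite andbT.
Qed.

Lemma S_col j z : 1 < j -> \sum_w S j w z <= q * Y j.
Proof.
case: j => [//|j] j0; rewrite /S -tsum_sum tsum_rcons.
apply: leq_trans (_ : \sum_(d | (d \in E) && (tgt d == z)) Y j.+1 <= _); last first.
  by rewrite sum_nat_const leq_mul2r; apply/orP; right; apply: in_le.
rewrite [X in _ <= X]big_mkcond /=; apply: leq_sum => d _.
case: (boolP (d \in E)) => dE /=; last first.
  by rewrite leqn0; apply/eqP/big1 => s _; apply: big1 => w _; rewrite walk_rcons (negPf dE).
case: eqP => /= [tz|/eqP tz]; last first.
  by rewrite leqn0; apply/eqP/big1 => s _; apply: big1 => w _; rewrite walk_rcons (negPf tz) !andbF.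
apply: leq_trans (sat_le dE j0); apply: leq_tsum => s _.
rewrite (@sat_perm _ (d :: s)); last by rewrite perm_rcons.
case: (sat _); last by rewrite big1 // => w _; rewrite andbF.
apply: leq_trans (sum_walk_origin s (src d)); apply: leq_sum => w _.
by rewrite andbT walk_rcons dE tz eqxx andbT.
Qed.

Lemma nsat_arc_split j m : 0 < j ->
  nsat (j + m) (nseq j true ++ nseq m false) = \sum_w \sum_z S j w z * nwalks m z w.
Proof.
move=> j0; have mk (s1 s2 : seq D) : size s1 = j -> size s2 = m -> mask (nseq j true ++ nseq m false) (s1 ++ s2) = s1.
  by move=> <- <-; rewrite mask_cat ?size_nseq // mask_true // mask_false cats0.
rewrite /nsat tsum_cat.
under eq_tsum => s1 h1.
  under eq_tsum => s2 h2.
    rewrite mk // -mulnb closed_walkE ?size_cat ?h1 ?addn_gt0 ?j0 // mulnC big_distrr /=; over.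
  rewrite tsum_sum; over.
rewrite tsum_sum; apply: eq_bigr => w _.
under eq_tsum => s1 _.
  under eq_tsum => s2 _ do rewrite walk_cat big_distrr /=.
  rewrite tsum_sum; over.
rewrite tsum_sum; apply: eq_bigr => z _; rewrite /S -tsumZr; apply: eq_tsum => s1 _.
by rewrite -tsumZ; apply: eq_tsum => s2 _; rewrite -mulnb mulnA; congr (_ * _); rewrite mulnC.
Qed.

Lemma nsat_arc_even j m : 1 < j ->
  nsat (j + (m + m)) (nseq j true ++ nseq (m + m) false) <= q * Y j * nclosed (m + m).
Proof.
move=> j1; rewrite nsat_arc_split ?(ltnW j1) //.
by apply: (schur_nclosed rvK) => // w; [apply: S_row | apply: S_col].
Qed.

(** One step of the free arc is absorbed into the matrix, which multiplies the bound on its row and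
    column sums by [q] and leaves an even power. *)
Lemma nsat_arc_odd j m : 1 < j ->
  nsat (j + (m + m).+1) (nseq j true ++ nseq (m + m).+1 false) <= q ^ 2 * Y j * nclosed (m + m).
Proof.
move=> j1; rewrite nsat_arc_split ?(ltnW j1) //.
have N1row w : \sum_z nwalks 1 w z <= q.
  apply: leq_trans (out_le w); rewrite /nwalks -tsum_sum tsumS -sum1_card [X in _ <= X]big_mkcond /=.
  apply: leq_sum => d _; rewrite tsum0 /= inE; case: (_ \in _) => /=; last by rewrite big1.
  by case: (_ == _); [exact: (sum_walk_end _ [::]) | rewrite big1].
have N1col z : \sum_w nwalks 1 w z <= q.
  by apply: leq_trans (N1row z); apply: leq_sum => w _; rewrite (nwalks1_sym rvK).
pose K w z := \sum_y S j w y * nwalks 1 y z.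
apply: leq_trans (_ : \sum_w \sum_z K w z * nwalks (m + m) z w <= _).
  apply: leq_sum => w _; rewrite /K.
  under [X in _ <= X]eq_bigr => z _ do rewrite big_distrl /=.
  rewrite exchange_big /=; apply: leq_sum => y _.
  rewrite -add1n nwalks_add big_distrr /=; apply: leq_sum => z _.
  by rewrite mulnA.
apply: (schur_nclosed rvK) => // w; rewrite /K -mulnn.
- rewrite exchange_big /=; apply: leq_trans (_ : \sum_y S j w y * q <= _).
    by apply: leq_sum => y _; rewrite -big_distrr /= leq_mul2l N1row orbT.
  by rewrite -big_distrl /= mulnC -mulnA leq_mul2l S_row ?orbT.
- rewrite exchange_big /=; apply: leq_trans (_ : \sum_y (q * Y j) * nwalks 1 y w <= _).
    by apply: leq_sum => y _; rewrite -big_distrl /= leq_mul2r S_col ?orbT.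
  by rewrite -big_distrr /= mulnC -mulnA leq_mul2r N1col orbT.
Qed.

Lemma hit_src_revisits s : closed_walk s -> hit src s <= \sum_(1 <= i < size s) revisits i s.
Proof.
case: s => [|d s]; first by [].
rewrite closed_walk_cons /= => /andP[dE ws].
case: (boolP (src d \in map src s)) => // /mapP[d' d's sd].
case/splitPr: d's ws => a b ws; rewrite size_cat /= addnS.
rewrite (bigD1_seq (size a).+1) ?mem_index_iota ?iota_uniq //=; last first.
  by rewrite !ltnS leq_addr.
rewrite /revisits (bigD1 (src d)) //= take_size_cat // drop_size_cat //= dE eqxx /=.
apply: leq_trans (leq_addr _ _); apply: leq_trans (leq_addr _ _).
have : (0 < walk (tgt d) (a ++ d' :: b) (src d)) by rewrite ws.
rewrite walk_cat lt0n sum_nat_eq0 negb_forall => /existsP[z]; rewrite implyTb.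
rewrite -lt0n muln_gt0 /= !lt0b => /andP[w1 /and3P[d'E /eqP sz w2]].
by move: w1; rewrite -sz -sd => ->; rewrite eqxx d'E w2.
Qed.

Lemma hit_src_bound l : nu ^ 2 * tsum (l + l) (fun s => closed_walk s && hit src s) <=
  (l + l) * (#|W| * (p * q) ^ l).
Proof.
apply: leq_trans (_ : nu ^ 2 * tsum (l + l) (fun s => \sum_(1 <= i < l + l) revisits i s) <= _).
  rewrite leq_mul2l; apply/orP; right; apply: leq_tsum => s sz; rewrite -sz.
  by case: (boolP (closed_walk s)) => //= /hit_src_revisits.
rewrite /tsum exchange_big big_distrr /= big_nat.
apply: leq_trans (_ : \sum_(1 <= i < l + l) (#|W| * (p * q) ^ l) <= _); last first.
  by rewrite sum_nat_const_nat leq_mul2r leq_subr orbT.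
rewrite [X in _ <= X]big_nat; apply: leq_sum => i il; exact: revisits_bound.
Qed.

Variables (C : finType) (V : eqType) (lab : C -> D -> V) (t : nat).
Hypothesis fibre_large : forall c w w' v,
  #|[pred d in E | [&& src d == w, tgt d == w' & lab c d == v]]| * t <= nwalks 1 w w'.

(** Given the other darts, the first one joins two fixed vertices, and a prescribed label is carried
    by at most one in [t] of the darts between them; fewer than [k] labels have to be considered.
    The comparison is with the closed walks themselves, so no degree enters. *)
Lemma hit_lab_bound c k : 0 < k ->
  tsum k (fun s => closed_walk s && hit (lab c) s) * t <= k * nclosed k.
Proof.
case: k => [//|k] _; rewrite nclosedE // !tsumS.
under eq_bigr => d _ do under eq_tsum => s _ do rewrite closed_walk_cons /=.
under [X in _ <= _ * X]eq_bigr => d _ do under eq_tsum => s _ do rewrite closed_walk_cons /=.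
rewrite -!tsum_sum -tsumZr -tsumZ; apply: leq_tsum => s sz.
apply: leq_trans (_ : \sum_(v <- map (lab c) s) \sum_d ((d \in E) && walk (tgt d) s (src d)) <= _); last first.
  rewrite big_const_seq count_predT iter_addn_0 size_map sz mulnC leq_mul2r.
  by rewrite leqnSn orbT.
apply: leq_trans (_ : (\sum_(v <- map (lab c) s) \sum_(d | (d \in E) && (lab c d == v))
    walk (tgt d) s (src d)) * t <= _).
  rewrite leq_mul2r; apply/orP; right.
  under [X in _ <= X]eq_bigr => v _ do rewrite big_mkcond /=.
  rewrite exchange_big /=; apply: leq_sum => d _.
  case: (boolP (d \in E)) => //= dE; case: (boolP (walk _ _ _)) => //= wd.
  case: (boolP (lab c d \in _)) => // /rot_to[i s1 e1].
  by rewrite -(perm_big _ (_ : perm_eq (rot i (map (lab c) s)) _)) ?perm_rot // e1 big_cons eqxx.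
rewrite big_distrl /= leq_sum // => v _.
apply: leq_trans (_ : \sum_w \sum_w' walk w' s w * nwalks 1 w w' <= _); last first.
  under eq_bigr => w _ do under eq_bigr => w' _ do rewrite nwalks1 -sum1_card big_mkcond big_distrr /=.
  under eq_bigr => w _ do rewrite exchange_big /=.
  rewrite exchange_big /=; apply: leq_sum => d _.
  rewrite (bigD1 (src d)) //= (bigD1 (tgt d)) //= !inE !eqxx !andbT.
  rewrite big1 => [|w' /negPf]; last by rewrite !inE eq_sym => ->; rewrite !andbF muln0.
  rewrite big1 => [|w /negPf]; last first.
    by move=> nw; apply: big1 => w' _; rewrite !inE eq_sym nw andbF muln0.
  by rewrite !addn0; case: (d \in E); case: (walk _ _ _).
rewrite big_distrl /=.
apply: leq_trans (_ : \sum_w \sum_w' walk w' s w *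
  (#|[pred d in E | [&& src d == w, tgt d == w' & lab c d == v]]| * t) <= _); last first.
  by apply: leq_sum => w _; apply: leq_sum => w' _; rewrite leq_mul2l fibre_large orbT.
under [X in _ <= X]eq_bigr => w _ do under eq_bigr => w' _ do
  rewrite -sum1_card big_mkcond big_distrl big_distrr /=.
under [X in _ <= X]eq_bigr => w _ do rewrite exchange_big /=.
rewrite exchange_big /= [X in X <= _]big_mkcond /=; apply: leq_sum => d _.
case: ifP => // /andP[dE dv].
rewrite (bigD1 (src d)) //= (bigD1 (tgt d)) //= !inE !eqxx dE dv /=.
by rewrite mul1n -addnA leq_addr.
Qed.

(** Repeated sources, repeated labels and saturated patterns each weigh at most a quarter of the
    closed walks. The third bound sums over at most [2 ^ (l + l)] masks, whence the power
    [2 ^ (l + l).+2]. *)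
Lemma good_walk_exists l : 0 < l -> 0 < nclosed (l + l) -> 0 < nu ->
    4 * ((l + l) ^ 2 * (#|W| * (p * q) ^ l)) <= nu ^ 2 * nclosed (l + l) ->
    4 * (#|C| * (l + l) ^ 2) <= t -> 0 < t ->
    (forall m : (l + l).-tuple bool, 1 < count id m -> 2 ^ (l + l).+2 * nsat (l + l) m <= nclosed (l + l)) ->
  exists s, [/\ size s = l + l, closed_walk s, uniq (map src s),
    forall c, uniq (map (lab c) s) & forall m, size m = l + l -> 1 < count id m -> ~~ sat (mask m s)].
Proof.
move=> l0 T0 nu0 H1 H2 t0 H3; set k := l + l in T0 H1 H2 H3 *.
have k0 : 0 < k by rewrite addn_gt0 l0.
pose b1 s := \sum_(i < k) hit src (rot i s).
pose b2 s := \sum_c \sum_(i < k) hit (lab c) (rot i s).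
pose b3 s := \sum_(m : k.-tuple bool | 1 < count id m) sat (mask m s).
have rotE (P : pred (seq D)) i :
    tsum k (fun s => closed_walk s * P (rot i s)) = tsum k (fun s => closed_walk s && P s).
  by rewrite [RHS](tsum_rot i); apply: eq_tsum => s _; rewrite closed_walk_rot mulnb.
have B1 : 4 * tsum k (fun s => closed_walk s * b1 s) <= nclosed k.
  rewrite -(@leq_pmul2l (nu ^ 2)) ?expn_gt0 ?nu0 //; apply: leq_trans H1.
  rewrite mulnCA leq_mul2l /=; rewrite /b1.
  under eq_tsum => s _ do rewrite big_distrr /=.
  rewrite tsum_sum; under eq_bigr => i _ do rewrite rotE.
  rewrite sum_nat_const card_ord [X in X <= _]mulnCA -(mulnn k) -(mulnA k) leq_mul2l; apply/orP; right.
  exact: hit_src_bound.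
have B2 : 4 * tsum k (fun s => closed_walk s * b2 s) <= nclosed k.
  rewrite -(@leq_pmul2l t) //; apply: leq_trans (_ : 4 * (#|C| * k ^ 2) * nclosed k <= _); last first.
    by rewrite leq_mul2r H2 orbT.
  rewrite mulnCA -mulnA leq_mul2l /=; rewrite /b2.
  under eq_tsum => s _ do rewrite big_distrr /=.
  rewrite tsum_sum mulnC big_distrl /= -mulnA -sum_nat_const; apply: leq_sum => c _.
  under eq_tsum => s _ do rewrite big_distrr /=.
  rewrite tsum_sum big_distrl /= -mulnn -mulnA -[X in X * _]card_ord -sum_nat_const.
  by apply: leq_sum => i _; rewrite rotE hit_lab_bound.
have B3 : 4 * tsum k (fun s => closed_walk s * b3 s) <= nclosed k.
  rewrite -(@leq_pmul2l (2 ^ k)) ?expn_gt0 // /b3.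
  under eq_tsum => s _ do rewrite big_distrr /=.
  rewrite tsum_sum mulnA big_distrr /=.
  apply: leq_trans (_ : \sum_(m : k.-tuple bool | 1 < count id m) nclosed k <= _).
    apply: leq_sum => m cm; apply: leq_trans (H3 m cm).
    have -> : 2 ^ k.+2 = 2 ^ k * 4 by rewrite !expnS; lia.
    rewrite leq_mul2l; apply/orP; right; apply: leq_tsum => s _.
    by rewrite mulnb.
  rewrite sum_nat_const leq_mul2r; apply/orP; right.
  by apply: leq_trans (max_card _) _; rewrite card_tuple card_bool.
have : exists2 s, size s = k & closed_walk s * (b1 s + b2 s + b3 s) < closed_walk s.
  case: (pickP (fun u : k.-tuple D => closed_walk u * (b1 u + b2 u + b3 u) < closed_walk u)) => [u h|none].
    by exists u; rewrite ?size_tuple.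
  have : nclosed k <= tsum k (fun s => closed_walk s * b1 s) + tsum k (fun s => closed_walk s * b2 s)
      + tsum k (fun s => closed_walk s * b3 s).
    rewrite nclosedE // /tsum -!big_split /=; apply: leq_sum => u _.
    by have := none u; rewrite /= ltnNge !mulnDr => /negbFE.
  lia.
case=> s sz; case cs : (closed_walk s); last by [].
rewrite mul1n ltnS leqn0 !addn_eq0 => /andP[/andP[z1 z2] z3].
exists s; split=> //.
- apply: contraTT z1 => /not_uniq_rot[i]; rewrite sz => ik h.
  by rewrite /b1 sum_nat_eq0 negb_forall; apply/existsP; exists (Ordinal ik); rewrite /= h.
- move=> c; apply: contraTT z2 => /not_uniq_rot[i]; rewrite sz => ik h.
  rewrite /b2 sum_nat_eq0 negb_forall; apply/existsP; exists c; rewrite /= sum_nat_eq0 negb_forall.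
  by apply/existsP; exists (Ordinal ik); rewrite /= h.
- move=> m /eqP sm cm; apply: contraTN z3 => h.
  rewrite /b3 sum_nat_eq0 negb_forall; apply/existsP; exists (Tuple sm).
  by rewrite /= cm h.
Qed.

Lemma nclosed2_le : nclosed 2 <= de * #|E|.
Proof.
rewrite (nclosed_double rvK srcrv Erv 1) -sum1_card big_distrr /=.
apply: leq_trans (_ : \sum_w \sum_z de * nwalks 1 w z <= _).
  by apply: leq_sum => w _; apply: leq_sum => z _; rewrite -mulnn leq_mul2r codeg_le orbT.
under eq_bigr => w _ do under eq_bigr => z _ do rewrite nwalks1 -sum1_card big_mkcond big_distrr /=.
under eq_bigr => w _ do rewrite exchange_big /=.
rewrite exchange_big [X in _ <= X]big_mkcond /=; apply: leq_sum => d _.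
rewrite (bigD1 (src d)) //= (bigD1 (tgt d)) //= !inE !eqxx !andbT.
rewrite big1 => [|w' /negPf]; last by rewrite !inE eq_sym => ->; rewrite !andbF muln0.
rewrite big1 => [|w /negPf]; last first.
  by move=> nw; apply: big1 => w' _; rewrite !inE eq_sym nw andbF muln0.
by rewrite !addn0; case: (d \in E); rewrite ?muln0.
Qed.

(** * Saturated patterns are rare among closed walks *)

Variables (l n m0 L L2 c C0 Q : nat).
Hypotheses (l2 : 1 < l) (p0 : 0 < p) (m00 : 0 < m0) (nu0 : 0 < nu) (C00 : 0 < C0) (c0 : 0 < c) (L20 : 0 < L2)
  (YE : forall j, Y j = C0 * Q ^ j.-1) (Ele : #|E| <= 2 * n * p) (Qle : Q * (m0 * L) <= p)
  (nm0 : n <= m0 ^ (l + l).-1) (nnu : n <= 2 * nu * m0 ^ l.-1)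
  (nu2 : c * (2 * n * C0 * L2) <= nu ^ 2) (Lle : 4 * c * C0 * L2 <= L)
  (Tle : (p * q) ^ l <= L2 * nclosed (l + l)).

Let La := m0 * L.

Lemma L_gt0 : 0 < L.
Proof. by apply: leq_trans Lle; rewrite !muln_gt0 c0 C00 L20. Qed.

Lemma La_gt0 : 0 < La.
Proof. by rewrite muln_gt0 m00 L_gt0. Qed.

Lemma expQLa j : Q ^ j * La ^ j <= p ^ j.
Proof. by rewrite -expnMn; case: j => [//|j]; rewrite leq_exp2r. Qed.

(** As [Q * La <= p], each saturated dart after the first gains [La]. The last hypothesis asks these
    gains and those of the gaps to absorb the factor [2 * n] coming from [#|E| <= 2 * n * p], and
    the constants. *)
Lemma nsat_sup_final m : size m = l + l -> head false m -> 1 < count id m ->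
    c * (2 * n * C0 * L2) <= nu ^ gaps m * La ^ (count id m).-1 ->
  c * nsat (l + l) m <= nclosed (l + l).
Proof.
move=> sm hm cm big; set j := count id m in cm big *; set g := gaps m in big *.
set N := nsat _ _; set T := nclosed _.
have w0 : 0 < nu ^ g * La ^ j.-1 by rewrite muln_gt0 !expn_gt0 nu0 La_gt0.
have pj : 0 < p ^ j by rewrite expn_gt0 p0.
have h := nsat_sup sm hm cm; rewrite -/j -/g -/N YE in h.
have h2 : p ^ j * (nu ^ g * La ^ j.-1 * N) <= p ^ j * (2 * n * C0 * L2 * T).
  apply: leq_trans (_ : La ^ j.-1 * (p ^ j * nu ^ g * N) <= _); first by lia.
  apply: leq_trans (_ : La ^ j.-1 * (2 * n * p * (C0 * Q ^ j.-1) * (L2 * T)) <= _).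
    rewrite leq_mul2l; apply/orP; right; apply: leq_trans h _.
    by apply: leq_mul => //; apply: leq_mul.
  rewrite (_ : _ * (2 * n * p * _ * _) = Q ^ j.-1 * La ^ j.-1 * p * (2 * n * C0 * L2 * T)); last by lia.
  rewrite leq_mul2r; apply/orP; right.
  rewrite -[X in _ <= p ^ X](prednK (ltnW cm)) expnSr leq_mul2r expQLa orbT //.
rewrite leq_pmul2l // in h2; rewrite -(leq_pmul2l w0) mulnCA.
apply: leq_trans (_ : c * (2 * n * C0 * L2 * T) <= _); first by rewrite leq_mul2l h2 orbT.
by rewrite mulnA leq_mul2r big orbT.
Qed.

Lemma nsat_arc_final i mm N s : l = i + mm -> 0 < i -> 0 < mm ->
    N <= s * nclosed (mm + mm) -> s * La ^ i <= C0 * (p * q) ^ i ->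
  c * N <= nclosed (l + l).
Proof.
move=> li i0 mm0 Nle sle.
have La0 := La_gt0.
have Li0 : 0 < La ^ i by rewrite expn_gt0 La0.
(* There are at most [de * #|E|], hence at most [2 * n * p ^ 2 / nu], closed walks of length 2, and
   at least [(p * q) ^ l / L2] of length [l + l]. What remains is [n <= 2 * nu * m0 ^ l.-1], with
   the constants absorbed by [L]. *)
have interp : (c * C0 * (p * q)) ^ l.-1 * nclosed 2 <= La ^ l.-1 * nclosed (l + l).
  rewrite -(leq_pmul2l nu0).
  apply: leq_trans (_ : (c * C0 * (p * q)) ^ l.-1 * (p * (2 * n * p)) <= _).
    rewrite mulnCA leq_mul2l; apply/orP; right.
    apply: leq_trans (_ : nu * (de * #|E|) <= _); first by rewrite leq_mul2l nclosed2_le orbT.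
    by rewrite mulnA leq_mul.
  apply: leq_trans (_ : (c * C0) ^ l.-1 * (2 * n) * (p * q) ^ l <= _).
    rewrite expnMn -[X in _ <= _ * _ ^ X](prednK (ltnW l2)) expnSr.
    rewrite (_ : _ * (p * (2 * n * p)) = (c * C0) ^ l.-1 * (2 * n) * ((p * q) ^ l.-1 * (p * p))); last by lia.
    by rewrite !leq_mul2l pq !orbT.
  apply: leq_trans (_ : (c * C0) ^ l.-1 * (2 * n) * (L2 * nclosed (l + l)) <= _).
    by rewrite leq_mul2l Tle orbT.
  rewrite [X in _ <= X]mulnA mulnA leq_mul2r; apply/orP; right.
  apply: leq_trans (_ : (c * C0) ^ l.-1 * (2 * (2 * nu * m0 ^ l.-1)) * L2 <= _).
    by rewrite leq_mul2r leq_mul2l leq_mul2l nnu !orbT.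
  rewrite /La [(m0 * L) ^ _]expnMn.
  rewrite (_ : _ * L2 = nu * m0 ^ l.-1 * (4 * L2 * (c * C0) ^ l.-1)); last by lia.
  rewrite [X in _ <= X]mulnA leq_mul2l; apply/orP; right.
  have [l' el] : exists l', l = l'.+2 by exists l.-2; lia.
  rewrite el /= !expnS; apply: leq_trans (_ : 4 * c * C0 * L2 * (c * C0) ^ l' <= _); first by lia.
  apply: leq_mul => //.
  have cL : c * C0 <= L.
    apply: leq_trans Lle; rewrite -[4 * c * C0]mulnA mulnAC leq_pmull ?muln_gt0 ?L20 //.
  by case: (l') => [//|l'']; rewrite leq_exp2r.
have il : i < l by rewrite li -[X in X < _]addn0 ltn_add2l.
have := nclosed_interpolation rvK srcrv Erv La0 il interp.
rewrite (_ : l - i = mm); last by rewrite li addKn.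
move=> h; rewrite -(leq_pmul2l Li0); apply: leq_trans h.
apply: leq_trans (_ : c * (s * La ^ i) * nclosed (mm + mm) <= _).
  rewrite (_ : c * (s * La ^ i) * nclosed (mm + mm) = La ^ i * (c * (s * nclosed (mm + mm)))); last by lia.
  by rewrite !leq_mul2l Nle !orbT.
rewrite leq_mul2r; apply/orP; right.
apply: leq_trans (_ : c * (C0 * (p * q) ^ i) <= _); first by rewrite leq_mul2l sle orbT.
rewrite [X in _ <= X]expnMn mulnA leq_mul2r; apply/orP; right.
by rewrite -[X in X <= _]expn1 leq_pexp2l // muln_gt0 c0 C00.
Qed.

Lemma nsat_final m : size m = l + l -> 1 < count id m -> c * nsat (l + l) m <= nclosed (l + l).
Proof.
move=> sm cm.
have La0 := La_gt0.
have Lpow j : 0 < j -> 4 * c * C0 * L2 <= L ^ j.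
  by case: j => [//|j] _; apply: leq_trans Lle _; rewrite expnS leq_pmulr // expn_gt0 L_gt0.
(* If no dart is free there is no gap to gain from, and [n <= m0 ^ (l + l).-1] has to suffice. *)
have [fm|nfm] := boolP (false \in m); last first.
  have em : m = nseq (l + l) true.
    rewrite -sm; elim: m nfm {sm cm} => [//|[] m IH]; rewrite !inE //= => /IH <- //.
  have cE k : count id (nseq k true) = k by elim: k => //= k ->.
  have gE k : gaps (nseq k true) = 0 by elim: k.
  apply: nsat_sup_final => //; first by rewrite em; case: (l) l2.
  rewrite em cE gE mul1n expnMn.
  apply: leq_trans (_ : m0 ^ (l + l).-1 * (4 * c * C0 * L2) <= _); last first.
    by rewrite leq_mul2l Lpow ?orbT //; lia.
  apply: leq_trans (_ : n * (4 * c * C0 * L2) <= _); last by rewrite leq_mul2r nm0 orbT.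
  by nia.
have tm : true \in m by move: cm; case: (boolP (true \in m)) => // nt; rewrite (_ : count id m = 0) //;
  apply/eqP; rewrite -leqn0 leqNgt -has_count; apply/hasPn => -[] //; rewrite (negPf nt).
have [i [j [m' [em lm]]]] := rot_true_false tm fm.
have nE : nsat (l + l) m = nsat (l + l) (true :: m').
  by rewrite -em -!nsat_rot // size_rot.
rewrite nE; have {}cm : 1 < count id (true :: m').
  by rewrite -em; have /permP -> : perm_eq (rot j (rot i m)) m by rewrite !perm_rot.
have {}sm : size (true :: m') = l + l by rewrite -em !size_rot.
have g0 : 0 < gaps (true :: m').
  rewrite lt0n; apply/eqP => /gaps0 [e]; have lt k : last true (nseq k true) = true by elim: k.
  by move: lm; rewrite e lt.
(* Two gaps gain [nu ^ 2], which already absorbs [n] and the constants. *)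
have [g2|g1] := leqP 2 (gaps (true :: m')).
  apply: nsat_sup_final => //; apply: leq_trans nu2 _.
  apply: leq_trans (_ : nu ^ gaps (true :: m') <= _); first by rewrite leq_pexp2l.
  by rewrite leq_pmulr // expn_gt0 La0.
have [a [b eab]] := gaps1 g1 lm.
have ca : count id (true :: m') = a.
  rewrite eab count_cat; have -> : count id (nseq b false) = 0 by elim: (b).
  by rewrite addn0; elim: (a) => //= k ->.
have sab : a + b = l + l by rewrite -sm eab size_cat !size_nseq.
have b0 : 0 < b.
  rewrite lt0n; apply/eqP => b0; have lt k : last true (nseq k true) = true by elim: k.
  have := congr1 (last true) eab; rewrite b0 /= cats0 lt => h.
  by rewrite h in lm.
(* A single free dart leaves no positive even length for the interpolation to reach; but then the
   saturated darts alone gain [La ^ (l + l - 2)], and the cruder bound works. *)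
have [b1|b1] := leqP b 1.
  apply: nsat_sup_final => //; rewrite ca (_ : gaps (true :: m') = 1); last by lia.
  rewrite expn1 (_ : a.-1 = l + l - 2); last by lia.
  rewrite expnMn [X in _ <= X]mulnA; apply: leq_trans (_ : nu * m0 ^ (l + l - 2) * (4 * c * C0 * L2) <= _); last first.
    by rewrite leq_mul2l Lpow ?orbT //; lia.
  apply: leq_trans (_ : (2 * nu * m0 ^ (l + l - 2)) * (2 * c * C0 * L2) <= _); last by lia.
  apply: leq_trans (_ : n * (2 * c * C0 * L2) <= _); first by lia.
  rewrite leq_mul2r; apply/orP; right; apply: leq_trans nnu _.
  by rewrite leq_mul2l leq_pexp2l ?orbT //; lia.
rewrite eab; rewrite ca in cm.
have expmono x y k : x <= y -> x ^ k <= y ^ k by case: k => [//|k] h; rewrite leq_exp2r.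
have oab : odd a = odd b by move: sab => /(congr1 odd); rewrite !oddD addbb; case: (odd a); case: (odd b).
have ea := odd_double_half a; have eb := odd_double_half b.
(* In both parities, [a - 1] factors [p] and one or two factors [q] have to fit into [(p * q) ^ i]
   with [i = l - mm]; their total number is [2 * i], and [p <= q]. *)
rewrite -oab in eb; case: (odd a) ea eb => /= ea eb.
  have [mm emm] : exists mm, b = (mm + mm).+1 by exists (b./2); lia.
  have [x ex] : exists x, a = x + x.+3 by exists (a./2).-1; lia.
  apply: (@nsat_arc_final x.+2 mm _ (q ^ 2 * Y a)); try lia.
    by rewrite emm -sab emm; apply: nsat_arc_odd.
  rewrite YE (_ : a.-1 = x.+2 + x); last by lia.
  apply: leq_trans (_ : q ^ 2 * (C0 * Q ^ (x.+2 + x)) * La ^ (x.+2 + x) <= _).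
    by rewrite leq_mul2l leq_pexp2l ?leq_addr ?orbT.
  apply: leq_trans (_ : q ^ 2 * C0 * p ^ (x.+2 + x) <= _).
    rewrite (_ : _ * La ^ _ = q ^ 2 * C0 * (Q ^ (x.+2 + x) * La ^ (x.+2 + x))); last by lia.
    by rewrite leq_mul2l expQLa orbT.
  rewrite expnMn expnD.
  rewrite (_ : q ^ 2 * C0 * (p ^ x.+2 * p ^ x) = C0 * p ^ x.+2 * (q ^ 2 * p ^ x)); last by lia.
  rewrite [X in _ <= X]mulnA leq_mul2l; apply/orP; right.
  by rewrite -[X in _ <= _ ^ X]add2n expnD leq_mul2l expmono ?orbT.
have [mm emm] : exists mm, b = mm + mm by exists (b./2); lia.
have [x ex] : exists x, a = x.+1 + x.+1 by exists (a./2).-1; lia.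
apply: (@nsat_arc_final x.+1 mm _ (q * Y a)); try lia.
  by rewrite emm -sab emm; apply: nsat_arc_even.
rewrite YE (_ : a.-1 = x.+1 + x); last by lia.
apply: leq_trans (_ : q * (C0 * Q ^ (x.+1 + x)) * La ^ (x.+1 + x) <= _).
  by rewrite leq_mul2l leq_pexp2l ?leq_addr ?orbT.
apply: leq_trans (_ : q * C0 * p ^ (x.+1 + x) <= _).
  rewrite (_ : _ * La ^ _ = q * C0 * (Q ^ (x.+1 + x) * La ^ (x.+1 + x))); last by lia.
  by rewrite leq_mul2l expQLa orbT.
rewrite expnMn expnD.
rewrite (_ : q * C0 * (p ^ x.+1 * p ^ x) = C0 * p ^ x.+1 * (q * p ^ x)); last by lia.
rewrite [X in _ <= X]mulnA leq_mul2l; apply/orP; right.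
by rewrite expnS leq_mul2l expmono ?orbT.
Qed.

End Saturation.
End GoodWalks.

(** * Regularization *)

Lemma uniformity_arith r : 3 < r -> [/\ (r - 2).+1 = r.-1, 0 < r.-1 & r.-1 * 2 <= (r - 2) * 3].
Proof. by split; lia. Qed.

Section Regularization.
Variables (r : nat) (V : finType).
Local Notation T := {ffun 'I_r -> V}.
Implicit Types (F G : {set T}) (e : T) (c : 'I_r).

Definition coord_proj c e : {ffun {i : 'I_r | i != c} -> V} := [ffun i => e (val i)].
Definition coord_fibre F c e := [set e' in F | coord_proj c e' == coord_proj c e].
Definition codegree F c c' e := #|[set e' in F | (e' c == e c) && (e' c' == e c')]|.

Lemma card_coord_proj F c : #|[set coord_proj c e | e in F]| <= #|V| ^ r.-1.
Proof.
apply: leq_trans (max_card _) _; rewrite card_ffun card_sig.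
by rewrite (_ : #|_| = r.-1) // -[in RHS](card_ord r) -(cardC1 c); apply: eq_card.
Qed.

(** Deleting a small fibre costs fewer than [t] elements and removes a point from one of the
    projections, so the total loss is at most [t] times the sum of their sizes. *)
Lemma clean_fibres t F : exists F', [/\ F' \subset F,
  forall c e, e \in F' -> t <= #|coord_fibre F' c e|
  & #|F| <= #|F'| + t * \sum_c #|[set coord_proj c e | e in F]|].
Proof.
have [m] := ubnP #|F|; elim: m F => [//|m IH] F Fm.
have [/existsP[c /existsP[e /andP[eF lt]]]|] :=
    boolP [exists c, exists e, (e \in F) && (#|coord_fibre F c e| < t)]; last first.
  rewrite negb_exists => /forallP none; exists F; split=> //; last by rewrite leq_addr.
  move=> c e eF; have := none c; rewrite negb_exists => /forallP/(_ e).
  by rewrite eF /= -leqNgt.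
pose F1 := F :\: coord_fibre F c e.
have fF : coord_fibre F c e \subset F by apply/subsetP => x; rewrite inE; case/andP.
have ef : e \in coord_fibre F c e by rewrite inE eF eqxx.
have cF1 : #|F| = #|F1| + #|coord_fibre F c e|.
  by rewrite cardsD (setIidPr fF) subnK // subset_leq_card.
have F1m : #|F1| < m.
  have : 0 < #|coord_fibre F c e| by apply/card_gt0P; exists e.
  by move: Fm; rewrite ltnS cF1; lia.
have F1F : F1 \subset F by apply: subsetDl.
have [F' [F'F t' cF']] := IH F1 F1m; exists F'; split=> //; first exact: subset_trans F'F F1F.
rewrite cF1; apply: leq_trans (leq_add cF' (ltnW lt)) _; rewrite -addnA leq_add2l -mulnSr leq_mul2l.
apply/orP; right; rewrite (bigD1 c) //= [X in _ <= X](bigD1 c) //= -addSn leq_add //.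
  apply: proper_card; apply/properP; split; first exact: imsetS.
  exists (coord_proj c e); first exact: imset_f.
  apply/imsetP => -[e' e'F1 E]; move: e'F1; rewrite !inE => /andP[]; rewrite -E eqxx andbT.
  by move/negP.
by apply: leq_sum => c' _; apply: subset_leq_card; apply: imsetS.
Qed.

Lemma coord_sum F c (X : {set V}) :
  \sum_(x in X) #|[set e in F | e c == x]| = #|[set e in F | e c \in X]|.
Proof.
under eq_bigr => x _ do rewrite -sum1_card.
rewrite (exchange_big_dep (fun e => (e \in F) && (e c \in X))) /=; last first.
  by move=> x e xX; rewrite inE => /andP[-> /eqP ->].
rewrite -sum1_card; apply: eq_big => [e|e /andP[eF eX]]; first by rewrite inE.
rewrite (big_pred1 (e c)) // => x; rewrite inE eF /= eq_sym.
by case: eqP => [->|]; rewrite ?eX ?andbF.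
Qed.

Lemma card_le_prod F (Y : 'I_r -> {set V}) : (forall e, e \in F -> forall c, e c \in Y c) ->
  #|F| <= \prod_c #|Y c|.
Proof.
move=> h; apply: leq_trans (_ : #|family (fun c => mem (Y c))| <= _).
  by apply: subset_leq_card; apply/subsetP => e /h eY; apply/familyP.
by rewrite card_family foldrE big_map big_enum.
Qed.

Lemma large_class (I : finType) F (f : T -> I) : 0 < #|I| ->
  exists i, #|F| <= #|I| * #|[set e in F | f e == i]|.
Proof.
move=> /card_gt0P[i0 _]; pose g i := #|[set e in F | f e == i]|.
exists [arg max_(i > i0) g i]; case: arg_maxnP => // i _ gi.
have -> : #|F| = \sum_j g j.
  rewrite /g; under eq_bigr => j _ do rewrite -sum1_card.
  rewrite (exchange_big_dep (mem F)) /=; last by move=> j e _; rewrite inE => /andP[].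
  rewrite -sum1_card; apply: eq_bigr => e eF.
  by rewrite (big_pred1 (f e)) // => j; rewrite inE eF eq_sym.
by rewrite -sum_nat_const; apply: leq_sum => j _; apply: gi.
Qed.

(** [nu] is the ratio of the smaller degree bound to the codegree bound. The numbers of vertices are
    compared with [#|G|] because the degrees are bounded below only in [G]. *)
Record regular_pair (F G : {set T}) (t : nat) (a b : 'I_r) (p q de nu : nat) : Prop := RegularPair {
  reg_ab : a != b;
  reg_pq : p <= q;
  reg_p : nu * de = p;
  reg_p0 : 0 < p;
  reg_a : forall x, #|[set e in F | e a == x]| <= p;
  reg_b : forall x, #|[set e in F | e b == x]| <= q;
  reg_ab_le : forall x y, #|[set e in F | (e a == x) && (e b == y)]| <= de;
  reg_na : #|[set e a | e : T in F]| * p <= 2 * #|G|;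
  reg_nb : #|[set e b | e : T in F]| * q <= 2 * #|G|;
  reg_nu : #|V| ^ 2 <= 8 * nu ^ 3;
  reg_fibre : forall c e, e \in F -> t <= #|coord_fibre F c e| }.

(** Codegrees are measured once, in [G]. Upper bounds pass to every subset of a dyadic class, so a
    single pigeonhole over all pairs of coordinates suffices and the later cleaning of fibres cannot
    spoil it. *)
Lemma regular_pair_exists (G : {set T}) t w : 4 <= r -> 0 < t -> #|V| ^ r < 2 ^ w.+1 -> 0 < #|V| ->
    2 * t * r * #|V| ^ r.-1 * w.+1 ^ (r * r) <= #|G| ->
  exists F a b p q de nu,
    [/\ F \subset G, #|G| <= 2 * w.+1 ^ (r * r) * #|F|, 0 < #|F| & regular_pair F G t a b p q de nu].
Proof.
move=> r4 t0 nw n0 Gbig; set n := #|V| in nw n0 Gbig.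
pose kap e : {ffun 'I_r * 'I_r -> 'I_w.+1} := [ffun x => inord (trunc_log 2 (codegree G x.1 x.2 e))].
have cardI : #|{ffun 'I_r * 'I_r -> 'I_w.+1}| = w.+1 ^ (r * r).
  by rewrite card_ffun card_prod !card_ord.
have Z0 : 0 < w.+1 ^ (r * r) by rewrite expn_gt0.
have [k0 G1big] : exists i, #|G| <= w.+1 ^ (r * r) * #|[set e in G | kap e == i]|.
  by rewrite -cardI; apply: large_class; rewrite cardI.
set G1 := [set _ in _ | _] in G1big.
have G1G : G1 \subset G by apply/subsetP => e; rewrite inE => /andP[].
have codeg_gt0 c c' e : e \in G -> 0 < codegree G c c' e.
  by move=> eG; apply/card_gt0P; exists e; rewrite inE eG !eqxx.
have kapE e c c' : e \in G1 -> 2 ^ k0 (c, c') <= codegree G c c' e < 2 ^ (k0 (c, c')).+1.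
  rewrite inE => /andP[eG /eqP <-]; rewrite ffunE /= inordK; first exact: trunc_log_bounds (codeg_gt0 _ _ _ eG).
  rewrite -(@ltn_exp2l 2) //; apply: leq_ltn_trans (trunc_logP _ (codeg_gt0 _ _ _ eG)) _ => //.
  apply: leq_ltn_trans (leq_trans _ _) nw; last exact: leqnn.
  by apply: leq_trans (max_card _) _; rewrite card_ffun card_ord.
have [F [FG1 Ffib Fbig]] := clean_fibres t G1.
have shadow : \sum_c #|[set coord_proj c e | e in G1]| <= r * n ^ r.-1.
  rewrite -[X in X * _]card_ord -sum_nat_const; apply: leq_sum => c _; exact: card_coord_proj.
have G1big2 : 2 * t * r * n ^ r.-1 <= #|G1|.
  by rewrite -(leq_pmul2l Z0); apply: leq_trans G1big; rewrite mulnC.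
have tsh : 2 * (t * \sum_c #|[set coord_proj c e | e in G1]|) <= #|G1|.
  apply: leq_trans G1big2; rewrite -!mulnA leq_mul2l /= leq_mul2l; apply/orP; right; exact: shadow.
have GF : #|G1| <= 2 * #|F| by lia.
have F_n : n ^ r.-1 <= #|F|.
  apply: leq_trans (_ : t * r * n ^ r.-1 <= _); last by nia.
  by rewrite leq_pmull // muln_gt0 t0; lia.
have F0 : 0 < #|F| by apply: leq_trans F_n; rewrite expn_gt0 n0.
have FG : F \subset G by apply: subset_trans FG1 G1G.
(* [a] has the least degree, whence [p <= q]; [b] then has the least codegree with [a], which makes
   [nu] as large as possible. *)
pose a := [arg min_(c < Ordinal (ltn_trans (isT : 0 < 3) r4)) (k0 (c, c) : nat)].
have amin c : k0 (a, a) <= k0 (c, c) by rewrite /a; case: arg_minnP => // i _; apply.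
have [b0 b0a] : exists b0, b0 != a.
  apply/existsP; rewrite -negb_forall; apply/negP => /forallP h.
  have := card_ord r; rewrite (eq_card (_ : _ =i pred1 a)) ?card1 => [|c]; last by rewrite !inE (eqP (h c)) eqxx.
  by move=> r1; have := r4; rewrite -r1.
pose b := [arg min_(c < b0 | c != a) (k0 (a, c) : nat)].
have [ba bmin] : b != a /\ forall c, c != a -> k0 (a, b) <= k0 (a, c).
  by rewrite /b; case: arg_minnP => // i.
have [e0 e0F] : exists e0, e0 \in F by apply/card_gt0P.
have e0G1 := subsetP FG1 _ e0F.
have kab c : k0 (a, c) <= k0 (a, a).
  rewrite -ltnS -(@ltn_exp2l 2) //.
  have /andP[h _] := kapE e0 a c e0G1; have /andP[_ h2] := kapE e0 a a e0G1.
  apply: leq_ltn_trans h _; apply: leq_ltn_trans h2; apply: subset_leq_card.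
  by apply/subsetP => e; rewrite !inE => /andP[-> /andP[-> _]].
pose p := 2 ^ (k0 (a, a)).+1; pose q := 2 ^ (k0 (b, b)).+1; pose de := 2 ^ (k0 (a, b)).+1.
pose nu := 2 ^ (k0 (a, a) - k0 (a, b)).
have degG c x : x \in [set e c | e : T in F] ->
    2 ^ k0 (c, c) <= #|[set e in G | e c == x]| < 2 ^ (k0 (c, c)).+1.
  case/imsetP=> e eF ->; have := kapE e c c (subsetP FG1 _ eF).
  by rewrite /codegree; under eq_finset => e' do rewrite andbb.
have degF c x : #|[set e in F | e c == x]| <= 2 ^ (k0 (c, c)).+1.
  have [xi|nx] := boolP (x \in [set e c | e : T in F]).
    have /andP[_ /ltnW] := degG c x xi; apply: leq_trans; apply: subset_leq_card.
    by apply/subsetP => e; rewrite !inE => /andP[/(subsetP FG) -> ->].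
  rewrite (_ : [set e in F | e c == x] = set0) ?cards0 //; apply/setP => e; rewrite !inE.
  by apply/negP => /andP[eF /eqP ex]; case/negP: nx; rewrite -ex; apply: imset_f.
have nF c : #|[set e c | e : T in F]| * 2 ^ (k0 (c, c)).+1 <= 2 * #|G|.
  rewrite expnS mulnCA leq_mul2l /= -sum_nat_const.
  apply: leq_trans (_ : \sum_(x in [set e c | e : T in F]) #|[set e in G | e c == x]| <= _).
    by apply: leq_sum => x /(degG c) /andP[].
  by rewrite coord_sum subset_leq_card //; apply/subsetP => e; rewrite inE => /andP[].
have nude : nu * de = p by rewrite /nu /de /p -expnD addnS subnK.
have de0 : 0 < de by rewrite expn_gt0.
have codF x y : #|[set e in F | (e a == x) && (e b == y)]| <= de.
  have [->|[e]] := set_0Vmem [set e in F | (e a == x) && (e b == y)]; first by rewrite cards0.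
  rewrite inE => /andP[eF /andP[/eqP ex /eqP ey]].
  have /andP[_ /ltnW] := kapE e a b (subsetP FG1 _ eF); apply: leq_trans; apply: subset_leq_card.
  by apply/subsetP => e'; rewrite !inE ex ey => /andP[/(subsetP FG) -> ->].
(* At each other coordinate the edges of [F] through [x] take at most [2 * nu] values: each value
   accounts for at least [2 ^ k0 (a, b)] of the fewer than [2 ^ (k0 (a, a)).+1] edges of [G] through
   [x]. *)
have degF2 x : #|[set e in F | e a == x]| <= (2 * nu) ^ r.-1.
  pose Y c := if c == a then [set x] else [set e c | e : T in F & e a == x].
  apply: leq_trans (@card_le_prod _ Y _) _.
    move=> e; rewrite inE => /andP[eF ex] c; rewrite /Y; case: eqP => [->|_]; first by rewrite inE.
    by apply/imsetP; exists e; rewrite // inE eF.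
  rewrite (bigD1 a) //= {1}/Y eqxx cards1 mul1n.
  apply: leq_trans (_ : \prod_(c | c != a) (2 * nu) <= _); last first.
    by rewrite prod_nat_const (_ : #|_| = r.-1) // -[in RHS](card_ord r) -(cardC1 a); apply: eq_card.
  apply: leq_prod => c ca; rewrite /Y (negPf ca).
  have [xi|nx] := boolP (x \in [set e a | e : T in F]); last first.
    rewrite (_ : [set e c | e : T in F & e a == x] = set0) ?cards0 //; apply/setP => y; rewrite !inE.
    apply/negP => /imsetP[e]; rewrite inE => /andP[eF /eqP ex] _.
    by case/negP: nx; rewrite -ex; apply: imset_f.
  have /andP[_ /ltnW hx] := degG a x xi.
  rewrite -(leq_pmul2r de0) -mulnA nude /p /de expnS mulnCA leq_mul2l /=.
  apply: leq_trans hx; apply: leq_trans (_ : #|[set e c | e : T in F & e a == x]| * 2 ^ k0 (a, c) <= _).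
    by rewrite leq_mul2l leq_exp2l // bmin // orbT.
  rewrite -sum_nat_const.
  apply: leq_trans (_ : \sum_(y in [set e c | e : T in F & e a == x])
      #|[set e in [set e in G | e a == x] | e c == y]| <= _).
    apply: leq_sum => y /imsetP[e]; rewrite inE => /andP[eF /eqP ex] ->.
    have /andP[h _] := kapE e a c (subsetP FG1 _ eF); apply: leq_trans h _.
    by apply: subset_leq_card; apply/subsetP => e'; rewrite !inE ex andbA.
  by rewrite coord_sum subset_leq_card //; apply/subsetP => e; rewrite inE => /andP[].
exists F, a, b, p, q, de, nu; split=> //.
  by apply: leq_trans G1big _; rewrite -mulnA mulnCA leq_mul2l GF orbT.
split=> //.
- by rewrite eq_sym.
- by rewrite leq_exp2l // ltnS amin.
- by rewrite expn_gt0.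
(* Summing over the vertices, [n ^ r.-1 <= #|F| <= n * (2 * nu) ^ r.-1]. Thus [2 * nu] is at least
   [n ^ ((r - 2) / (r - 1))], which is at least [n ^ (2 / 3)] for [r >= 4]. *)
- have [r2 r1 r3] := uniformity_arith r4.
  have h : n ^ (r - 2) <= (2 * nu) ^ r.-1.
    have h1 : #|F| <= n * (2 * nu) ^ r.-1.
      apply: leq_trans (_ : \sum_(x in [set: V]) #|[set e in F | e a == x]| <= _).
        by rewrite coord_sum subset_leq_card //; apply/subsetP => e eF; rewrite !inE eF.
      by rewrite /n -cardsT -sum_nat_const; apply: leq_sum => x _; apply: degF2.
    rewrite -(leq_pmul2l n0) -expnS r2.
    exact: leq_trans F_n h1.
  rewrite (_ : 8 * nu ^ 3 = (2 * nu) ^ 3); last by rewrite expnMn.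
  rewrite leqNgt; apply/negP => lt.
    have : ((2 * nu) ^ 3) ^ r.-1 < (n ^ 2) ^ r.-1 by rewrite ltn_exp2r.
  rewrite ltnNge => /negP; apply; rewrite -!expnM [3 * _]mulnC [X in _ <= X]expnM.
  apply: leq_trans (_ : (n ^ (r - 2)) ^ 3 <= _); last by rewrite leq_exp2r.
  by rewrite -expnM [2 * _]mulnC leq_pexp2l.
Qed.

End Regularization.

(** * Balanced supersaturation of linear cycles *)

Lemma double_pred_le l : 1 < l -> (l + l).-1 <= l.-1 * 3.
Proof. by lia. Qed.

Lemma collision_const_le l : 1 < l ->
  4 * (l + l) ^ 2 <= 2 ^ (l + l).+2 * (2 ^ (l + l) * (2 * (l + l)) ^ (l + l)).
Proof.
move=> l2; rewrite -[X in X <= _]mul1n; apply: leq_mul; first by rewrite expn_gt0.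
apply: leq_trans (_ : (2 * (l + l)) ^ (l + l) <= _); last by rewrite leq_pmull ?expn_gt0.
rewrite (_ : 4 * _ = (2 * (l + l)) ^ 2); last by rewrite expnMn.
by rewrite leq_pexp2l //; lia.
Qed.

Section PartiteCycles.
Variables (r : nat) (V : finType).
Local Notation T := {ffun 'I_r -> V}.
Local Notation D := (T * bool)%type.
Local Notation W := (bool * V)%type.

(* A dart [(e, s)] traverses the edge [e] from its [a]-coordinate to its [b]-coordinate if [s] is
   false, and in the other direction if [s] is true. *)
Definition dart_coord (a b : 'I_r) (s : bool) := if s then b else a.
Definition dart_src (a b : 'I_r) (d : D) : W := (d.2, d.1 (dart_coord a b d.2)).
Definition dart_tgt (a b : 'I_r) (d : D) : W := (~~ d.2, d.1 (dart_coord a b (~~ d.2))).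
Definition dart_rev (d : D) : D := (d.1, ~~ d.2).

(** Vertices of different parts may coincide as elements of [V], so distinctness is required part by
    part; the parts [a] and [b] are told apart by the tag in [W]. *)
Definition partite_cycle_walk a b (s : seq D) :=
  [&& closed_walk (dart_src a b) (dart_tgt a b) predT s, uniq (map (dart_src a b) s)
    & [forall c : 'I_r, (c != a) && (c != b) ==> uniq (map (fun d : D => d.1 c) s)]].

Definition partite_cycles k : {set {set T}} :=
  [set X | [exists a, [exists b, [exists s : k.-tuple D,
     [&& a != b, partite_cycle_walk a b s & X == [set e in map fst s]]]]]].

Lemma tsum_all (A : {set D}) j : tsum j (fun s => all (mem A) s) = #|A| ^ j.
Proof.
elim: j => [|j IH]; first by rewrite tsum0.
rewrite tsumS expnS -IH -sum_nat_const [RHS]big_mkcond /=; apply: eq_bigr => d _.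
by case: (d \in A) => //=; apply: big1.
Qed.

Section SaturatedLists.
Variables (H : {set {set T}}) (k Q : nat).
Hypotheses (k0 : 0 < k) (Q0 : 0 < Q) (Huni : forall X, X \in H -> #|X| = k).

Definition sat_list (s : seq D) :=
  let X := [set e in map fst s] in
  (#|X| == size s) && (Q ^ (k - #|X|) <= hdeg H X).

Lemma sat_list_perm s1 s2 : perm_eq s1 s2 -> sat_list s1 = sat_list s2.
Proof.
move=> p12; rewrite /sat_list (perm_size p12).
have -> // : [set e in map fst s1] = [set e in map fst s2].
by apply/setP => e; rewrite !inE; apply: (perm_mem (perm_map fst p12)).
Qed.

(** Double counting: fewer than [Q ^ k.-1] members of [H] contain [e], each has [2 ^ k] subsets, and
    each saturated set of size [j.+1] lies in at least [Q ^ (k - j.+1)] members. *)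
Lemma count_sat_sets e j : hdeg H [set e] < Q ^ k.-1 ->
  #|[set X : {set T} | [&& e \in X, #|X| == j.+1 & Q ^ (k - j.+1) <= hdeg H X]]| <= 2 ^ k * Q ^ j.
Proof.
move=> unsat; set S := [set _ | _].
have [kj|jk] := ltnP k j.+1.
  rewrite (_ : S = set0) ?cards0 //; apply/setP => X; rewrite !inE; apply/negP => /and3P[_ /eqP Xj].
  rewrite (_ : k - j.+1 = 0) ?expn0; last by lia.
  move=> /card_gt0P[Y]; rewrite inE => /andP[/Huni Yk /subset_leq_card].
  by rewrite Yk Xj leqNgt kj.
have Qk0 : 0 < Q ^ (k - j.+1) by rewrite expn_gt0 Q0.
rewrite -(leq_pmul2r Qk0) -sum_nat_const.
apply: leq_trans (_ : \sum_(X : {set T} | e \in X) hdeg H X <= _).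
  rewrite [X in X <= _]big_mkcond [X in _ <= X]big_mkcond /=; apply: leq_sum => X _.
  by rewrite inE; case: (e \in X) => //=; case: ifP => // /andP[].
rewrite sum_hdeg; apply: leq_trans (_ : \sum_(Y in [set Y in H | [set e] \subset Y]) 2 ^ k <= _).
  rewrite [X in X <= _]big_mkcond [X in _ <= X]big_mkcond /=; apply: leq_sum => Y _.
  rewrite inE; case: (boolP (Y \in H)) => //= YH; rewrite sub1set.
  have [eY|neY] := boolP (e \in Y).
    rewrite -(Huni YH) -card_powerset subset_leq_card //.
    by apply/subsetP => X; rewrite !inE => /andP[].
  rewrite (_ : [set _ | _] = set0) ?cards0 //; apply/setP => X; rewrite !inE.
  by apply/negP => /andP[eX /subsetP/(_ e eX)]; apply/negP.
rewrite sum_nat_const mulnC -mulnA leq_mul2l -expnD (_ : j + _ = k.-1); last by lia.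
by rewrite ltnW ?orbT.
Qed.

Lemma count_sat_lists d j : hdeg H [set d.1] < Q ^ k.-1 ->
  tsum j (fun s => sat_list (d :: s)) <= 2 ^ k * (2 * k) ^ k * Q ^ j.
Proof.
move=> unsat; set S := [set X : {set T} | [&& d.1 \in X, #|X| == j.+1 & Q ^ (k - j.+1) <= hdeg H X]].
have [kj|jk] := ltnP k j.+1.
  rewrite (_ : tsum _ _ = 0) //; apply: big1 => s _; apply/eqP; rewrite eqb0; apply/negP.
  rewrite /sat_list /= size_tuple => /andP[/eqP Xj]; rewrite Xj.
  rewrite (_ : k - j.+1 = 0) ?expn0; last by lia.
  move=> /card_gt0P[Y]; rewrite inE => /andP[/Huni Yk /subset_leq_card].
  by rewrite Yk Xj leqNgt kj.
apply: leq_trans (_ : tsum j (fun s => \sum_(X in S) all (mem [set d' : D | d'.1 \in X]) s) <= _).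
  apply: leq_tsum => s sz; case: (boolP (sat_list _)) => //.
  rewrite /sat_list /= sz => /andP[/eqP Xj hX].
  rewrite (bigD1 [set e in map fst (d :: s)]) /=; last first.
    by rewrite inE Xj eqxx inE mem_head /= -Xj.
  rewrite (_ : all _ s = true) //; apply/allP => d' d's; rewrite !inE.
  by rewrite map_f ?orbT.
rewrite tsum_sum; apply: leq_trans (_ : \sum_(X in S) (2 * k) ^ k <= _).
  apply: leq_sum => X; rewrite inE => /and3P[_ /eqP Xj _]; rewrite tsum_all.
  have -> : #|[set d' : D | d'.1 \in X]| = #|X| * 2.
    rewrite -card_bool -cardX; apply: eq_card => -[e s]; rewrite !inE /= andbT.
    by [].
  rewrite Xj mulnC.
  apply: leq_trans (_ : (2 * k) ^ j <= _); last by rewrite leq_pexp2l //; lia.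
  by case: (j) jk => [//|i] ik; rewrite leq_exp2r // leq_mul2l.
rewrite sum_nat_const [X in _ <= X]mulnAC leq_mul2r; apply/orP; right.
exact: count_sat_sets.
Qed.

End SaturatedLists.

Section Supersaturation.
Variables (l t w n m0 Q : nat).
Let k := l + l.
Let Z := w.+1 ^ (r * r).
(** Regularization will give [2 * #|G0| <= L1 * #|F|], which costs a factor [L1 ^ 2] in each of the
    [l] double steps of the lower bound on closed walks; together these make up [L2]. *)
Let L1 := 4 * Z.
Let L2 := L1 ^ k.
Let C0 := 2 ^ k * (2 * k) ^ k.
Let c := 2 ^ k.+2.
Let L := 4 * c * C0 * L2.
Hypotheses (r4 : 4 <= r) (l2 : 1 < l) (Q0 : 0 < Q) (nE : n = #|V|) (n0 : 0 < n) (m00 : 0 < m0)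
  (tE : t = 4 * (r * k ^ 2)) (nw : n ^ r < 2 ^ w.+1) (nm0 : n <= m0 ^ k.-1)
  (nbig : 64 * (c * (2 * C0 * L2)) ^ 3 <= n).

Lemma good_cycle_exists (G0 : {set T}) (H : {set {set T}}) :
    (forall X, X \in H -> #|X| = k) -> (forall e, e \in G0 -> hdeg H [set e] < Q ^ k.-1) ->
    2 * t * r * n ^ r.-1 * Z <= #|G0| -> Q * n * (m0 * L) * (2 * Z) <= #|G0| ->
  exists X, [/\ X \in partite_cycles k, X \subset G0, #|X| = k &
    forall Y : {set T}, Y \subset X -> Y != set0 -> hdeg H Y < Q ^ (k - #|Y|)].
Proof.
move=> Huni unsat G0big Qle.
have k0 : 0 < k by rewrite addn_gt0 ltnW.
have Z0 : 0 < Z by rewrite expn_gt0.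
have t0 : 0 < t by rewrite tE !muln_gt0 k0; lia.
have C00 : 0 < C0 by rewrite muln_gt0 !expn_gt0 muln_gt0 k0.
have c0 : 0 < c by rewrite expn_gt0.
have L20 : 0 < L2 by rewrite expn_gt0 muln_gt0 Z0.
have V0 : 0 < #|V| by rewrite -nE.
have Vw : #|V| ^ r < 2 ^ w.+1 by rewrite -nE.
rewrite nE in G0big.
have [F [a [b [p [q [de [nu [FG GF F0 reg]]]]]]]] := regular_pair_exists r4 t0 Vw V0 G0big.
case: reg => ab pq nude p0 degA degB codeg na nb nu3 fibre.
pose src := dart_src a b; pose tgt := dart_tgt a b.
pose E : {set D} := [set d : D | d.1 \in F].
have rvK : involutive dart_rev by case=> e s; rewrite /dart_rev /= negbK.
have srcrv d : src (dart_rev d) = tgt d by [].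
have Erv d : (dart_rev d \in E) = (d \in E) by rewrite !inE.
have side_tgt d : fst (tgt d) = ~~ fst (src d) by [].
have deg_le x : #|[set d in E | src d == x]| <= (if x.1 then q else p).
  case: x => s x; apply: leq_trans (_ : #|[set e in F | e (dart_coord a b s) == x]| <= _); last first.
    by rewrite /dart_coord; case: s => /=.
  rewrite -(card_imset _ (_ : injective (fun e : T => (e, s)))); last by move=> e e' [].
  apply: subset_leq_card; apply/subsetP => -[e s']; rewrite !inE /= => /andP[eF].
  rewrite /src /dart_src /= => /eqP [-> ex]; apply/imsetP; exists e => //.
  by rewrite inE eF ex eqxx.
have codeg_le x y : nwalks src tgt E 1 x y <= de.
  rewrite nwalks1; case: x => s x; case: y => s' y.
  apply: leq_trans (codeg (if s then y else x) (if s then x else y)).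
  rewrite -[X in _ <= X](card_imset _ (_ : injective (fun e : T => (e, s)))); last by move=> e e' [].
  apply: subset_leq_card; apply/subsetP => -[e s2]; rewrite !inE /= => /and3P[eF].
  rewrite /src /tgt /dart_src /dart_tgt /= => /eqP [-> ex] /eqP[_ ey]; apply/imsetP; exists e => //.
  by rewrite inE eF /=; move: ex ey; rewrite /dart_coord; case: s => /= -> ->; rewrite !eqxx.
have q0 : 0 < q by apply: leq_trans p0 pq.
have nu0 : 0 < nu by move: p0; rewrite -nude muln_gt0 => /andP[].
have cardE : #|E| = 2 * #|F|.
  by rewrite mulnC -card_bool -cardX; apply: eq_card => -[e s]; rewrite !inE andbT.
have Fnp : #|F| <= n * p.
  apply: leq_trans (_ : \sum_(x in [set: V]) #|[set e in F | e a == x]| <= _).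
    by rewrite coord_sum subset_leq_card //; apply/subsetP => e eF; rewrite !inE eF.
  by rewrite nE -cardsT -sum_nat_const; apply: leq_sum => x _.
have Qle' : Q * (m0 * L) <= p.
  rewrite -(leq_pmul2l n0); apply: leq_trans Fnp.
  have Z20 : 0 < 2 * Z by rewrite muln_gt0.
  rewrite -(leq_pmul2r Z20); apply: leq_trans (_ : #|G0| <= _); last by rewrite mulnC.
  by apply: leq_trans Qle; rewrite leq_eqVlt; apply/orP; left; apply/eqP; lia.
have Tle : (p * q) ^ l <= L2 * nclosed src tgt E k.
  pose A : {set W} := [set (false, x) | x in [set e a | e : T in F]].
  pose B : {set W} := [set (true, x) | x in [set e b | e : T in F]].
  have cA : #|A| = #|[set e a | e : T in F]| by apply: card_imset => x y [].
  have cB : #|B| = #|[set e b | e : T in F]| by apply: card_imset => x y [].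
  have [e0 e0F] : exists e, e \in F by apply/card_gt0P.
  have A0 : 0 < #|A| by rewrite cA; apply/card_gt0P; exists (e0 a); apply: imset_f.
  have B0 : 0 < #|B| by rewrite cB; apply/card_gt0P; exists (e0 b); apply: imset_f.
  have eF : #|F| <= \sum_(x in A) \sum_(y in B) nwalks src tgt E 1 x y.
    under eq_bigr => x _ do under eq_bigr => y _ do rewrite nwalks1.
    rewrite -sum1_card.
    apply: leq_trans (_ : \sum_(e in F) \sum_(x in A) \sum_(y in B)
       ((src (e, false) == x) && (tgt (e, false) == y)) <= _).
      apply: leq_sum => e eF; rewrite (bigD1 (false, e a)) /=; last first.
        by apply: imset_f; apply: imset_f.
      rewrite (bigD1 (true, e b)) /=; last by apply: imset_f; apply: imset_f.
      by rewrite !eqxx.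
    rewrite exchange_big /=; apply: leq_sum => x _.
    rewrite exchange_big /=; apply: leq_sum => y _.
    apply: leq_trans (_ : #|[set e in F | (src (e, false) == x) && (tgt (e, false) == y)]| <= _).
      rewrite -sum1_card [X in X <= _]big_mkcond [X in _ <= X]big_mkcond /=; apply: leq_sum => e _.
      by rewrite inE; case: (e \in F) => //=; case: (_ && _).
    rewrite -(card_imset _ (_ : injective (fun e : T => (e, false)))); last by move=> e e' [].
    rewrite subset_leq_card //; apply/subsetP => _ /imsetP[e + ->]; rewrite !inE /=.
    by [].
  have low := nclosed_lower rvK srcrv Erv l eF A0 B0.
  have AB0 : 0 < (#|A| * #|B|) ^ l by rewrite expn_gt0 muln_gt0 A0 B0.
  rewrite -(leq_pmul2l AB0).
  apply: leq_trans (_ : L2 * (#|F| ^ 2) ^ l <= _); last by rewrite mulnCA leq_mul2l low orbT.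
  have -> : L2 = (L1 ^ 2) ^ l by rewrite /L2 -expnM mul2n -addnn.
  have G0F : 2 * #|G0| <= L1 * #|F|.
    by rewrite /L1 -[4]/(2 * 2) -!mulnA leq_mul2l /= mulnA.
  rewrite -!expnMn; have h : #|A| * #|B| * (p * q) <= L1 ^ 2 * #|F| ^ 2.
    have hA : #|A| * p <= L1 * #|F|.
      by rewrite cA; apply: leq_trans na _.
    have hB : #|B| * q <= L1 * #|F|.
      by rewrite cB; apply: leq_trans nb _.
    by rewrite mulnACA -expnMn -mulnn leq_mul.
  by rewrite leq_exp2r ?(ltnW l2) // expnMn.
have T0 : 0 < nclosed src tgt E k.
  by rewrite lt0n; apply/eqP => T0; move: Tle; rewrite T0 muln0 leqNgt expn_gt0 muln_gt0 p0 q0.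
(* From [n ^ 2 <= 8 * nu ^ 3], [nu ^ 2] is at least of order [n ^ (4 / 3)]; by [nbig] the surplus
   [n ^ (1 / 3)] absorbs the other factors. *)
have nu2 : c * (2 * n * C0 * L2) <= nu ^ 2.
  rewrite (_ : c * _ = n * (c * (2 * C0 * L2))); last by lia.
  pose K := c * (2 * C0 * L2); rewrite -/K leqNgt; apply/negP => lt.
  have nbig' : 64 * K ^ 3 <= n by [].
  have h1 : (nu ^ 2) ^ 3 < (n * K) ^ 3 by rewrite ltn_exp2r.
  have h2 : (n ^ 2) ^ 2 <= (8 * nu ^ 3) ^ 2 by rewrite leq_exp2r // nE.
  have h3 : n ^ 4 <= 64 * (nu ^ 2) ^ 3.
    apply: leq_trans (_ : (n ^ 2) ^ 2 <= _); first by rewrite -expnM.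
    by apply: leq_trans h2 _; rewrite expnMn -!expnM.
  have h4 : n ^ 4 < 64 * (n * K) ^ 3.
    by apply: leq_ltn_trans h3 _; rewrite ltn_mul2l.
  by move: h4; rewrite expnMn mulnCA [n ^ 4]expnSr ltn_mul2l => /andP[_]; rewrite ltnNge nbig'.
have nnu : n <= 2 * nu * m0 ^ l.-1.
  rewrite leqNgt; apply/negP => lt.
  have h1 : (2 * nu * m0 ^ l.-1) ^ 3 < n ^ 3 by rewrite ltn_exp2r.
  have h2 : n ^ 3 <= 8 * nu ^ 3 * m0 ^ k.-1.
    by rewrite expnSr leq_mul // nE.
  move: h1; rewrite ltnNge => /negP; apply; apply: leq_trans h2 _.
  rewrite !expnMn leq_mul2l; apply/orP; right; rewrite -expnM leq_pexp2l //.
  exact: double_pred_le.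
pose CL := {x : 'I_r | (x != a) && (x != b)}.
pose lab (x : CL) (d : D) := d.1 (val x).
have cardCL : #|{: CL}| <= r.
  by rewrite -[X in _ <= X]card_ord card_sig max_card.
pose sat := sat_list H k Q.
pose Y j := C0 * Q ^ j.-1.
have sat_perm s1 s2 : perm_eq s1 s2 -> sat s1 = sat s2 by apply: sat_list_perm.
have sat_le j d : d \in E -> 0 < j -> tsum j (fun s => sat (d :: s)) <= Y j.+1.
  rewrite inE => dF _; apply: count_sat_lists => //.
  by apply: unsat; apply: (subsetP FG).
(* Double counting: a dart with label [y] has at least [t] companions agreeing with it outside the
   coordinate [x], and a companion determines the dart by resetting that coordinate to [y]. *)
have fib (x : CL) u v y : #|[pred d in E | [&& src d == u, tgt d == v & lab x d == y]]| * t <= nwalks src tgt E 1 u v.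
  rewrite nwalks1 -sum_nat_const.
  have /andP[xa xb] := valP x.
  apply: leq_trans (_ : \sum_(d | d \in [pred d in E | [&& src d == u, tgt d == v & lab x d == y]])
      \sum_(d' | d' \in [pred d' in E | (src d' == u) && (tgt d' == v)]) ((coord_proj (val x) d'.1 == coord_proj (val x) d.1) && (d'.2 == d.2)) <= _).
    apply: leq_sum => -[e s]; rewrite inE /= => /andP[]; rewrite inE /= => eF /and3P[/eqP eu /eqP ev _].
    apply: leq_trans (fibre (val x) e eF) _.
    rewrite -(card_imset _ (_ : injective (fun e : T => (e, s)))); last by move=> ? ? [].
    rewrite -sum1_card [X in X <= _]big_mkcond [X in _ <= X]big_mkcond /=; apply: leq_sum => d' _.
    case: imsetP => // -[e'] /[!inE] /andP[e'F /eqP pe] -> /=; rewrite e'F pe !eqxx /= -eu -ev.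
    have pc z : z != val x -> e' z = e z.
      by move=> zx; have := congr1 (fun g : {ffun _ -> _} => g (exist _ z zx)) pe; rewrite !ffunE.
    by rewrite /src /tgt /dart_src /dart_tgt /= /dart_coord; case: (s); rewrite /= !pc ?eqxx // eq_sym.
  rewrite exchange_big /= -sum1_card; apply: leq_sum => -[e' s'] _.
  pose e1 : T := [ffun i => if i == val x then y else e' i].
  apply: leq_trans (_ : \sum_d (d == (e1, s')) <= _); last first.
    by rewrite (bigD1 (e1, s')) //= eqxx big1 // => d /negPf ->.
  rewrite big_mkcond /=; apply: leq_sum => -[e s] _.
  rewrite inE /=; case: ifP => // /andP[_ /and3P[_ _ /eqP ey]].
  case: eqP => //= pe; case: eqP => //= ->; rewrite xpair_eqE eqxx andbT.
  case: eqP => // ne; case: ne; apply/ffunP => i; rewrite ffunE.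
  case: (eqVneq i (val x)) => [->//|ix].
  by have := congr1 (fun g : {ffun _ -> _} => g (exist _ i ix)) pe; rewrite !ffunE.
have masks (m : k.-tuple bool) : 1 < count id m -> c * nsat src tgt E sat k m <= nclosed src tgt E k.
  apply: (nsat_final rvK srcrv Erv side_tgt deg_le codeg_le pq _ sat_perm sat_le l2 p0 m00 nu0 C00 c0 L20 _ _ Qle' nm0 nnu nu2) => //.
  - by rewrite nude.
  - by rewrite cardE -mulnA leq_mul2l.
  - by rewrite size_tuple.
have nude' : nu * de <= p by rewrite nude.
have [||s [sz cw us ul ns]] :=
  good_walk_exists side_tgt deg_le codeg_le pq nude' fib (ltnW l2) T0 nu0 _ _ t0 masks.
- have -> : #|{: W}| = 2 * n by rewrite card_prod card_bool nE.
  apply: leq_trans (_ : 4 * (k ^ 2 * (2 * n * (L2 * nclosed src tgt E k))) <= _).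
    by rewrite !leq_mul2l Tle !orbT.
  rewrite (mulnA (2 * n)) (mulnA (k ^ 2)) (mulnA 4) leq_mul2r; apply/orP; right.
  apply: leq_trans nu2; have -> : 2 * n * C0 * L2 = C0 * (2 * n * L2) by rewrite mulnAC mulnC.
  by rewrite [4 * _]mulnA [c * _]mulnA leq_mul2r collision_const_le ?orbT.
- by rewrite tE !leq_mul2l leq_mul2r cardCL !orbT.
(* The distinct labels at one coordinate other than [a] and [b] show that the edges of the walk are
   distinct. *)
have [z _] : exists z : CL, true.
  have : 0 < #|[pred x : 'I_r | (x != a) && (x != b)]|.
    rewrite lt0n; apply/eqP => h; have := cardC [pred x : 'I_r | (x != a) && (x != b)].
    rewrite h card_ord (eq_card (_ : _ =i [set a; b])) => [|x]; last first.
      by rewrite !inE negb_and !negbK.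
    by rewrite cards2 ab => r2; have := r4; rewrite -r2.
  by case/card_gt0P=> x xab; exists (exist _ x xab).
have ufst : uniq (map fst s).
  by have := ul z; rewrite /lab (map_comp (fun e : T => e (val z)) fst) => /map_uniq.
pose X : {set T} := [set e in map fst s].
have Xk : #|X| = k by rewrite cardsE (card_uniqP ufst) size_map.
have walkE s' x x' : walk src tgt E x s' x' -> all (mem E) s' && walk src tgt predT x s' x'.
  by elim: s' x => [//|d s' IH] x /= /and3P[-> -> /IH].
have [x0 /walkE/andP[sE cw']] := existsP cw.
have XG0 : X \subset G0.
  apply/subsetP => e; rewrite inE => /mapP[d ds ->]; apply: (subsetP FG).
  by have := allP sE d ds; rewrite !inE.
exists X; split=> //.
- rewrite inE; apply/existsP; exists a; apply/existsP; exists b.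
  have sz' : size s == k by rewrite sz.
  apply/existsP; exists (Tuple sz'); rewrite ab eqxx andbT /=; apply/and3P; split=> //.
    by apply/existsP; exists x0.
  by apply/forallP => x; apply/implyP => xab; apply: (ul (exist _ x xab)).
- move=> S YX Y0; have [Y1|Y2] := leqP #|S| 1.
    have /eqP/cards1P[e eS] : #|S| = 1 by apply/eqP; rewrite eqn_leq Y1 card_gt0.
    rewrite eS cards1 subn1; apply: unsat; apply: (subsetP XG0); apply: (subsetP YX).
    by rewrite eS inE.
  pose P (d : D) := d.1 \in S.
  have fY : [set e in map fst (seq.filter P s)] = S.
    apply/setP => e; rewrite inE; apply/mapP/idP => [[d]|eS].
      by rewrite mem_filter => /andP[dY _] ->.
    have : e \in X by apply: (subsetP YX).
    by rewrite inE => /mapP[d ds ed]; exists d; rewrite // mem_filter /P -ed eS.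
  have szf : size (seq.filter P s) = #|S|.
    rewrite -fY cardsE (card_uniqP _) ?size_map //.
    by apply: subseq_uniq ufst; apply: map_subseq; apply: filter_subseq.
  have := ns (map P s); rewrite size_map sz => /(_ erefl).
  rewrite -filter_mask count_map -size_filter szf => /(_ Y2).
  by rewrite /sat /sat_list fY szf eqxx /= -ltnNge.
Qed.

Lemma balanced_supersaturation (G : {set T}) :
    4 * t * r * n ^ r.-1 * Z <= #|G| -> Q * n * (m0 * L) * (4 * Z) <= #|G| ->
  exists H : {set {set T}}, [/\ H \subset partite_cycles k,
    forall X, X \in H -> X \subset G /\ #|X| = k,
    forall S : {set T}, 0 < #|S| <= k -> hdeg H S <= 1 * Q ^ (k - #|S|)
    & #|G| * Q ^ k.-1 <= 2 * k * #|H|].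
Proof.
move=> Gbig Qle.
pose P (H : {set {set T}}) := [&& H \subset partite_cycles k,
  [forall X in H, (X \subset G) && (#|X| == k)] &
  [forall S : {set T}, (0 < #|S| <= k) ==> (hdeg H S <= Q ^ (k - #|S|))]].
have P0 : P set0.
  apply/and3P; split; first exact: sub0set.
    by apply/forall_inP => X; rewrite inE.
  apply/forallP => S; apply/implyP => _.
  by rewrite /hdeg (_ : [set _ in _ | _] = set0) ?cards0 //; apply/setP => X; rewrite !inE.
have [H] : exists2 H, P H & forall H', P H' -> #|H'| <= #|H|.
  by exists [arg max_(H > set0 | P H) #|H|]; case: arg_maxnP.
case/and3P=> Hcyc /forall_inP Hin /forallP Hdeg Hmax.
have Huni X : X \in H -> #|X| = k by move/Hin => /andP[_ /eqP].
exists H; split=> //.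
- by move=> X /Hin/andP[-> /eqP].
- by move=> S hS; have := Hdeg S; rewrite hS mul1n.
rewrite leqNgt; apply/negP => small.
(* The degrees in [H] of the elements of [G] sum to at most [k * #|H|], so a small [H] saturates at
   most half of [G]. *)
pose G0 := [set e in G | hdeg H [set e] < Q ^ k.-1].
have GG0 : #|G| <= 2 * #|G0|.
  have cG : #|G| = #|G0| + #|G :\: G0|.
    by rewrite -(cardsID G0 G) (setIidPr _) //; apply/subsetP => e; rewrite inE => /andP[].
  suff : 2 * #|G :\: G0| <= #|G| by rewrite cG; lia.
  rewrite -(@leq_pmul2r (Q ^ k.-1)) ?expn_gt0 ?Q0 //; apply: leq_trans (ltnW small).
  rewrite -!mulnA leq_mul2l /= -sum_nat_const.
  apply: leq_trans (_ : \sum_(e in G :\: G0) hdeg H [set e] <= _).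
    by apply: leq_sum => e; rewrite !inE => /andP[+ eG]; rewrite eG /= -leqNgt.
  apply: leq_trans (_ : \sum_(e | true) hdeg H [set e] <= _).
    by rewrite [X in X <= _]big_mkcond /=; apply: leq_sum => e _; case: ifP.
  under eq_bigr => e _ do rewrite /hdeg -sum1_card.
  rewrite (exchange_big_dep (mem H)) /=; last by move=> e X _; rewrite inE => /andP[].
  rewrite mulnC -sum_nat_const; apply: leq_sum => X XH.
  rewrite sum1_card -(Huni X XH) subset_leq_card //.
  apply/subsetP => e; rewrite -[e \in _]/(X \in [set Y in H | [set e] \subset Y]).
  by rewrite inE sub1set => /andP[].
have [||||X [Xcyc XG0 Xk Xunsat]] := @good_cycle_exists G0 H.
- exact: Huni.
- by move=> e; rewrite inE => /andP[].
- by rewrite -(@leq_pmul2l 2) //; apply: leq_trans GG0; rewrite !mulnA.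
- rewrite -(@leq_pmul2l 2) //; apply: leq_trans GG0; apply: leq_trans Qle.
  by rewrite mulnCA (mulnA 2 2).
have XG : X \subset G by apply: subset_trans XG0 _; apply/subsetP => e; rewrite inE => /andP[].
have k0 : 0 < k by rewrite addn_gt0 ltnW.
(* The threshold of [X] itself is [Q ^ 0], so being unsaturated means having degree zero in [H]. *)
have XH : X \notin H.
  have X0 : X != set0 by rewrite -card_gt0 Xk.
  apply/negP => XH; have := Xunsat X (subxx _) X0; rewrite Xk subnn expn0 ltnS leqn0.
  by rewrite cards_eq0 => /eqP/setP/(_ X); rewrite !inE XH subxx.
have /Hmax : P (X |: H); last by rewrite cardsU1 XH add1n ltnn.
apply/and3P; split.
- by rewrite subUset sub1set Xcyc.
- by apply/forall_inP => S; rewrite !inE => /orP[/eqP ->|/Hin //]; rewrite XG Xk eqxx.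
apply/forallP => S; apply/implyP => hS.
have [SX|nSX] := boolP (S \subset X).
  apply: leq_trans (hdegU _ _ _) _; apply: leq_trans (Xunsat S SX _); last by rewrite -card_gt0; case/andP: hS.
  rewrite -add1n leq_add2r; apply: leq_trans (_ : #|[set X]| <= _); last by rewrite cards1.
  by apply: subset_leq_card; apply/subsetP => Y; rewrite inE => /andP[].
have := Hdeg S; rewrite hS /=; apply: leq_trans; apply: subset_leq_card.
apply/subsetP => Y; rewrite !inE => /andP[/orP[/eqP ->|-> ->] //].
by rewrite (negPf nSX).
Qed.

End Supersaturation.
End PartiteCycles.

(** * Containers for partite cycle-free hypergraphs *)

Lemma expn_succ_lower x m : x ^ m + m * x ^ m.-1 <= x.+1 ^ m.
Proof.
elim: m => [//|[|m] IH]; first by rewrite !expn1 expn0 muln1 addn1.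
rewrite [x.+1 ^ _]expnS mulSn /=.
apply: leq_trans (leq_add (leqnn _) (leq_mul (leqnn x) IH)).
rewrite mulnDr -expnS mulnCA -expnS /=.
have : x ^ m.+1 <= x.+1 ^ m.+1 by rewrite leq_exp2r.
by rewrite mulSn; lia.
Qed.

(** Bernoulli's inequality: [C] rounds of shrinking by the factor [1 - 1 / C] at least halve the
    size. *)
Lemma expn_pred_double C : 0 < C -> 2 * C.-1 ^ C <= C ^ C.
Proof.
case: C => [//|C] _ /=; apply: leq_trans (expn_succ_lower C C.+1).
by rewrite mul2n -addnn leq_add2l mulSn expnS /= leq_addl.
Qed.

Lemma iterate_containers (T : finType) (cyc : {set {set T}}) (M0 B C N w : nat) : 0 < M0 -> 0 < B -> 0 < C ->
    #|T| <= N -> N < 2 ^ w ->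
    (forall G : {set T}, M0 <= #|G| -> exists F : {set {set T}},
      [/\ #|F| <= B, forall c, c \in F -> c \subset G /\ C * #|c| + #|G| <= C * #|G|
        & forall I : {set T}, I \subset G -> (forall X, X \in cyc -> ~~ (X \subset I)) ->
            exists2 c, c \in F & I \subset c]) ->
  exists F : {set {set T}}, [/\ #|F| <= B ^ (C * w), forall c, c \in F -> #|c| <= M0
    & forall I : {set T}, (forall X, X \in cyc -> ~~ (X \subset I)) -> exists2 c, c \in F & I \subset c].
Proof.
move=> M00 B0 C0 TN Nw step.
have step' (G : {set T}) : exists F : {set {set T}},
      [/\ #|F| <= B, forall c, c \in F -> #|c| < M0 \/ C * #|c| + #|G| <= C * #|G|
        & forall I : {set T}, I \subset G -> (forall X, X \in cyc -> ~~ (X \subset I)) ->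
            exists2 c, c \in F & I \subset c].
  have [/step [F [F1 F2 F3]]|lt] := leqP M0 #|G|.
    by exists F; split=> // c /F2[_]; right.
  exists [set G]; split; first by rewrite cards1.
    by move=> c; rewrite inE => /eqP ->; left.
  by move=> I IG _; exists G; rewrite ?inE.
have [f fP] := fin_all_exists step'.
have iter i : exists F : {set {set T}},
   [/\ #|F| <= B ^ i, forall c, c \in F -> #|c| < M0 \/ #|c| * C ^ i <= N * C.-1 ^ i
    & forall I : {set T}, (forall X, X \in cyc -> ~~ (X \subset I)) -> exists2 c, c \in F & I \subset c].
  elim: i => [|i [F [F1 F2 F3]]].
    exists [set [set: T]]; split; first by rewrite cards1.
      by move=> c; rewrite inE => /eqP ->; right; rewrite !expn0 !muln1 cardsT.
    by move=> I _; exists [set: T]; rewrite ?inE ?subsetT.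
  exists [set c | [exists (d | d \in F), (c \in if #|d| < M0 then [set d] else f d)]]; split.
  - apply: leq_trans (_ : \sum_(d in F) B <= _); last by rewrite sum_nat_const expnSr leq_mul2r F1 orbT.
    apply: leq_trans (_ : \sum_(d in F) #|if #|d| < M0 then [set d] else f d| <= _); last first.
      apply: leq_sum => d dF; case: ifP => _; first by rewrite cards1.
      by have [] := fP d.
    under eq_bigr => d _ do rewrite -sum1_card.
    rewrite (exchange_big_dep predT) //= -sum1_card big_mkcond /=; apply: leq_sum => c _.
    rewrite inE; case: existsP => // -[d /andP[dF cd]].
    by rewrite (bigD1 d) /= ?dF.
  - move=> c; rewrite inE => /existsP[d /andP[dF]]; case: ifP => [dM|dM].
      by rewrite inE => /eqP ->; left.
    have [_ h _] := fP d; move=> /h[|le]; [by left | right].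
    have [|h2] := F2 d dF; first by rewrite dM.
    have h3 : C * #|c| <= C.-1 * #|d|.
      by case: (C) C0 le => [//|C'] _ /=; rewrite !mulSn; lia.
    rewrite !expnS [#|c| * _]mulnCA mulnA; apply: leq_trans (leq_mul h3 (leqnn _)) _.
    by rewrite [N * _]mulnCA -mulnA leq_mul2l h2 orbT.
  - move=> I hI; have [d dF Id] := F3 I hI; have [_ _ h] := fP d.
    case: (ltnP #|d| M0) => dM.
      by exists d => //; rewrite inE; apply/existsP; exists d; rewrite dF dM inE eqxx.
    have [c cf Ic] := h I Id hI; exists c => //; rewrite inE; apply/existsP; exists d.
    by rewrite dF ltnNge dM.
(* After [C * w] rounds, a container that has not dropped below [M0] would have at most
   [N / 2 ^ w < 1] elements. *)
have [F [F1 F2 F3]] := iter (C * w); exists F; split=> // c /F2[/ltnW //|].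
have [->//|c0] := posnP #|c|; rewrite leqNgt => h; exfalso; move/negP: h; apply.
have CC : 2 ^ w * C.-1 ^ (C * w) <= C ^ (C * w).
  by rewrite !expnM -expnMn; case: (w) => [//|w']; rewrite leq_exp2r // expn_pred_double.
apply: leq_trans (_ : C ^ (C * w) <= _); last by rewrite leq_pmull.
have [z|z] := posnP (C.-1 ^ (C * w)); last first.
  by apply: leq_trans CC; rewrite ltn_mul2r z.
rewrite z muln0 expn_gt0; case: (C) z => [|//] /=.
by rewrite mul0n.
Qed.

(** A single [K] serves both as factor and as exponent in all polylogarithmic bounds. *)
Lemma poly_bound c e K W x : 0 < W -> c <= K -> e <= K -> x <= c * W ^ e -> x <= K * W ^ K.
Proof.
move=> W0 cK eK h; apply: leq_trans h _; apply: leq_mul => //.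
by rewrite leq_pexp2l.
Qed.

Lemma le_sum_constants a b c d e (K := (a + b + c + d + e + 2).+1) :
  [/\ a <= K, b <= K, c <= K, d <= K & e + 2 <= K].
Proof. by rewrite /K; split; lia. Qed.

Lemma divn_divn_lt N D : 0 < D -> D <= N -> (N %/ (N %/ D)).+1 <= 3 * D.
Proof.
move=> D0 DN; have Q0 : 0 < N %/ D by rewrite divn_gt0.
suff : N %/ (N %/ D) <= 2 * D by lia.
rewrite -ltnS ltn_divLR //; have := ltn_ceil N D0; set Q := N %/ D in Q0 *.
have : D <= Q * D by rewrite leq_pmull.
by nia.
Qed.

Lemma container_exponentE W k n m0 c x z C :
  W * (k * (3 * (n * (m0 * (c * x)) * (4 * z)))) * (C * W) =
  n * m0 * (k * (3 * (c * 4)) * C * (x * z * (W * W))).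
Proof. by lia. Qed.

Lemma container_sizeE n m0 c x z : n * (m0 * (c * x)) * (4 * z) = n * m0 * (c * 4 * (x * z)).
Proof. by lia. Qed.

Lemma arith_side l r : 1 < l -> 3 < r -> 0 < (l + l).-1 /\ 1 < r.-1.
Proof. by lia. Qed.

(** Integers replace real quantities: [w.+1] stands for the binary logarithm of [#|V| ^ r], and [m0]
    for [#|V| ^ (1 / (2 * l - 1))]. *)
Theorem partite_cycle_containers (l r : nat) : 1 < l -> 3 < r ->
  exists K, 0 < K /\ forall (V : finType) (w m0 : nat),
    0 < #|V| -> #|V| ^ r < 2 ^ w.+1 -> #|V| <= m0 ^ (l + l).-1 -> m0 <= #|V| -> K * w.+1 ^ K <= #|V| ->
  exists F : {set {set {ffun 'I_r -> V}}},
   [/\ #|F| <= 2 ^ (#|V| * m0 * (K * w.+1 ^ K)),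
       forall c, c \in F -> #|c| <= #|V| ^ r.-1 * (K * w.+1 ^ K)
     & forall I : {set {ffun 'I_r -> V}}, (forall X, X \in partite_cycles r V (l + l) -> ~~ (X \subset I)) ->
         exists2 c, c \in F & I \subset c].
Proof.
move=> l2 r4; set k := l + l.
have k0 : 0 < k by rewrite addn_gt0 ltnW.
have k20 : 0 < 2 * k by rewrite muln_gt0.
have [C' HC] := @hypergraph_containers k 1 (2 * k) k0 isT k20.
pose C := C'.+1; pose c := 2 ^ k.+2; pose C0 := 2 ^ k * (2 * k) ^ k; pose t := 4 * (r * k ^ 2).
pose ee := r * r * k.
pose c1 := 4 * c * C0 * 4 ^ k.
pose K1 := 64 * (c * (2 * C0 * 4 ^ k)) ^ 3.
pose K2 := 4 * t * r + c1 * 4.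
pose K3 := k * (3 * (c1 * 4)) * C.
pose K := (K1 + K2 + K3 + 3 * ee + (ee + r * r) + 2).+1.
have [hK1 hK2 hK3 he1 he3] := le_sum_constants K1 K2 K3 (3 * ee) (ee + r * r).
have he2 : ee + r * r <= K by apply: leq_trans he3; rewrite leq_addr.
have [kp rp] := arith_side l2 r4.
exists K; split=> // V w m0 n0 nw nm0 m0n nbig.
set n := #|V| in n0 nw nm0 m0n nbig *; set W := w.+1 in nbig *.
have W0 : 0 < W by [].
pose Z := W ^ (r * r); pose L2 := (4 * Z) ^ k; pose L := 4 * c * C0 * L2.
have Z0 : 0 < Z by rewrite expn_gt0.
have L2E : L2 = 4 ^ k * W ^ ee by rewrite /L2 expnMn -expnM.
have LE : L = c1 * W ^ ee by rewrite /L L2E mulnA.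
have C00 : 0 < C0 by rewrite muln_gt0 !expn_gt0 k20.
have c0 : 0 < c by rewrite expn_gt0.
have L20 : 0 < L2 by rewrite expn_gt0 muln_gt0 Z0.
have L0 : 0 < L by rewrite (muln_gt0 (4 * c * C0)) (muln_gt0 (4 * c)) (muln_gt0 4) c0 C00 L20.
have m00 : 0 < m0.
  by rewrite lt0n; apply/eqP => m0z; move: nm0; rewrite m0z exp0n // leqNgt n0.
(* [Q = #|G| %/ D] will be the largest value that supersaturation allows; then [#|G| %/ Q] is of
   order [D], which governs the number of containers. *)
pose D := n * (m0 * L) * (4 * Z).
have D0 : 0 < D by rewrite (muln_gt0 (n * _)) (muln_gt0 n) (muln_gt0 m0) (muln_gt0 4) n0 m00 L0 Z0.
pose M0 := 4 * t * r * n ^ r.-1 * Z + D.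
pose B := 2 ^ (W * (k * (3 * D))).
have big : 64 * (c * (2 * C0 * L2)) ^ 3 <= n.
  apply: leq_trans nbig; apply: (@poly_bound K1 (3 * ee)) => //.
  have -> : W ^ (3 * ee) = (W ^ ee) ^ 3 by rewrite mulnC expnM.
  by rewrite L2E (mulnA (2 * C0)) (mulnA c) expnMn mulnA.
have [||//|||G|F [F1 F2 F3]] := @iterate_containers {ffun 'I_r -> V} (partite_cycles r V k) M0 B C (n ^ r) W.
- by rewrite addn_gt0 D0 orbT.
- by rewrite expn_gt0.
- by rewrite card_ffun card_ord.
- exact: nw.
- move=> GM.
  pose Q := #|G| %/ D.
  have GD : D <= #|G| by apply: leq_trans GM; rewrite leq_addl.
  have Q0 : 0 < Q by rewrite divn_gt0.
  have [||H [H1 H2 H3 H4]] := @balanced_supersaturation r V l t w n m0 Q r4 l2 Q0 erefl n0 m00 erefl nw nm0 big G.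
  - by apply: leq_trans GM; rewrite leq_addr.
  - by rewrite -/Z -[Q * n * _]mulnA -mulnA; apply: leq_trunc_div.
  have [F [F1 F2 F3]] := HC _ G H Q Q0 H2 H3 H4; exists F; split.
  - apply: leq_trans F1 _; have -> : B = (2 ^ W) ^ (k * (3 * D)) by rewrite /B [LHS]expnM.
    have Gn : #|G|.+1 <= 2 ^ W.
      by apply: leq_ltn_trans nw; apply: leq_trans (max_card _) _; rewrite card_ffun card_ord.
    apply: leq_trans (_ : (2 ^ W) ^ (k * (#|G| %/ Q).+1) <= _).
      by rewrite leq_exp2r // muln_gt0 k0.
    rewrite leq_pexp2l ?expn_gt0 // leq_mul2l; apply/orP; right.
    exact: divn_divn_lt.
  - move=> x /F2[xG le]; split=> //; rewrite !mulSn -addnA leq_add //; exact: subset_leq_card.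
  - move=> I IG hI; apply: F3 => // X XH; apply: hI; exact: (subsetP H1).
exists F; split=> //.
- apply: leq_trans F1 _; rewrite /B -expnM leq_exp2l //.
  rewrite /D LE /Z container_exponentE leq_mul2l (@poly_bound K3 (ee + r * r + 2)) ?orbT //.
  by rewrite !expnD mulnn.
- move=> x /F2 xM; apply: leq_trans xM _; rewrite /M0 /D.
  apply: leq_trans (_ : n ^ r.-1 * (K2 * W ^ (ee + r * r)) <= _); last first.
    by rewrite leq_mul2l (@poly_bound K2 (ee + r * r)) ?orbT.
  rewrite /K2 mulnDl mulnDr; apply: leq_add.
    rewrite -[X in X <= _]mulnA mulnCA leq_mul2l; apply/orP; right.
    rewrite leq_mul2l; apply/orP; right.
    by rewrite /Z leq_pexp2l // leq_addl.
  rewrite LE /Z container_sizeE -expnD.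
  rewrite leq_mul2r; apply/orP; right.
  apply: leq_trans (_ : n ^ 2 <= _); first by rewrite -mulnn leq_mul2l m0n orbT.
  by rewrite leq_pexp2l.
Qed.

(** * From partite hypergraphs to hypergraphs *)

Lemma closed_walk_cycle (D W : finType) (src tgt : D -> W) (E : {pred D}) s :
  closed_walk src tgt E s -> cycle (fun d d' => tgt d == src d') s.
Proof.
case/existsP=> w; case: s => [//|d s] /= /and3P[_ /eqP <-].
rewrite rcons_path; move: (src d) => x.
elim: s d => [|d1 s IH] d /=; first by move/eqP->; rewrite eqxx.
by case/and3P=> _ /eqP -> /IH/andP[-> ->]; rewrite eqxx.
Qed.

Lemma cycle_tnth (D : eqType) (e : rel D) k (s : k.-tuple D) (i : 'I_k) :
  cycle e s -> e (tnth s i) (tnth s (ordS i)).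
Proof.
move=> cs; have ik : i < size s by rewrite size_tuple.
have x0 : D := tnth s i.
rewrite !(tnth_nth x0) /=; move: (nat_of_ord i) ik => {}i.
rewrite -[X in _ %% X](size_tuple s).
case: (tval s) cs => [//|d s'] /= cs ik; have := pathP x0 cs i.
rewrite size_rcons nth_rcons -rcons_cons nth_rcons /= ik => /(_ isT).
move: ik; rewrite ltnS leq_eqVlt => /orP[/eqP ->|lt]; first by rewrite ltnn eqxx modnn.
by rewrite lt modn_small // ltnS.
Qed.

Section Transfer.
Variables (r : nat) (V : finType).
Local Notation T := {ffun 'I_r -> V}.
Implicit Types (f : {ffun V -> 'I_r}) (g : T) (F : {set {set V}}).

Definition transversal f g := [forall c, f (g c) == c].
Definition tuple_edge g : {set V} := [set g c | c : 'I_r].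
Definition lift_edges f F : {set T} := [set g | transversal f g && (tuple_edge g \in F)].

Lemma transversalP f g : transversal f g -> forall c, f (g c) = c.
Proof. by move=> /forallP h c; apply/eqP. Qed.

Lemma card_tuple_edge f g : transversal f g -> #|tuple_edge g| = r.
Proof.
move=> /transversalP fg; rewrite card_imset ?card_ord // => c c' e.
by rewrite -(fg c) e fg.
Qed.

Lemma other_coords (a b : 'I_r) : a != b ->
  exists cc : 'I_(r - 2) -> 'I_r,
    [/\ injective cc, forall j, (cc j != a) && (cc j != b)
      & forall c, c != a -> c != b -> exists j, cc j = c].
Proof.
move=> ab; pose P := [pred c : 'I_r | (c != a) && (c != b)].
have cP : #|P| = r - 2.
  have := cardC P; rewrite card_ord (eq_card (_ : [predC P] =i [set a; b])) => [|x]; last first.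
    by rewrite inE /= negb_and !negbK !inE.
  by rewrite cards2 ab => h; apply/eqP; rewrite -(eqn_add2r 2) -[X in _ == X - 2 + 2]h addnK h.
exists (fun j => enum_val (cast_ord (esym cP) j)); split.
- by move=> i j /enum_val_inj/cast_ord_inj.
- by move=> j; have := enum_valP (cast_ord (esym cP) j).
- move=> c ca cb; have cPc : c \in P by rewrite inE ca cb.
  by exists (cast_ord cP (enum_rank_in cPc c)); rewrite cast_ordK enum_rankK_in.
Qed.

(** The sources of the darts serve as vertices of the graph cycle, and the coordinates other than
    [a] and [b] as added vertices. Vertices from different parts are distinct because [f] labels
    them differently. *)
Lemma partite_cycle_copy k f F X : X \in partite_cycles r V k -> X \subset lift_edges f F ->
  contains_copy (linear_cycle k r) F.
Proof.
rewrite inE => /existsP[a /existsP[b /existsP[s]]] /and3P[ab /and3P[cw us ul] /eqP XE] XF.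
have [cc [cc_inj cc_ab cc_surj]] := other_coords ab.
pose d i := tnth s i; pose v i := (dart_src a b (d i)).2.
have eF i : (d i).1 \in lift_edges f F.
  by apply: (subsetP XF); rewrite XE inE map_f // mem_tnth.
have fe i c : f ((d i).1 c) = c by have := eF i; rewrite inE => /andP[/transversalP ->].
have step i : dart_tgt a b (d i) = dart_src a b (d (ordS i)).
  by apply/eqP; have := cycle_tnth i (closed_walk_cycle cw).
have vS i : v (ordS i) = (d i).1 (dart_coord a b (~~ (d i).2)) by rewrite /v -step.
have fv i : f (v i) = dart_coord a b (d i).2 by rewrite /v /dart_src /= fe.
have tnth_inj (U : eqType) (h : T * bool -> U) : uniq (map h s) -> forall i i', h (d i) = h (d i') -> i = i'.
  move=> uh i i' E; apply/val_inj/eqP; have sz : size (map h s) = k by rewrite size_map size_tuple.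
  rewrite -(nth_uniq (h (d i)) _ _ uh) ?sz; try exact: ltn_ord.
  have dE (x : 'I_k) : nth (d i) s x = d x by rewrite /d -tnth_nth.
  have lt (x : 'I_k) : val x < size s by rewrite size_tuple; exact: ltn_ord.
  by rewrite !(nth_map (d i)) ?lt //= !dE E.
pose phi (u : linear_cycle_vertex k r) : V :=
  match u with inl i => v i | inr (i, j) => (d i).1 (cc j) end.
have dc_cc s' j : dart_coord a b s' <> cc j.
  by move=> dcj; have := cc_ab j; rewrite -dcj /dart_coord; case: (s') => /andP[]; rewrite eqxx.
rewrite /contains_copy; apply/existsP; exists [ffun u => phi u]; apply/andP; split.
  apply/injectiveP => u u'; rewrite !ffunE.
  case: u => [i|[i j]]; case: u' => [i'|[i' j']] /= E.
  - congr inl; apply: (tnth_inj _ _ us); have := congr1 f E; rewrite !fv => dd.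
    rewrite /dart_src; congr pair; last exact: E.
    move: dd; rewrite /dart_coord; case: (d i).2; case: (d i').2 => // /eqP.
      by rewrite eq_sym (negPf ab).
    by rewrite (negPf ab).
  - by have := congr1 f E; rewrite fv fe => /dc_cc.
  - by have := congr1 f E; rewrite fv fe => /esym/dc_cc.
  - have jj : j = j' by have := congr1 f E; rewrite !fe => /cc_inj.
    rewrite -jj in E *; congr (inr (_, _)).
    have /forallP/(_ (cc j))/implyP/(_ (cc_ab j)) uc := ul.
    exact: (tnth_inj _ _ uc).
apply/forall_inP => e /imsetP[i _ ->].
suff -> : [set [ffun u => phi u] x | x in linear_cycle_edge r i] = tuple_edge (d i).1.
  by have := eF i; rewrite inE => /andP[].
apply/setP => x; apply/imsetP/imsetP => [[u + ->]|[c _ ->]].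
  rewrite ffunE !inE => /orP[/orP[] /eqP ->|/imsetP[j _ ->]] /=.
  - by exists (dart_coord a b (d i).2).
  - by exists (dart_coord a b (~~ (d i).2)); rewrite // -vS.
  - by exists (cc j).
have [E|n1] := eqVneq c (dart_coord a b (d i).2).
  by exists (inl i); rewrite ?ffunE ?inE ?eqxx // E.
have [E|n2] := eqVneq c (dart_coord a b (~~ (d i).2)).
  by exists (inl (ordS i)); rewrite ?ffunE ?inE ?eqxx ?orbT // E /= vS.
have [||j <-] := cc_surj c.
- by apply: contraNneq n1 => ca; move: n2; rewrite ca /dart_coord; case: (d i).2 => //=; rewrite eqxx.
- by apply: contraNneq n1 => ca; move: n2; rewrite ca /dart_coord; case: (d i).2 => //=; rewrite eqxx.
exists (inr (i, j)); last by rewrite ffunE.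
by rewrite !inE; apply/orP; right; apply: imset_f.
Qed.

(** A labelling is recovered from its values along [g] together with its modification that makes [g]
    transversal. *)
Lemma card_transversal_labellings g : injective g -> r ^ #|V| <= r ^ r * #|[set f | transversal f g]|.
Proof.
move=> g_inj.
have <- : #|{ffun V -> 'I_r}| = r ^ #|V| by rewrite card_ffun card_ord.
have -> : r ^ r = #|[set: {ffun 'I_r -> 'I_r}]| by rewrite cardsT card_ffun card_ord.
rewrite -cardsX -cardsT.
pose over f : {ffun V -> 'I_r} := [ffun x => if [pick c | g c == x] is Some c then c else f x].
pose h f : {ffun 'I_r -> 'I_r} * {ffun V -> 'I_r} := ([ffun c => f (g c)], over f).
rewrite -(card_imset [set: {ffun V -> 'I_r}] (_ : injective h)).
  apply: subset_leq_card; apply/subsetP => _ /imsetP[f _ ->]; rewrite !inE /=.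
  apply/forallP => c; rewrite ffunE; case: pickP => [c' /eqP/g_inj -> //|/(_ c)].
  by rewrite eqxx.
move=> f1 f2 [h1 h2]; apply/ffunP => x.
have := congr1 (fun q : {ffun _ -> _} => q x) h2; rewrite !ffunE.
case: pickP => [c /eqP <- _|//].
by have := congr1 (fun q : {ffun _ -> _} => q c) h1; rewrite !ffunE.
Qed.

(** By averaging over labellings: each edge, listed in a fixed order, is transversal for at least
    one labelling in [r ^ r]. *)
Lemma exists_rainbow F : 0 < r -> F \subset complete_rgraph V r ->
  exists f, #|F| <= r ^ r * #|lift_edges f F|.
Proof.
move=> r0 Fr; have c0 : 'I_r by exists 0.
have [->|[e0 e0F]] := set_0Vmem F; first by exists [ffun=> c0]; rewrite cards0.
have ce e : e \in F -> #|e| = r by move=> /(subsetP Fr); rewrite inE => /eqP.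
have [x0 x0e] : exists x0, x0 \in e0 by apply/card_gt0P; rewrite ce.
pose g (e : {set V}) : T := [ffun c : 'I_r => nth x0 (enum e) c].
have ge e : e \in F -> tuple_edge (g e) = e /\ injective (g e).
  move=> eF; have sz : size (enum e) = r by rewrite -cardE ce.
  split.
    apply/setP => x; apply/imsetP/idP => [[c _ ->]|xe].
      by rewrite ffunE -mem_enum mem_nth // sz.
    have lt : index x (enum e) < r by rewrite -sz index_mem mem_enum.
    by exists (Ordinal lt); rewrite // ffunE /= nth_index // mem_enum.
  move=> c c'; rewrite !ffunE => /eqP; rewrite nth_uniq ?sz ?enum_uniq // => /eqP.
  exact: val_inj.
case: (pickP (fun f => #|F| <= r ^ r * #|lift_edges f F|)) => [f h|none]; first by exists f.
exfalso.
have h1 : \sum_(f : {ffun V -> 'I_r}) r ^ r * #|lift_edges f F| < #|{ffun V -> 'I_r}| * #|F|.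
  apply: leq_ltn_trans (_ : \sum_(f : {ffun V -> 'I_r}) #|F|.-1 < _).
    apply: leq_sum => f _; have := none f; rewrite /= leqNgt => /negbFE lt.
    by rewrite -ltnS prednK //; apply/card_gt0P; exists e0.
  have F0 : 0 < #|F| by apply/card_gt0P; exists e0.
  rewrite sum_nat_const ltn_mul2l.
  rewrite prednK // leqnn andbT; apply/card_gt0P; by exists [ffun=> c0].
move: h1; rewrite ltnNge => /negP; apply.
rewrite -big_distrr /= card_ffun card_ord mulnC -sum_nat_const.
apply: leq_trans (_ : \sum_(e in F) r ^ r * #|[set f | transversal f (g e)]| <= _).
  by apply: leq_sum => e eF; apply: card_transversal_labellings; have [] := ge e eF.
rewrite -big_distrr leq_mul2l; apply/orP; right.
under eq_bigr => e _ do rewrite -sum1_card.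
rewrite (exchange_big_dep predT) //=; apply: leq_sum => f _.
rewrite sum1dep_card -(card_in_imset (f := g)).
  apply: subset_leq_card; apply/subsetP => _ /imsetP[e + ->]; rewrite !inE => /andP[eF ->].
  by have [-> _] := ge e eF.
move=> e e'; rewrite !inE => /andP[eF _] /andP[e'F _] E.
by have [<- _] := ge e eF; have [<- _] := ge e' e'F; rewrite E.
Qed.

Definition push_edges f (C : {set T}) : {set {set V}} := [set tuple_edge g | g in [set g in C | transversal f g]].

Lemma lift_edges_push f F (C : {set T}) : lift_edges f F \subset C ->
  #|lift_edges f F| <= #|F :&: push_edges f C|.
Proof.
move=> FC; rewrite -(card_in_imset (f := tuple_edge) (D := lift_edges f F)).
  apply: subset_leq_card; apply/subsetP => _ /imsetP[g gF ->]; rewrite inE.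
  have := gF; rewrite inE => /andP[tg ->] /=; apply: imset_f.
  by rewrite inE tg (subsetP FC).
move=> g g'; rewrite !inE => /andP[/transversalP tg _] /andP[/transversalP tg' _] E.
apply/ffunP => c.
have : g c \in tuple_edge g' by rewrite -E; apply: imset_f.
by case/imsetP=> c' _ gc; move: (gc) => /(congr1 f); rewrite tg tg' gc => ->.
Qed.

End Transfer.

(** The containers for all labellings are collected, at the cost of a factor [r ^ #|V|] only. A
    container need not cover [G], but it meets a fixed proportion of it, which is enough for the
    union bound. *)
Theorem cycle_free_containers (l r : nat) : 1 < l -> 3 < r ->
  exists K, 0 < K /\ forall (V : finType) (w m0 : nat),
    0 < #|V| -> #|V| ^ r < 2 ^ w.+1 -> #|V| <= m0 ^ (2 * l).-1 -> m0 <= #|V| -> K * w.+1 ^ K <= #|V| ->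
  exists F : {set {set {set V}}},
   [/\ #|F| <= 2 ^ (#|V| * m0 * (K * w.+1 ^ K)),
       forall c, c \in F -> #|c| <= #|V| ^ r.-1 * (K * w.+1 ^ K),
       forall c, c \in F -> c \subset complete_rgraph V r
     & forall G : {set {set V}}, G \subset complete_rgraph V r -> ~~ contains_copy (linear_cycle (2 * l) r) G ->
         exists2 c, c \in F & #|G| <= r ^ r * #|G :&: c|].
Proof.
move=> l2 r4; have [K0 [K00 HK]] := partite_cycle_containers l2 r4.
exists (K0 + r); split; first by rewrite addn_gt0 K00.
move=> V w m0 n0 nw nm m0n big; rewrite mul2n -addnn in nm *.
have KK : K0 * w.+1 ^ K0 <= (K0 + r) * w.+1 ^ (K0 + r).
  by apply: leq_mul; rewrite ?leq_addr // leq_pexp2l ?leq_addr.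
have [F [F1 F2 F3]] := HK V w m0 n0 nw nm m0n (leq_trans KK big).
have r0 : 0 < r by apply: ltn_trans r4.
have m00 : 0 < m0.
  have [kp _] := arith_side l2 r4.
  by rewrite lt0n; apply/eqP => z; move: nm; rewrite z exp0n // leqNgt n0.
pose h (x : {ffun V -> 'I_r} * {set {ffun 'I_r -> V}}) := push_edges x.1 x.2.
exists [set h x | x in setX [set: {ffun V -> 'I_r}] F]; split.
- apply: leq_trans (leq_imset_card _ _) _; rewrite cardsX cardsT card_ffun card_ord.
  apply: leq_trans (_ : 2 ^ (r * #|V|) * 2 ^ (#|V| * m0 * (K0 * w.+1 ^ K0)) <= _).
    apply: leq_mul F1; rewrite expnM; have := ltn_expl r (isT : 1 < 2).
    by case: (#|V|) => [//|n'] lt; rewrite leq_exp2r // ltnW.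
  rewrite -expnD leq_exp2l // mulnDl mulnDr addnC; apply: leq_add.
    by rewrite leq_mul2l leq_mul2l leq_pexp2l ?leq_addr ?orbT.
  rewrite mulnC -mulnA leq_mul2l; apply/orP; right; rewrite mulnCA.
  by rewrite leq_pmulr // muln_gt0 m00 expn_gt0.
- move=> c /imsetP[[f C]]; rewrite inE => /andP[_ CF] ->.
  apply: leq_trans (leq_imset_card _ _) _; apply: leq_trans (_ : #|C| <= _).
    by apply: subset_leq_card; apply/subsetP => g; rewrite inE => /andP[].
  by apply: leq_trans (F2 C CF) _; rewrite leq_mul2l KK orbT.
- move=> c /imsetP[[f C]] _ ->; apply/subsetP => e /imsetP[g]; rewrite !inE => /andP[_ tg] ->.
  by rewrite (card_tuple_edge tg).
- move=> G Gr Gfree; have [f hf] := exists_rainbow r0 Gr.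
  have [|C CF GC] := F3 (lift_edges f G).
    move=> X Xc; apply: contra Gfree; exact: partite_cycle_copy Xc.
  exists (push_edges f C).
    by apply/imsetP; exists (f, C); rewrite // inE /= inE CF.
  by apply: leq_trans hf _; rewrite leq_mul2l lift_edges_push ?orbT.
Qed.

(** * The random hypergraph *)

Local Open Scope ring_scope.

Lemma sum_subset_prod (R : comNzRingType) (I : finType) (U : {set I}) (a b : I -> R) :
  \sum_(G : {set I} | G \subset U) \prod_(i in U) (if i \in G then a i else b i) =
  \prod_(i in U) (a i + b i).
Proof.
rewrite big_mkcond [RHS]big_mkcond /=.
(* Outside [U] the factor [0 + 1] leaves the product unchanged and kills the terms in which [G] is
   not contained in [U]. *)
transitivity (\prod_i ((if i \in U then a i else 0) + (if i \in U then b i else 1))); last first.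
  by apply: eq_bigr => i _; case: ifP => // _; rewrite add0r.
rewrite bigA_distr; apply: eq_bigr => G _; case: ifPn => [GU|/subsetPn[i iG iU]].
  rewrite big_mkcond /=; apply: eq_bigr => i _; case: (boolP (i \in U)) => // iU.
  by case: (boolP (i \in G)) => // /(subsetP GU); rewrite (negPf iU).
by rewrite (bigD1 i) //= iG (negPf iU) mul0r.
Qed.

Section RandomHypergraph.
Variables (R : realType) (r n : nat) (p : R).
Hypothesis p01 : 0 <= p <= 1.
Local Notation U := (complete_rgraph 'I_n r).
Implicit Types A B : pred {set {set 'I_n}}.

Lemma Gnp_weight_ge0 (G : {set {set 'I_n}}) : 0 <= \prod_(e in U) (if e \in G then p else 1 - p).
Proof.
case/andP: p01 => p0 p1; apply: prodr_ge0 => e _; case: ifP => // _.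
by rewrite subr_ge0.
Qed.

Lemma Gnp_prob_split A : Gnp_prob r p A + Gnp_prob r p (predC A) = 1.
Proof.
rewrite /Gnp_prob -bigID /= sum_subset_prod big1 // => e _.
by rewrite addrC subrK.
Qed.

Lemma Gnp_prob_ge0 A : 0 <= Gnp_prob r p A.
Proof. by apply: sumr_ge0 => G _; apply: Gnp_weight_ge0. Qed.

Lemma Gnp_prob_le1 A : Gnp_prob r p A <= 1.
Proof. by rewrite -(Gnp_prob_split A) lerDl Gnp_prob_ge0. Qed.

(* Markov's inequality for [2 ^ #|G :&: D|]. *)
Lemma Gnp_prob_tail (D : {set {set 'I_n}}) m : D \subset U ->
  Gnp_prob r p (fun G : {set {set 'I_n}} => (m <= #|G :&: D|)%N) * 2 ^+ m <= (1 + p) ^+ #|D|.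
Proof.
move=> DU; pose w i : R := if i \in D then 2 else 1.
have -> : (1 + p) ^+ #|D| = \prod_(e in U) (p * w e + (1 - p)).
  rewrite -prodr_const big_mkcond [RHS]big_mkcond /=; apply: eq_bigr => e _; rewrite /w.
  case: (boolP (e \in D)) => [/(subsetP DU) ->|_]; first by ring.
  by case: ifP => // _; rewrite mulr1 addrC subrK.
rewrite -sum_subset_prod /Gnp_prob mulr_suml [X in X <= _]big_mkcond [X in _ <= X]big_mkcond /=.
apply: ler_sum => G _; case: (boolP (G \subset U)) => //= GU; case: ifP => [mG|_]; last first.
  apply: prodr_ge0 => e _; case/andP: p01 => p0 p1; case: ifP => _; last by rewrite subr_ge0.
  by rewrite mulr_ge0 // /w; case: ifP.
have -> : \prod_(e in U) (if e \in G then p * w e else 1 - p) =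
    \prod_(e in U) (if e \in G then p else 1 - p) * 2 ^+ #|G :&: D|.
  have -> : 2 ^+ #|G :&: D| = \prod_(e in U) (if e \in G then w e else 1) :> R.
    rewrite -prodr_const big_mkcond [RHS]big_mkcond /=; apply: eq_bigr => e _; rewrite inE /w.
    case: (boolP (e \in G)) => [/(subsetP GU) -> //|_] /=.
    by case: ifP.
  rewrite -big_split /=; apply: eq_bigr => e _; case: ifP => // _; by rewrite mulr1.
by apply: ler_wpM2l; [exact: Gnp_weight_ge0 | rewrite ler_weXn2l // ler1n].
Qed.

Lemma Gnp_prob_union (S : {set {set {set 'I_n}}}) (Pr : {set {set 'I_n}} -> pred {set {set 'I_n}}) A :
  (forall G : {set {set 'I_n}}, G \subset U -> A G -> exists2 D, D \in S & Pr D G) ->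
  Gnp_prob r p A <= \sum_(D in S) Gnp_prob r p (Pr D).
Proof.
move=> AS; rewrite /Gnp_prob (exchange_big_dep (fun G : {set {set 'I_n}} => G \subset U)) /=; last first.
  by move=> D G _ /andP[].
rewrite [X in X <= _]big_mkcond [X in _ <= X]big_mkcond /=; apply: ler_sum => G _.
case: (boolP (G \subset U)) => //= GU; case: (boolP (A G)) => [AG|_]; last first.
  by apply: sumr_ge0 => D _; apply: Gnp_weight_ge0.
have [D DS PD] := AS G GU AG.
rewrite (bigD1 D) /= ?DS // lerDl; apply: sumr_ge0 => D' _; exact: Gnp_weight_ge0.
Qed.

(** An [H]-free subgraph with more than [c * m] edges has at least [m] of them in some [D], and then
    so has [G]; this event is summed over the members of [S]. *)
Lemma Gnp_turan_tail (W : finType) (H : {set {set W}}) (S : {set {set {set 'I_n}}}) (X : R) a b c m :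
    (#|S| <= 2 ^ a)%N ->
    (forall D, D \in S -> (#|D| <= b)%N /\ D \subset U) ->
    (forall G : {set {set 'I_n}}, G \subset U -> ~~ contains_copy H G ->
       exists2 D, D \in S & (#|G| <= c * #|G :&: D|)%N) ->
    (c * m)%:R <= X ->
  Gnp_prob r p (fun G : {set {set 'I_n}} => ~~ ((turan_ex G H)%:R <= X)) * 2 ^+ m <= 2 ^+ a * (1 + p) ^+ b.
Proof.
move=> Sa SD Scov cmX; have /andP[p0 p1] := p01.
apply: le_trans (_ : (\sum_(D in S) Gnp_prob r p (fun G : {set {set 'I_n}} => (m <= #|G :&: D|)%N)) * 2 ^+ m <= _).
  apply: ler_wpM2r; first by rewrite exprn_ge0.
  apply: Gnp_prob_union => G GU; rewrite -ltNge => XG.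
  have : ~~ (turan_ex G H <= c * m)%N.
    by rewrite -ltnNge -(ltr_nat R); apply: le_lt_trans XG.
  case: (pickP [pred F : {set {set 'I_n}} | (F \subset G) && ~~ contains_copy H F & (c * m < #|F|)%N]).
    move=> F /andP[/andP[FG Ffree] cF] _.
    have [D DS FD] := Scov F (subset_trans FG GU) Ffree; exists D => //.
    have c0 : (0 < c)%N by move: (leq_trans cF FD); case: (c).
    rewrite ltnW // -(ltn_pmul2l c0); apply: leq_trans cF _; apply: leq_trans FD _.
    by rewrite leq_mul2l subset_leq_card ?orbT // setSI.
  move=> none /negP; case; apply/bigmax_leqP => F hF.
  by have := none F; rewrite /= hF /= ltnNge => /negbFE.
rewrite mulr_suml; apply: le_trans (_ : \sum_(D in S) (1 + p) ^+ b <= _).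
  apply: ler_sum => D DS; have [Db DU] := SD D DS.
  apply: le_trans (Gnp_prob_tail m DU) _; apply: ler_weXn2l => //.
  by rewrite lerDl.
rewrite sumr_const -[X in X <= _]mulr_natl; apply: ler_wpM2r.
  by rewrite exprn_ge0 // addr_ge0.
by rewrite -natrX ler_nat.
Qed.

End RandomHypergraph.

(** * Exponential and logarithmic estimates *)

Section Estimates.
Variable R : realType.
Implicit Types x y : R.

Lemma two_le_expR1 : 2 <= expR 1 :> R.
Proof. by apply: le_trans (expR_ge1Dx 1); lra. Qed.

Lemma expR_half_le2 : expR 2^-1 <= 2 :> R.
Proof.
have h : 2^-1 <= expR (- 2^-1) :> R by apply: le_trans (expR_ge1Dx _); lra.
have e0 := expR_gt0 (2^-1 : R).
rewrite expRN in h; have := ler_wpM2l (ltW e0) h; rewrite divff ?gt_eqF //.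
by lra.
Qed.

Lemma tail_estimate y (A Lam p X : R) (a b c m n0 : nat) :
    0 < y -> 0 <= p -> 1 <= n0%:R :> R -> n0%:R <= y -> a%:R <= y -> p * b%:R <= y * A -> X = y * Lam ->
    2 * c%:R * (A + 3) <= Lam -> (0 < c)%N -> X < (c * m.+1)%:R ->
  2 ^+ a * (1 + p) ^+ b * n0.+1%:R <= 2 ^+ m.
Proof.
move=> y0 p0 n1 ny ay pb XE LamA c0 Xm.
have c0' : 0 < c%:R :> R by rewrite ltr0n.
have h1 : 2 ^+ a <= expR y.
  apply: le_trans (_ : expR a%:R <= _); last by rewrite ler_expR.
  rewrite -[a%:R]mulr1 expRM_natl; apply: lerXn2r; rewrite ?nnegrE ?expR_ge0 //.
  exact: two_le_expR1.
have h2 : (1 + p) ^+ b <= expR (y * A).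
  apply: le_trans (_ : expR (p * b%:R) <= _); last by rewrite ler_expR.
  rewrite expRM_natr; apply: lerXn2r; rewrite ?nnegrE ?expR_ge0 ?addr_ge0 //.
  exact: expR_ge1Dx.
have h3 : n0.+1%:R <= expR y.
  by apply: le_trans (expR_ge1Dx y); rewrite -natr1; lra.
have mlow : y * (A + 3) - 2^-1 <= m%:R * 2^-1.
  have : c%:R * (2 * y * (A + 3)) < c%:R * m.+1%:R.
    apply: le_lt_trans (_ : X < _); last by rewrite -natrM.
    rewrite (_ : _ * _ = y * (2 * c%:R * (A + 3))); last by ring.
    by rewrite XE ler_wpM2l // ltW.
  by rewrite ltr_pM2l // -[m.+1%:R]natr1 -mulrA; set z := y * (A + 3); lra.
apply: le_trans (_ : expR (m%:R * 2^-1) <= _); last first.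
  rewrite expRM_natl; apply: lerXn2r; rewrite ?nnegrE ?expR_ge0 //.
  exact: expR_half_le2.
apply: le_trans (_ : expR (y + y * A + y) <= _); last first.
  by rewrite ler_expR; apply: le_trans mlow; lra.
have pb0 : 0 <= (1 + p) ^+ b by rewrite exprn_ge0 ?addr_ge0.
have a0 : 0 <= 2 ^+ a :> R by rewrite exprn_ge0.
by rewrite !expRD; apply: ler_pM; rewrite ?mulr_ge0 //; apply: ler_pM.
Qed.

Lemma pow_le_expR (C : nat) x : C.+1%:R ^+ C.+1 <= x -> x ^+ C <= expR x.
Proof.
move=> Cx; have C0 : 0 < C.+1%:R :> R by rewrite ltr0n.
have x0 : 0 <= x by apply: le_trans Cx; rewrite exprn_ge0 // ltW.
have -> : expR x = expR (x / C.+1%:R) ^+ C.+1.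
  by rewrite -expRM_natl mulrCA divff ?mulr1 // gt_eqF.
apply: le_trans (_ : (x / C.+1%:R) ^+ C.+1 <= _); last first.
  apply: lerXn2r; rewrite ?nnegrE; [by rewrite divr_ge0 // ltW | exact: expR_ge0 |].
  by apply: le_trans (expR_ge1Dx _); rewrite lerDr.
rewrite expr_div_n ler_pdivlMr ?exprn_gt0 // [x ^+ C.+1]exprSr.
by apply: ler_wpM2l => //; rewrite exprn_ge0.
Qed.

End Estimates.

Local Open Scope classical_set_scope.
Local Open Scope ring_scope.

Section Asymptotics.
Variable R : realType.

Lemma near_ln_ge (B : R) : \forall n \near \oo, B <= ln (n%:R : R).
Proof.
have h : \forall n \near \oo, expR B <= n%:R :> R by move/cvgryPge : (@cvgr_idn R); apply.
near=> n; have hn : expR B <= n%:R :> R by near: n.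
by rewrite -(expRK B) ler_ln ?posrE ?expR_gt0 // (lt_le_trans (expR_gt0 B)).
Unshelve. all: by end_near. Qed.

(** An exponent of order [ln (ln n) / ln n] is thus a power of the logarithm. *)
Lemma powR_loglog (C : R) n : 0 < ln (n%:R : R) -> (0 < n)%N ->
  n%:R `^ (C * (ln (ln n%:R) / ln n%:R)) = ln (n%:R : R) `^ C.
Proof.
move=> L0 n0; rewrite /powR pnatr_eq0 eqn0Ngt n0 /= (gt_eqF L0).
by rewrite -!mulrA mulVf ?mulr1 // gt_eqF.
Qed.

Lemma trunc_log_bound r n : (0 < n)%N -> (trunc_log 2 (n ^ r))%:R <= 2 * r%:R * ln (n%:R : R).
Proof.
move=> n0; set w := trunc_log _ _; have nr0 : (0 < n ^ r)%N by rewrite expn_gt0 n0.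
have h : expR (w%:R * 2^-1) <= expR (r%:R * ln (n%:R : R)).
  rewrite !expRM_natl lnK ?posrE ?ltr0n // -natrX.
  apply: le_trans (_ : 2 ^+ w <= _); last by rewrite -natrX ler_nat; apply: trunc_logP.
  by apply: lerXn2r; rewrite ?nnegrE ?expR_ge0 // expR_half_le2.
by move: h; rewrite ler_expR; lra.
Qed.

Lemma natural_root (n k : nat) : (0 < n)%N -> (0 < k)%N ->
  exists m, [/\ (n <= m ^ k)%N, (m <= n)%N & m%:R <= 2 * (n%:R : R) `^ (k%:R^-1)].
Proof.
move=> n0 k0; have ex : exists m, (n <= m ^ k)%N.
  by exists n; rewrite -[X in (X <= _)%N]expn1 leq_pexp2l.
exists (ex_minn ex); case: ex_minnP => m nm mmin; split=> //.
  by apply: mmin; rewrite -[X in (X <= _)%N]expn1 leq_pexp2l.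
set s := (n%:R : R) `^ _.
have s1 : 1 <= s.
  by rewrite -(powRr0 (n%:R : R)); apply: ler_powR; rewrite ?ler1n // invr_ge0.
have sk : s ^+ k = n%:R.
  rewrite -powR_mulrn ?powR_ge0 // -powRrM mulVf ?powRr1 //.
  by rewrite pnatr_eq0 -lt0n.
case: m nm mmin => [|m] nm mmin; first by rewrite mulr_ge0 // (le_trans ler01).
have : ~~ (n <= m ^ k)%N by apply/negP => /mmin; rewrite ltnn.
rewrite -ltnNge => lt.
have : m%:R < s.
  rewrite ltNge; apply/negP => sm.
  have : s ^+ k <= m%:R ^+ k by apply: lerXn2r; rewrite ?nnegrE // (le_trans ler01).
  by rewrite sk -natrX ler_nat leqNgt lt.
by rewrite -natr1; lra.
Qed.

End Asymptotics.

Lemma exponents_gt0 l r : (1 < l)%N -> (3 < r)%N -> [/\ 0 < (2 * l).-1, 0 < 2 * l & 0 < r]%N.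
Proof. by split; lia. Qed.

(** [p] is quantified after the threshold on [n], so that the bound applies along every sequence of
    probabilities. *)
Lemma turan_ex_whp (R : realType) (l r : nat) : (2 <= l)%N -> (4 <= r)%N ->
  exists C : nat, \forall n \near \oo, forall p eps : R,
    0 <= p <= 1 -> eps = C%:R * (ln (ln n%:R) / ln n%:R) ->
    n%:R `^ (- (r%:R - 2) + (2 * l%:R - 1)^-1 + eps) <= p ->
    1 - n.+1%:R^-1 <= Gnp_prob r p (fun G : {set {set 'I_n}} =>
      (turan_ex G (linear_cycle (2 * l) r))%:R <= p * n%:R `^ (r%:R - 1 + eps)).
Proof.
move=> l2 r4; have [K [K0 HK]] := cycle_free_containers l2 r4.
(* The polylogarithmic factor [A] below is at most [L ^+ K.*2.+1]; one more power of [L] absorbs the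
   constants. *)
pose C := (K.*2.+2)%N; exists C.
pose c := (r ^ r)%N.
near=> n => p eps p01 epsD hp; set L := ln (n%:R : R) in epsD.
have p0 : 0 <= p by case/andP: p01.
have Lc : 4 * c%:R <= L by rewrite /L; near: n; apply: near_ln_ge.
have LK : K%:R <= L by rewrite /L; near: n; apply: near_ln_ge.
have Lr : 2 * r%:R + 1 <= L by rewrite /L; near: n; apply: near_ln_ge.
have L3 : 3 <= L by rewrite /L; near: n; apply: near_ln_ge.
have LC : C%:R ^+ C <= L by rewrite /L; near: n; apply: near_ln_ge.
have L0 : 0 < L by apply: lt_le_trans L3.
have L1 : 1 <= L by apply: le_trans L3; lra.
have n0 : (0 < n)%N.
  by rewrite lt0n; apply/eqP => nz; move: L0; rewrite /L nz ln0 ?ltxx.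
have nR0 : 0 < n%:R :> R by rewrite ltr0n.
have [k0 l0 r0] := exponents_gt0 l2 r4.
have [m0 [nm0 m0n m0s]] := natural_root R n0 k0.
set s := n%:R `^ _ in m0s.
have sE : s = n%:R `^ (2 * l%:R - 1)^-1.
  by rewrite /s -subn1 natrB ?natrM.
have s1 : 1 <= s.
  by rewrite -(powRr0 (n%:R : R)); apply: ler_powR; rewrite ?ler1n // invr_ge0.
pose w := trunc_log 2 (n ^ r).
have nw : (n ^ r < 2 ^ w.+1)%N by apply: trunc_log_ltn.
have WL : w.+1%:R <= L ^+ 2.
  rewrite -natr1; have := trunc_log_bound R r n0; rewrite -/w -/L => wL.
  have : (2 * r%:R + 1) * L <= L * L by apply: ler_wpM2r => //; apply: ltW.
  rewrite expr2 mulrDl mul1r; set u := 2 * r%:R * L in wL *; lra.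
pose A := (K * w.+1 ^ K)%N.
have AL : A%:R <= L ^+ K.*2.+1.
  rewrite /A natrM natrX exprS; apply: ler_pM => //.
  by rewrite -mul2n exprM; apply: lerXn2r; rewrite ?nnegrE ?ler0n // exprn_ge0 // ltW.
have An : (A <= n)%N.
  rewrite -(ler_nat R); apply: le_trans AL _.
  by rewrite -[n%:R]lnK ?posrE // -/L; apply: pow_le_expR.
have [S [S1 S2 S3 S4]] : exists S : {set {set {set 'I_n}}},
   [/\ (#|S| <= 2 ^ (n * m0 * A))%N,
       forall D, D \in S -> (#|D| <= n ^ r.-1 * A)%N,
       forall D, D \in S -> D \subset complete_rgraph 'I_n r
     & forall G : {set {set 'I_n}}, G \subset complete_rgraph 'I_n r ->
         ~~ contains_copy (linear_cycle (2 * l) r) G ->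
         exists2 D, D \in S & (#|G| <= c * #|G :&: D|)%N].
  by have := HK 'I_n w m0; rewrite card_ord; apply.
pose y := p * n%:R ^+ r.-1.
pose X := p * n%:R `^ (r%:R - 1 + eps).
have r1E : r.-1%:R = r%:R - 1 :> R by rewrite -subn1 natrB.
have nN0 : (n%:R == 0 :> R) = false by rewrite gt_eqF.
have powD u v : n%:R `^ (u + v) = n%:R `^ u * n%:R `^ v :> R.
  by rewrite powRD // nN0 implybT.
have epsE : n%:R `^ eps = L ^+ C.
  by rewrite epsD powR_loglog // powR_mulrn // ltW.
have XE : X = y * L ^+ C.
  by rewrite /X powD epsE -r1E powR_mulrn // mulrA.
(* Here the lower bound on [p] enters: it makes [p * n ^ (r - 1)] at least the exponent [n * m0 * A]
   of the number of containers. *)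
have yge : n%:R * s * L ^+ C <= y.
  apply: le_trans (_ : n%:R `^ (- (r%:R - 2) + (2 * l%:R - 1)^-1 + eps) * n%:R ^+ r.-1 <= _).
    rewrite -[n%:R ^+ _]powR_mulrn // r1E sE -epsE -{1}[n%:R]powRr1 // -!powD.
    by rewrite le_eqVlt; apply/orP; left; apply/eqP; congr (_ `^ _); ring.
  by apply: ler_wpM2r => //; rewrite exprn_ge0.
have LC1 : 1 <= L ^+ C by apply: exprn_ege1.
have ny : n%:R <= y.
  apply: le_trans yge; rewrite -mulrA ler_peMr ?ler0n // -[1]mulr1.
  by apply: ler_pM.
have ay : (n * m0 * A)%:R <= y.
  apply: le_trans yge; rewrite (natrM _ _ A) natrM -!mulrA; apply: ler_wpM2l => //.
  apply: le_trans (_ : 2 * s * L ^+ K.*2.+1 <= _); first by apply: ler_pM.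
  rewrite /C [L ^+ K.*2.+2]exprS [2 * s]mulrC -mulrA; apply: ler_wpM2l; first by apply: le_trans s1.
  apply: ler_wpM2r; first by rewrite exprn_ge0 // ltW.
  by lra.
have Lam : 2 * c%:R * (A%:R + 3) <= L ^+ C.
  have h3 : 3 <= L ^+ K.*2.+1.
    by apply: le_trans L3 _; rewrite -[X in X <= _]expr1; apply: ler_weXn2l.
  apply: le_trans (_ : (4 * c%:R) * L ^+ K.*2.+1 <= _); last first.
    by rewrite /C [L ^+ K.*2.+2]exprS; apply: ler_wpM2r; rewrite // exprn_ge0 // ltW.
  apply: le_trans (_ : 2 * c%:R * (2 * L ^+ K.*2.+1) <= _); last by lra.
  apply: ler_wpM2l; first by rewrite mulr_ge0.
  by lra.
have c0 : (0 < c)%N by rewrite expn_gt0 r0.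
have cR0 : 0 < c%:R :> R by rewrite ltr0n.
have y0 : 0 < y by apply: lt_le_trans ny.
have X0 : 0 <= X by rewrite XE mulr_ge0 ?(ltW y0) // (le_trans ler01).
pose m := Num.truncn (X / c%:R).
have /andP[mX Xm] : m%:R <= X / c%:R < m.+1%:R by apply: truncn_itv; rewrite divr_ge0 // ltW.
have cmX : (c * m)%:R <= X by rewrite natrM mulrC -ler_pdivlMr.
have Xcm : X < (c * m.+1)%:R by rewrite natrM mulrC -ltr_pdivrMr.
have SD D : D \in S -> (#|D| <= n ^ r.-1 * A)%N /\ D \subset complete_rgraph 'I_n r.
  by move=> DS; split; [apply: S2 | apply: S3].
have tail := Gnp_turan_tail p01 S1 SD S4 cmX.
have n1 : 1 <= n%:R :> R by rewrite ler1n.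
have pb : p * (n ^ r.-1 * A)%:R <= y * A%:R by rewrite natrM natrX mulrA.
have est := tail_estimate y0 p0 n1 ny ay pb XE Lam c0 Xcm.
have total := @Gnp_prob_split R r n p (fun G => (turan_ex G (linear_cycle (2 * l) r))%:R <= X).
rewrite lerBlDr -[X in X <= _]total lerD2l; set q := Gnp_prob _ _ _ in tail *.
have m20 : 0 < 2 ^+ m :> R by rewrite exprn_gt0.
rewrite -[n.+1%:R^-1]mul1r ler_pdivlMr ?ltr0n // -(ler_pM2r m20) mul1r mulrAC.
by apply: le_trans est; apply: ler_wpM2r.
Unshelve. all: by end_near. Qed.

Theorem theorem3p1 (R : realType) (l r : nat)
    (hl : (2 <= l)%N) (hr : (4 <= r)%N) :
  exists eps1 eps2 : nat -> R,
    [/\ eps1 =O_\oo (fun n : nat => ln (ln n%:R) / ln n%:R : R),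
        eps2 =O_\oo (fun n : nat => ln (ln n%:R) / ln n%:R : R)
      & forall p : nat -> R,
          (forall n, 0 <= p n <= 1) ->
          (\forall n \near \oo,
             n%:R `^ (- (r%:R - 2) + (2 * l%:R - 1)^-1 + eps1 n) <= p n) ->
          (fun n : nat => Gnp_prob r (p n)
             (fun G : {set {set 'I_n}} =>
                (turan_ex G (linear_cycle (2 * l) r))%:R
                  <= p n * n%:R `^ (r%:R - 1 + eps2 n))) @ \oo --> (1 : R)].
Proof.
have [C hC] := turan_ex_whp R hl hr.
pose eps n : R := C%:R * (ln (ln n%:R) / ln n%:R).
have epsO : eps =O_\oo (fun n : nat => ln (ln n%:R) / ln n%:R : R).
  apply/eqO_exP; exists C.+1%:R; first by rewrite ltr0n.
  near=> n; by rewrite /eps normrM ler_wpM2r // ger0_norm // ler_nat leqnSn.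
exists eps, eps; split=> // p p01 hp.
apply: (@squeeze_cvgr _ _ _ _ (fun n => 1 - n.+1%:R^-1) (fun=> 1)).
- near=> n; rewrite Gnp_prob_le1 ?p01 // andbT.
  have h : forall p eps : R, 0 <= p <= 1 -> eps = C%:R * (ln (ln n%:R) / ln n%:R) ->
    n%:R `^ (- (r%:R - 2) + (2 * l%:R - 1)^-1 + eps) <= p ->
    1 - n.+1%:R^-1 <= Gnp_prob r p (fun G : {set {set 'I_n}} =>
      (turan_ex G (linear_cycle (2 * l) r))%:R <= p * n%:R `^ (r%:R - 1 + eps)) by near: n.
  by apply: h => //; near: n.
- rewrite -[X in _ --> X]subr0; apply: cvgB; first exact: cvg_cst.
  exact: cvg_harmonic.
- exact: cvg_cst.
Unshelve. all: by end_near. Qed.
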